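(* Let $X\subset\mathbb{P}^4$ be a smooth quintic threefold over $\mathbb{C}$. Suppose $\mathrm{Aut}(X)$ contains an element of order $13$. Then $\mathrm{Aut}(X)$ is isomorphic to a subgroup of one of the three groups $G_9$, $G_{12}$, $G_{16}$ defined in the context, and $|\mathrm{Aut}(X)|$ is divisible by $3$.
   Context: A smooth quintic threefold is a smooth hypersurface of degree $5$ in $\mathbb{P}^4$; its automorphism group is finite and is identified with $\{\varphi\in\mathrm{PGL}(5,\mathbb{C}) : \varphi(X)=X\}$. $\xi_k=e^{2\pi i/k}$; for a permutation $\sigma$ of $\{1,\dots,5\}$, $P(\sigma)$ is the $5\times5$ matrix whose $(i,\sigma(i))$ entries are $1$ and whose other entries are $0$. The groups are the subgroups of $\mathrm{PGL}(5,\mathbb{C})$ generated by the classes of the following matrices. $G_9$: $P((1\,2\,3))$, $\mathrm{diag}(\xi_{13},\xi_{13}^{-4},\xi_{13}^3,1,1)$, $P((4\,5))$, $\mathrm{diag}(1,1,1,\xi_5,1)$, $\mathrm{diag}(1,1,1,1,\xi_5)$. $G_{12}$: $\mathrm{diag}(\xi_4,1,1,1,1)$, $\mathrm{diag}(\xi_5,\xi_5,1,1,1)$, $P((3\,4\,5))$, $\mathrm{diag}(1,1,\xi_{13},\xi_{13}^{-4},\xi_{13}^3)$. $G_{16}$: $\mathrm{diag}(\xi_{13},\xi_{13}^{-4},\xi_{13}^3,1,1)$, $P((1\,2\,3))$, $P((4\,5))$, $\mathrm{diag}(1,1,1,\xi_3,\xi_3^2)$, $\mathrm{diag}(1,1,1,\xi_5,\xi_5)$.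 *)

(* Defs.v *)
From HB Require Import structures.
From mathcomp Require Import all_boot all_order all_algebra perm.
From mathcomp.classical Require Import boolp classical_sets functions cardinality.
From mathcomp Require Import reals trigo.
From mathcomp.real_closed Require Import complex.
From mathcomp Require Import mpoly.

Set Implicit Arguments.
Unset Strict Implicit.
Unset Printing Implicit Defensive.

Import Order.TTheory GRing.Theory Num.Theory.
Local Open Scope classical_set_scope.
Local Open Scope quotient_scope.
Local Open Scope ring_scope.

Definition GL (K : fieldType) (n : nat) := {A : 'M[K]_n | A \in unitmx}.

HB.instance Definition _ (K : fieldType) (n : nat) := Choice.on (GL K n).
HB.instance Definition _ (K : fieldType) (n : nat) :=
  [isSub of GL K n for @sval _ _].

Definition GL1 (K : fieldType) (n : nat) : GL K n := exist _ 1%:M (unitmx1 K n).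

Lemma GL_mul_subproof (K : fieldType) (n : nat) (A B : GL K n) :
  val A *m val B \in unitmx.
Proof. by rewrite unitmx_mul (valP A) (valP B). Qed.

Definition GL_mul (K : fieldType) (n : nat) (A B : GL K n) : GL K n :=
  exist _ (val A *m val B) (GL_mul_subproof A B).

Lemma GL_inv_subproof (K : fieldType) (n : nat) (A : GL K n) :
  invmx (val A) \in unitmx.
Proof. by rewrite unitmx_inv (valP A). Qed.

Definition GL_inv (K : fieldType) (n : nat) (A : GL K n) : GL K n :=
  exist _ (invmx (val A)) (GL_inv_subproof A).

Lemma GL_mulA (K : fieldType) (n : nat) : associative (@GL_mul K n).
Proof. by move=> A B D; apply/val_inj; exact: mulmxA. Qed.

Lemma GL_mul1 (K : fieldType) (n : nat) : left_id (GL1 K n) (@GL_mul K n).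
Proof. by move=> A; apply/val_inj; exact: mul1mx. Qed.

Lemma GL_mulr1 (K : fieldType) (n : nat) : right_id (GL1 K n) (@GL_mul K n).
Proof. by move=> A; apply/val_inj; exact: mulmx1. Qed.

Lemma GL_mulV (K : fieldType) (n : nat) :
  left_inverse (GL1 K n) (@GL_inv K n) (@GL_mul K n).
Proof. by move=> A; apply/val_inj; exact: mulVmx (valP A). Qed.

Lemma GL_mulrV (K : fieldType) (n : nat) :
  right_inverse (GL1 K n) (@GL_inv K n) (@GL_mul K n).
Proof. by move=> A; apply/val_inj; exact: mulmxV (valP A). Qed.

HB.instance Definition _ (K : fieldType) (n : nat) :=
  isGroup.Build (GL K n) (@GL_mulA K n) (@GL_mul1 K n) (@GL_mulr1 K n)
    (@GL_mulV K n) (@GL_mulrV K n).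

Definition proportional (K : fieldType) (m n : nat) (A B : 'M[K]_(m, n)) : Prop :=
  exists2 c : K, c != 0 & A = c *: B.

Lemma proportional_refl (K : fieldType) (m n : nat) (A : 'M[K]_(m, n)) :
  proportional A A.
Proof. by exists 1; rewrite ?oner_neq0 ?scale1r. Qed.

Lemma proportional_sym (K : fieldType) (m n : nat) (A B : 'M[K]_(m, n)) :
  proportional A B -> proportional B A.
Proof.
move=> [c c0 ->]; exists c^-1; first by rewrite invr_eq0.
by rewrite scalerA mulVf // scale1r.
Qed.

Lemma proportional_trans (K : fieldType) (m n : nat) (A B D : 'M[K]_(m, n)) :
  proportional A B -> proportional B D -> proportional A D.
Proof.
by move=> [c c0 ->] [d d0 ->]; exists (c * d); rewrite ?mulf_neq0 // scalerA.
Qed.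

Lemma proportional_mul (K : fieldType) (m n p : nat) (A A' : 'M[K]_(m, n))
    (B B' : 'M[K]_(n, p)) :
  proportional A A' -> proportional B B' -> proportional (A *m B) (A' *m B').
Proof.
move=> [c c0 ->] [d d0 ->]; exists (c * d); first by rewrite mulf_neq0.
by rewrite -scalemxAl -scalemxAr scalerA.
Qed.

Definition GL_rel (K : fieldType) (n : nat) : rel (GL K n) :=
  fun A B => `[< proportional (val A) (val B) >].

Lemma GL_rel_equiv (K : fieldType) (n : nat) : equiv_class_of (@GL_rel K n).
Proof.
split=> [A|A B|B A D].
- exact/asboolP/proportional_refl.
- by apply/asboolP/asboolP => /proportional_sym.
- by move=> /asboolP AB /asboolP BD; apply/asboolP/(proportional_trans AB BD).
Qed.

Canonical GL_equiv (K : fieldType) (n : nat) := EquivRelPack (@GL_rel_equiv K n).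

Definition PGL (K : fieldType) (n : nat) := {eq_quot @GL_equiv K n}.

HB.instance Definition _ (K : fieldType) (n : nat) := Choice.on (PGL K n).
HB.instance Definition _ (K : fieldType) (n : nat) := EqQuotient.on (PGL K n).

Lemma PGL_piP (K : fieldType) (n : nat) (A B : GL K n) :
  \pi_(PGL K n) A = \pi_(PGL K n) B <-> proportional (val A) (val B).
Proof.
split=> [/eqP|AB]; first by rewrite eqmodE => /asboolP.
by apply/eqP; rewrite eqmodE; apply/asboolP.
Qed.

Definition PGL_one (K : fieldType) (n : nat) : PGL K n := \pi_(PGL K n) (GL1 K n).

Definition PGL_mul (K : fieldType) (n : nat) (f g : PGL K n) : PGL K n :=
  \pi_(PGL K n) (GL_mul (repr f) (repr g)).

Definition PGL_inv (K : fieldType) (n : nat) (f : PGL K n) : PGL K n :=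
  \pi_(PGL K n) (GL_inv (repr f)).

Lemma PGL_repr_pi (K : fieldType) (n : nat) (A : GL K n) :
  proportional (val (repr (\pi_(PGL K n) A))) (val A).
Proof. by apply/PGL_piP; rewrite reprK. Qed.

Lemma PGL_pi_mul (K : fieldType) (n : nat) (A B : GL K n) :
  PGL_mul (\pi_(PGL K n) A) (\pi_(PGL K n) B) = \pi_(PGL K n) (GL_mul A B).
Proof.
by rewrite /PGL_mul; apply/PGL_piP; apply: proportional_mul; exact: PGL_repr_pi.
Qed.

Lemma PGL_pi_inv (K : fieldType) (n : nat) (A : GL K n) :
  PGL_inv (\pi_(PGL K n) A) = \pi_(PGL K n) (GL_inv A).
Proof.
rewrite /PGL_inv; apply/PGL_piP => /=; have [c c0 ->] := PGL_repr_pi A.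
by exists c^-1; rewrite ?invr_eq0 // invmxZ // unitmxZ ?unitfE // (valP A).
Qed.

Lemma PGL_mulA (K : fieldType) (n : nat) : associative (@PGL_mul K n).
Proof.
move=> f g h; rewrite -[f]reprK -[g]reprK -[h]reprK.
rewrite (PGL_pi_mul (repr g) (repr h)) (PGL_pi_mul (repr f) (repr g)).
by rewrite (PGL_pi_mul (repr f)) (PGL_pi_mul _ (repr h)) GL_mulA.
Qed.

Lemma PGL_mul1 (K : fieldType) (n : nat) : left_id (PGL_one K n) (@PGL_mul K n).
Proof. by move=> f; rewrite -[f]reprK PGL_pi_mul GL_mul1. Qed.

Lemma PGL_mulr1 (K : fieldType) (n : nat) : right_id (PGL_one K n) (@PGL_mul K n).
Proof. by move=> f; rewrite -[f]reprK PGL_pi_mul GL_mulr1. Qed.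

Lemma PGL_mulV (K : fieldType) (n : nat) :
  left_inverse (PGL_one K n) (@PGL_inv K n) (@PGL_mul K n).
Proof. by move=> f; rewrite -[f]reprK PGL_pi_inv PGL_pi_mul GL_mulV. Qed.

Lemma PGL_mulrV (K : fieldType) (n : nat) :
  right_inverse (PGL_one K n) (@PGL_inv K n) (@PGL_mul K n).
Proof. by move=> f; rewrite -[f]reprK PGL_pi_inv PGL_pi_mul GL_mulrV. Qed.

HB.instance Definition _ (K : fieldType) (n : nat) :=
  isGroup.Build (PGL K n) (@PGL_mulA K n) (@PGL_mul1 K n) (@PGL_mulr1 K n)
    (@PGL_mulV K n) (@PGL_mulrV K n).

(* [proj K n] is the space of lines in K^n, i.e. projective (n-1)-space. *)
Definition nzvec (K : fieldType) (n : nat) := {x : 'cV[K]_n | x != 0}.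

HB.instance Definition _ (K : fieldType) (n : nat) := Choice.on (nzvec K n).
HB.instance Definition _ (K : fieldType) (n : nat) :=
  [isSub of nzvec K n for @sval _ _].

Definition nzvec_rel (K : fieldType) (n : nat) : rel (nzvec K n) :=
  fun x y => `[< proportional (val x) (val y) >].

Lemma nzvec_rel_equiv (K : fieldType) (n : nat) : equiv_class_of (@nzvec_rel K n).
Proof.
split=> [x|x y|y x z].
- exact/asboolP/proportional_refl.
- by apply/asboolP/asboolP => /proportional_sym.
- by move=> /asboolP xy /asboolP yz; apply/asboolP/(proportional_trans xy yz).
Qed.

Canonical nzvec_equiv (K : fieldType) (n : nat) :=
  EquivRelPack (@nzvec_rel_equiv K n).

Definition proj (K : fieldType) (n : nat) := {eq_quot @nzvec_equiv K n}.

HB.instance Definition _ (K : fieldType) (n : nat) := Choice.on (proj K n).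
HB.instance Definition _ (K : fieldType) (n : nat) := EqQuotient.on (proj K n).

Lemma proj_piP (K : fieldType) (n : nat) (x y : nzvec K n) :
  \pi_(proj K n) x = \pi_(proj K n) y <-> proportional (val x) (val y).
Proof.
split=> [/eqP|xy]; first by rewrite eqmodE => /asboolP.
by apply/eqP; rewrite eqmodE; apply/asboolP.
Qed.

Lemma proj_repr_pi (K : fieldType) (n : nat) (x : nzvec K n) :
  proportional (val (repr (\pi_(proj K n) x))) (val x).
Proof. by apply/proj_piP; rewrite reprK. Qed.

Lemma GL_act_subproof (K : fieldType) (n : nat) (A : GL K n) (x : nzvec K n) :
  val A *m val x != 0.
Proof.
apply: contra_neq (valP x) => Ax0.
by rewrite -[LHS](mulKmx (valP A)) Ax0 mulmx0.
Qed.

Definition GL_act (K : fieldType) (n : nat) (A : GL K n) (x : nzvec K n) :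
  nzvec K n := exist _ (val A *m val x) (GL_act_subproof A x).

Definition PGL_act (K : fieldType) (n : nat) (f : PGL K n) (p : proj K n) :
  proj K n := \pi_(proj K n) (GL_act (repr f) (repr p)).

Lemma PGL_act_pi (K : fieldType) (n : nat) (A : GL K n) (x : nzvec K n) :
  PGL_act (\pi_(PGL K n) A) (\pi_(proj K n) x) = \pi_(proj K n) (GL_act A x).
Proof.
rewrite /PGL_act; apply/proj_piP; apply: proportional_mul.
  exact: PGL_repr_pi.
exact: proj_repr_pi.
Qed.

Definition hcoord (K : fieldType) (n : nat) (p : proj K n) : 'I_n -> K :=
  fun i => val (repr p) i ord0.

Definition zero_locus (K : fieldType) (n : nat) (F : {mpoly K[n]}) :
  set (proj K n) := [set p | F.@[hcoord p] = 0].

(* Smoothness is the Jacobian criterion; as F is homogeneous, neither condition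
   depends on the representatives chosen by [hcoord]. *)
Definition smooth_hypersurface (K : fieldType) (n d : nat) (X : set (proj K n)) :
  Prop :=
  exists F : {mpoly K[n]},
    [/\ F != 0, F \is d.-homog, X = zero_locus F &
        forall p, X p -> exists i : 'I_n, (mderiv i F).@[hcoord p] != 0].

Definition Aut_hyp (K : fieldType) (n : nat) (X : set (proj K n)) :
  set (PGL K n) := [set f | PGL_act f @` X = X].

Definition is_subgroup (G : groupType) (H : set G) : Prop := group_closed (mem H).

Definition has_order (G : groupType) (x : G) (k : nat) : Prop :=
  [/\ (0 < k)%N, (x ^+ k = 1)%g &
      forall m, (0 < m < k)%N -> (x ^+ m <> 1)%g].

Definition isomorphic (G G' : groupType) (H : set G) (H' : set G') : Prop :=
  exists2 f : G -> G', set_bij H H' f &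
    {in H &, {morph f : x y / (x * y)%g >-> (x * y)%g}}.

(* A singular matrix is sent to 1; this is only used for invertible ones. *)
Definition PGL_class (K : fieldType) (n : nat) (M : 'M[K]_n) : PGL K n :=
  \pi_(PGL K n) (insubd (1%g : GL K n) M).

Definition PGL_gen (K : fieldType) (n : nat) (s : seq 'M[K]_n) : set (PGL K n) :=
  smallest (@is_subgroup (PGL K n)) [set PGL_class M | M in [set` s]].

Definition xi (R : realType) (k : nat) : R[i] :=
  Complex (cos (2 * pi / k%:R)) (sin (2 * pi / k%:R)).

Definition diag5 (K : fieldType) (a b c d e : K) : 'M[K]_5 :=
  diag_mx (\row_(i < 5) [:: a; b; c; d; e]`_i).

(* The indices 1, ..., 5 of the usual notation are 0, ..., 4 here.
   [perm_mx s] has its 1s at the entries (i, s i). *)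
Definition cyc3 (n : nat) (i j k : 'I_n) : 'S_n := (tperm i j * tperm i k)%g.

Lemma cyc3E (n : nat) (i j k : 'I_n) : uniq [:: i; j; k] ->
  [/\ cyc3 i j k i = j, cyc3 i j k j = k & cyc3 i j k k = i].
Proof.
rewrite /= !inE negb_or andbT => /andP[/andP[ij ik] jk].
rewrite /cyc3 !permM tpermL tpermR (tpermD ik jk) tpermL tpermR.
by split => //; rewrite tpermD // eq_sym.
Qed.

Definition P123 (K : fieldType) : 'M[K]_5 :=
  perm_mx (cyc3 (inord 0) (inord 1) (inord 2)).
Definition P345 (K : fieldType) : 'M[K]_5 :=
  perm_mx (cyc3 (inord 2) (inord 3) (inord 4)).
Definition P45 (K : fieldType) : 'M[K]_5 :=
  perm_mx (tperm (inord 3) (inord 4)).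

Definition G9_gens (R : realType) : seq 'M[R[i]]_5 :=
  [:: P123 _;
      diag5 (xi R 13) (xi R 13 ^- 4) (xi R 13 ^+ 3) 1 1;
      P45 _;
      diag5 1 1 1 (xi R 5) 1;
      diag5 1 1 1 1 (xi R 5)].

Definition G12_gens (R : realType) : seq 'M[R[i]]_5 :=
  [:: diag5 (xi R 4) 1 1 1 1;
      diag5 (xi R 5) (xi R 5) 1 1 1;
      P345 _;
      diag5 1 1 (xi R 13) (xi R 13 ^- 4) (xi R 13 ^+ 3)].

Definition G16_gens (R : realType) : seq 'M[R[i]]_5 :=
  [:: diag5 (xi R 13) (xi R 13 ^- 4) (xi R 13 ^+ 3) 1 1;
      P123 _;
      P45 _;
      diag5 1 1 1 (xi R 3) (xi R 3 ^+ 2);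
      diag5 1 1 1 (xi R 5) (xi R 5)].

Definition G9 (R : realType) : set (PGL R[i] 5) := PGL_gen (G9_gens R).
Definition G12 (R : realType) : set (PGL R[i] 5) := PGL_gen (G12_gens R).
Definition G16 (R : realType) : set (PGL R[i] 5) := PGL_gen (G16_gens R).

Arguments G9 R _ : clear implicits.
Arguments G12 R _ : clear implicits.
Arguments G16 R _ : clear implicits.

Lemma xi_neq0 (R : realType) (k : nat) : xi R k != 0.
Proof.
apply/negP => /eqP [c0 s0]; have := cos2Dsin2 (2 * pi / k%:R : R).
by rewrite c0 s0 !expr0n /= addr0 => /eqP; rewrite eq_sym oner_eq0.
Qed.

Lemma diag5_unit (K : fieldType) (a b c d e : K) :
  a != 0 -> b != 0 -> c != 0 -> d != 0 -> e != 0 -> diag5 a b c d e \in unitmx.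
Proof.
move=> a0 b0 c0 d0 e0; rewrite unitmxE det_diag unitfE.
by rewrite !big_ord_recr big_ord0 /= !mxE /= mul1r !mulf_neq0.
Qed.

Lemma gens_unit (R : realType) (M : 'M[R[i]]_5) :
  M \in G9_gens R ++ G12_gens R ++ G16_gens R -> M \in unitmx.
Proof.
by rewrite !(mem_cat, inE) -!orbA => H; do !case/predU1P: H => [->|H];
  rewrite ?(eqP H) ?unitmx_perm ?diag5_unit ?invr_eq0 ?expf_neq0 ?xi_neq0
    ?oner_neq0.
Qed.

(* Main.v *)
(** Let [F] be the quintic form of [X]. An automorphism lifts to a matrix [A] such that [F]
    and [F o A] have the same zeros, and comparing both on a line that meets [X] transversally
    shows [F o A = c F]. The eigenvalue weights modulo 13 of a lift of order 13 are forced, by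
    smoothness, to be [(1, -4, 3, 0, 0)], so in suitable coordinates
    [F = x^4 y + y^4 w + w^4 x + x y w q(t, s) + f(t, s)] with [f] a smooth binary quintic.

    The Hessian matrix of [F] has rank at most 2 on the line [x = y = w = 0], and there are few
    other points where this happens; hence every [A] preserves the decomposition of the
    coordinates into [(x, y, w)] and [(t, s)]. On the first block the Hessian determinant of
    [x^4 y + y^4 w + w^4 x] is singular only at the coordinate points, so [A] permutes them and
    is a power of the cyclic permutation times a power of [diag(z, z^-4, z^3)], up to a scalar.
    The second block is an element of the stabilizer of [f], which is contained in that of one of
    [t^5 + s^5], [t^5 + t s^4] (up to coefficients) and [t^4 s + t s^4], or is generated by
    scalars and one involution; these cases give [G9], [G12], [G16] and again [G12].

    In these coordinates the cyclic permutation of [x, y, w] preserves [F], whence the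
    factor 3 of the order. *)

From HB Require Import structures.
From mathcomp Require Import all_fingroup all_solvable.
Require Import Defs.
From mathcomp Require Import all_boot all_order all_algebra all_field.
From mathcomp.classical Require Import boolp classical_sets functions cardinality.
From mathcomp Require Import reals trigo.
From mathcomp.real_closed Require Import complex.
From mathcomp Require Import finmap ring mpoly zify.

Set Implicit Arguments.
Unset Strict Implicit.
Unset Printing Implicit Defensive.

Import Order.TTheory GRing.Theory Num.Theory.
Local Open Scope ring_scope.

(** * Forms with the same zeros *)

(** The proportionality step uses polynomials in one variable only. On a separable line the simple
    zeros determine the restricted form up to a factor, and this factor is the quotient of the two
    leading coefficients, which depends on the direction of the line and not on its base point.
    Genericity of such lines comes from a resultant over [K[s]]. The numbers come from the cycle x^4
    y, y^4 w, w^4 x: a diagonal matrix with first entry d fixes it exactly when the others are d^-4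
    and d^16 and d^65 = 1, with 65 = 4^3 + 1. Scalars account for the factor 5 and leave 13.
    Multiplication by -4 has order 3 modulo 13, whence the weights 1, 9, 3. The obstacle is the
    locus where the Hessian has rank at most 2: where x y w is nonzero it depends on q and f, and it
    is not computed. It suffices to study a whole line inside it, the image of x = y = w = 0. This
    image meets the original line; if it left that line, kernel vectors of the Hessian would express
    the ratios of consecutive Klein monomials as squares of roots of r^2 + 4 r + 1. These squares
    have product 1, which no choice of roots allows. *)

Section PolyPoly.
Variable K : numClosedFieldType.
Implicit Types (P q w : {poly {poly K}}) (c : {poly K}).

(** A [{poly {poly K}}] is read as a polynomial in an outer variable t with coefficients in [K[s]];
    this is its restriction to a fixed s. *)
Definition fiber (s : K) P : {poly K} := map_poly (horner_eval s) P.

Lemma fiberM s P q : fiber s (P * q) = fiber s P * fiber s q.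
Proof. exact: rmorphM. Qed.

Lemma fiberE s t P : (fiber s P).[t] = P.[t%:P].[s].
Proof. by rewrite /fiber -[t in LHS](hornerC t s) -/(horner_eval s _) horner_map. Qed.

Lemma fiber_eq0 s P : fiber s P = 0 -> exists P1, P = ('X - s%:P)%:P * P1.
Proof.
move=> P0; exists (\poly_(i < size P) (P`_i %/ ('X - s%:P))).
apply/polyP => i; rewrite coefCM coef_poly.
case: ltnP => [lti|lei]; last by rewrite mulr0 nth_default.
rewrite mulrC divpK // dvdp_XsubCl.
by rewrite /root -/(horner_eval s _) -coef_map -/(fiber s P) P0 coef0.
Qed.

(** Gauss's lemma for a square factor. At a root z of [c] the fibre of [q * w ^+ 2] is zero, and
    [K[t]] is a domain, so s - z divides [q] or [w]; it is cancelled and the degree of [c] drops. *)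
Lemma square_factor_clear c P q w : c != 0 -> c%:P * P = q * w ^+ 2 ->
  exists q1 w1, P = q1 * w1 ^+ 2 /\ size w1 = size w.
Proof.
have [n] := ubnP (size c); elim: n c q w => // n IHn c q w /ltnSE lec c0 Dc.
have [/eqP/size_poly1P[a a0 Da]|sc] := eqVneq (size c) 1%N.
  exists ((a^-1)%:P%:P * q), w; split=> //.
  by rewrite -mulrA -Dc Da mulrA -!polyCM mulVf ?mul1r.
have /closed_rootP[z /factor_theorem[c1 Dc1]] := sc.
have c10 : c1 != 0 by apply: contraNneq c0; rewrite Dc1 => ->; rewrite mul0r.
have X0 : ('X - z%:P)%:P != 0 :> {poly {poly K}}.
  by rewrite polyC_eq0 polyXsubC_eq0.
have lec1 : (size c1 < n)%N.
  by apply: leq_trans lec; rewrite Dc1 size_Mmonic ?monicXsubC // size_XsubC addn2.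
have : fiber z (q * w ^+ 2) = 0.
  by rewrite -Dc fiberM {1}/fiber map_polyC /= /horner_eval Dc1 !hornerE subrr
             mulr0 mul0r.
rewrite fiberM => /eqP; rewrite mulf_eq0 => /orP[/eqP/fiber_eq0[q1 Dq]|].
  apply: (IHn c1 q1 w) => //; apply: (mulfI X0).
  by rewrite mulrA -polyCM [_ * c1]mulrC -Dc1 Dc Dq -mulrA.
(* Here s - z divides [w], hence occurs twice: one copy cancels against [c], the other goes into
   [q]. *)
rewrite {1}/fiber rmorphXn expf_eq0 /= => /eqP/fiber_eq0[w1 Dw].
have -> : size w = size w1 by rewrite Dw mul_polyC size_scale // -polyC_eq0.
apply: (IHn c1 (('X - z%:P)%:P * q) w1) => //; apply: (mulfI X0).
rewrite mulrA -polyCM [_ * c1]mulrC -Dc1 Dc Dw; ring.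
Qed.

Lemma coef_deriv_lead P : (1 < size P)%N -> P^`()`_(size P).-2 != 0.
Proof.
move=> sP; rewrite coef_deriv prednK -?subn1 ?subn_gt0 // subn1 -/(lead_coef P).
have P0 : lead_coef P != 0 by rewrite lead_coef_eq0 -size_poly_gt0 ltnW.
have n0 : ((size P).-1%:R : {poly K}) != 0.
  by rewrite -(rmorph_nat (@polyC K)) polyC_eq0 pnatr_eq0 -lt0n -subn1 subn_gt0.
by rewrite -mulr_natr mulf_neq0.
Qed.

Lemma deriv_neq0 P : (1 < size P)%N -> P^`() != 0.
Proof. by move/coef_deriv_lead; apply: contraNneq => ->; rewrite coef0. Qed.

Lemma size_deriv_gt1 P : (2 < size P)%N -> (1 < size P^`())%N.
Proof.
move=> sP; have /coef_deriv_lead := ltnW sP; apply: contraNltn => sD.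
by rewrite nth_default // (leq_trans sD) // -!subn1 -subnDA subn_gt0.
Qed.

(* A repeated factor of [P] over [K(s)] can be chosen in [K[s][t]]; it then has
   a root on the fibre [s = 0], where all partial derivatives of [P] vanish. *)
Lemma generic_fiber_separable P (c : K) : c != 0 -> lead_coef P = c%:P -> (2 < size P)%N ->
  (forall t, P.[t%:P].[0] = 0 -> P^`().[t%:P].[0] = 0 ->
     (P.[t%:P])^`().[0] != 0) ->
  exists2 D : {poly K}, D != 0 &
    forall s, D.[s] != 0 -> coprimep (fiber s P) (fiber s P)^`().
Proof.
move=> c0 Dc sP reg.
have P0 : P != 0 by rewrite -lead_coef_eq0 Dc polyC_eq0.
have sepP : coprimep P P^`().
  suff: separable_poly P by rewrite unlock.
  apply/separable_polyP; split=> [|u _]; last exact: deriv_neq0.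
  apply/poly_square_freeP => w sw; apply/negP.
  (* Division over [K[s]] is pseudo-division: a power [a] of the leading coefficient of the divisor
     appears, and is cleared afterwards. *)
  rewrite Pdiv.Idomain.dvdp_eq; set a := _ ^+ _ => /eqP Da.
  have a0 : a != 0.
    have [w0|w0] := eqVneq w 0; last by rewrite expf_neq0 // lead_coef_eq0 expf_neq0.
    by rewrite /a w0 expr0n scalp0 expr0 oner_eq0.
  move: Da; rewrite -mul_polyC => /(square_factor_clear a0)[q [w1 [DP sw1]]].
  have : lead_coef q * lead_coef w1 ^+ 2 = c%:P.
    by rewrite -Dc DP lead_coefM lead_coef_exp.
  (* The leading coefficient of [P] is constant, so that of [w1] cannot vanish at 0; the fibre of
     [w1] at 0 keeps its degree and has a root. *)
  move=> Dl; have lw0 : (lead_coef w1).[0] != 0.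
    apply: contraNneq c0 => l0; move/(congr1 (horner^~ 0)): Dl.
    by rewrite hornerM horner_exp l0 expr0n mulr0 hornerC => <-.
  have [t /rootP] : exists t, root (fiber 0 w1) t.
    by apply/closed_rootP; rewrite size_map_poly_id0 ?sw1.
  rewrite fiberE => w1t; move: (reg t); rewrite DP expr2 !(derivM, hornerM, hornerD) w1t.
  by rewrite !(mulr0, mul0r, addr0) eqxx => /(_ erefl erefl).
(* The resultant is a combination of [P] and its derivative; where it is nonzero, this combination
   specializes to a Bezout relation on the fibre. *)
pose D := resultant P P^`().
exists D => [|s]; first by rewrite /D resultant_eq0 (eqP sepP).
have [[u v] /= _ Duv] := resultant_in_ideal (ltnW sP) (size_deriv_gt1 sP).
move=> Ds; apply/Bezout_coprimepP; exists (fiber s u, fiber s v) => /=.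
rewrite /fiber deriv_map -!rmorphM -rmorphD /= -Duv map_polyC /= /horner_eval.
by rewrite polyC_eqp1.
Qed.
End PolyPoly.

Section Lines.
Variables (K : numClosedFieldType) (n : nat).
Implicit Types (F : {mpoly K[n]}) (v w : 'cV[K]_n).

Definition ev F v : K := F.@[fun i => v i ord0].

Definition grad F v : 'rV[K]_n := \row_i ev (mderiv i F) v.

(** The coefficient ring is left open: S = K gives one line, S = K[s] gives a pencil of parallel
    lines in a plane. *)
Definition line (S : comNzRingType) (c : {rmorphism K -> S}) (a : 'I_n -> S) v F :=
  mmap (@polyC S \o c) (fun i => (a i)%:P + (c (v i ord0))%:P * 'X) F.

(** A formal degree: the coefficient [c] may be 0, which makes the notion multiplicative over any
    commutative ring. *)
Definition top_coef (S : comNzRingType) (p : {poly S}) k (c : S) : Prop :=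
  (size p <= k.+1)%N /\ p`_k = c.

Lemma top_coefM (S : comNzRingType) (p q : {poly S}) k l (c d : S) :
  top_coef p k c -> top_coef q l d -> top_coef (p * q) (k + l) (c * d).
Proof.
move=> [sp <-] [sq <-]; split.
  apply: leq_trans (size_polyMleq _ _) _.
  by rewrite -subn1 leq_subLR add1n -addSn -addnS leq_add.
have kl : (k < (k + l).+1)%N by rewrite ltnS leq_addr.
rewrite coefM (bigD1 (Ordinal kl)) //= addKn.
rewrite big1 ?addr0 // => i; rewrite -val_eqE /= => ik.
have [lik|lki|eik] := ltngtP i k; last by rewrite eik eqxx in ik.
  rewrite [q`__]nth_default ?mulr0 // (leq_trans sq) //.
  by rewrite ltn_subRL ltn_add2r.
by rewrite [p`__]nth_default ?mul0r // (leq_trans sp).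
Qed.

Lemma top_coef_line (S : comNzRingType) (c : {rmorphism K -> S}) a v F d :
  F \is d.-homog -> top_coef (line c a v F) d (c (ev F v)).
Proof.
move=> /dhomogP hF; rewrite /line /mmap /ev mevalE rmorph_sum.
rewrite big_seq [X in top_coef _ _ X]big_seq.
apply: (big_ind2 (fun p x => top_coef p d x)) => [|p1 c1 p2 c2 [s1 <-] [s2 <-]|m mF].
- by split; rewrite ?size_poly0 ?coef0.
- by split; rewrite ?coefD // (leq_trans (size_polyD _ _)) // geq_max s1.
have hm : mdeg m = d := hF m mF.
rewrite rmorphM -hm -[mdeg m]add0n; apply: top_coefM.
  by split; rewrite ?coefC // size_polyC; case: (_ != _).
rewrite rmorph_prod mdegE /mmap1; elim/big_ind3: _ => [|p1 c1 k1 p2 c2 k2|i _].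
- by split; rewrite ?size_poly1 ?coef1.
- exact: top_coefM.
rewrite rmorphXn; elim: (m i) => [|k IHk].
  by rewrite !expr0; split; rewrite ?size_poly1 ?coef1.
rewrite !exprS -[k.+1]add1n; apply: top_coefM IHk; split.
  rewrite (leq_trans (size_polyD _ _)) // geq_max size_polyC.
  rewrite (leq_trans (size_polyMleq _ _)) ?size_polyX ?size_polyC; last first.
    by rewrite addn2 /=; case: (_ != _).
  by case: (_ != _).
by rewrite coefD coefC coefCM coefX /= mulr1 add0r.
Qed.

Lemma horner_line (S : comNzRingType) (c : {rmorphism K -> S}) a v F x :
  (line c a v F).[x] = mmap c (fun i => a i + c (v i ord0) * x) F.
Proof.
rewrite /line /mmap horner_sum; apply: eq_bigr => m _.
rewrite hornerM hornerC /mmap1 horner_prod; congr (_ * _); apply: eq_bigr => i _.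
by rewrite horner_exp !hornerE.
Qed.

Lemma deriv_line a v F :
  (line idfun a v F)^`() = \sum_i v i ord0 *: line idfun a v (mderiv i F).
Proof.
pose L := mmap (@polyC K \o idfun) (fun i => (a i)%:P + (v i ord0)%:P * 'X).
pose P G := (L G)^`() = \sum_i v i ord0 *: L (mderiv i G).
have PM G H : P G -> P H -> P (G * H).
  rewrite /P /L rmorphM derivM => -> ->.
  rewrite mulr_suml mulr_sumr -big_split; apply: eq_bigr => i _ /=.
  by rewrite mderivM rmorphD !rmorphM /= scalerDr -scalerAl -scalerAr.
have PC c : P c%:MP.
  rewrite /P /L mmapC derivC big1 // => i _.
  by rewrite mderivC rmorph0 scaler0.
have PX i : P 'X_i.
  rewrite /P /L mmapX mmap1U derivD derivC mul_polyC derivZ derivX add0r (bigD1 i) //= big1.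
    have UU : (U_(i) - U_(i))%MM = 0%MM :> 'X_{1..n}.
      by apply/mnmP => j; rewrite mnmBE subnn mnm0E.
    by rewrite mderivX mnm1E eqxx scale1r UU mmapX mmap11 addr0.
  by move=> j ij; rewrite mderivX mnm1E eq_sym (negPf ij) scale0r rmorph0 scaler0.
have PD G H : P G -> P H -> P (G + H).
  rewrite /P /L rmorphD derivD => -> ->; rewrite -big_split; apply: eq_bigr => i _ /=.
  by rewrite mderivD rmorphD scalerDr.
rewrite -/(P F) [F]mpolyE; apply: (big_ind P) => [|G H|m _]; [exact: (PC 0) | exact: PD |].
rewrite -mul_mpolyC mpolyXE_id; apply: (PM _ _ (PC _)).
apply: (big_ind P) => [|G H|i _]; [exact: (PC 1) | exact: PM |].
by elim: (m i) => [|k IHk]; [exact: (PC 1) | rewrite exprS; apply: PM].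
Qed.

Definition ln v w F : {poly K} := line idfun (fun i => v i ord0) w F.

Lemma horner_ln v w F t : (ln v w F).[t] = ev F (v + t *: w).
Proof. rewrite horner_line -/(meval _ F); apply: meval_eq => i.
by rewrite !mxE mulrC. Qed.

Lemma deriv_ln v w F t : (ln v w F)^`().[t] = (grad F (v + t *: w) *m w) ord0 ord0.
Proof.
rewrite deriv_line horner_sum mxE; apply: eq_bigr => i _.
by rewrite hornerZ -/(ln v w _) horner_ln mxE mulrC.
Qed.

Lemma ev_homog F d c v : F \is d.-homog -> ev F (c *: v) = c ^+ d * ev F v.
Proof.
move=> /dhomogP hF; rewrite /ev !mevalE mulr_sumr big_seq [RHS]big_seq.
apply: eq_bigr => m /hF mF; have <- : mdeg m = d := mF.
rewrite mulrCA; congr (_ * _); rewrite mdegE -prodrXr -big_split; apply: eq_bigr => i _ /=.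
by rewrite mxE exprMn.
Qed.
End Lines.

Section ZeroLocus.
Variables (K : numClosedFieldType) (n : nat).
Implicit Types (F : {mpoly K[n]}) (v w : 'cV[K]_n) (A : 'M[K]_n).

Lemma poly_ext (p q : {poly K}) : (forall t, p.[t] = q.[t]) -> p = q.
Proof.
move=> pq; apply/eqP; rewrite -subr_eq0; apply/negPn/negP => /closed_nonrootP[t].
by rewrite /root hornerD hornerN pq subrr eqxx.
Qed.

(** If [w] serves for the tail and [u] for the head, every functional restricts to a nonzero
    polynomial on the line [w + t *: u]; a non-root of the product serves for all. *)
Lemma avoid_hyperplanes (s : seq 'rV[K]_n) : all (fun r => r != 0) s ->
  exists w, all (fun r : 'rV_n => (r *m w) ord0 ord0 != 0) s.
Proof.
elim: s => [|r s IHs] /=; first by exists 0.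
case/andP=> r0 /IHs[w ws].
have [i ri] : exists i, r ord0 i != 0 by apply/rV0Pn.
pose u : 'cV[K]_n := delta_mx i ord0.
have ru : (r *m u) ord0 ord0 = r ord0 i.
  rewrite mxE (bigD1 i) //= big1 ?addr0 => [|j ji]; rewrite !mxE ?eqxx ?mulr1 //.
  by rewrite (negPf ji) mulr0.
pose p (r' : 'rV[K]_n) := ((r' *m w) ord0 ord0)%:P + ((r' *m u) ord0 ord0)%:P * 'X.
have pn0 (r' : 'rV[K]_n) : ((r' *m w) ord0 ord0 != 0) || ((r' *m u) ord0 ord0 != 0) -> p r' != 0.
  apply: contraLR; rewrite negbK => /eqP p0; rewrite negb_or !negbK.
  have := coef0 K 0; have := coef0 K 1; rewrite -p0 !coefD !coefC !coefCM !coefX /=.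
  by rewrite mulr0 mulr1 addr0 add0r => -> ->; rewrite eqxx.
have : \prod_(r' <- r :: s) p r' != 0.
  rewrite prodf_seq_neq0 /= pn0 ?ru ?ri ?orbT //=.
  by apply/allP => r' r's; rewrite pn0 // (allP ws _ r's).
case/closed_nonrootP => t; rewrite /root horner_prod prodf_seq_neq0 => /allP h.
exists (w + t *: u); rewrite -[X in is_true X]/(all _ (r :: s)); apply/allP => r' /h.
rewrite /p /= !hornerE mulmxDr -scalemxAr => h'; rewrite [X in X != _]mxE.
by rewrite [in X in _ + X]mxE mulrC.
Qed.

Lemma ln_top v w F d : F \is d.-homog -> ev F w != 0 ->
  size (ln v w F) = d.+1 /\ lead_coef (ln v w F) = ev F w.
Proof.
move=> hF Fw; have [sl cl] : top_coef (ln v w F) d (ev F w) := top_coef_line idfun _ w hF.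
have sE : size (ln v w F) = d.+1.
  by apply/eqP; rewrite eqn_leq sl ltnNge; apply: contraNN Fw => h; rewrite -cl nth_default.
by rewrite /lead_coef sE.
Qed.

Definition smooth F := forall v, v != 0 -> ev F v = 0 -> grad F v != 0.

(** In the plane with coordinates (s, t) the restriction of [F] has the constant leading coefficient
    [ev F v] in t. The hypothesis says that the plane curve is smooth wherever the line s = 0 is
    tangent to it, so almost all parallel lines are transversal. *)
Lemma generic_line_separable F d v a w :
  F \is d.-homog -> (1 < d)%N -> ev F v != 0 ->
  (forall t, ev F (a + t *: v) = 0 -> (grad F (a + t *: v) *m v) ord0 ord0 = 0 ->
     (grad F (a + t *: v) *m w) ord0 ord0 != 0) ->
  exists2 D : {poly K}, D != 0 &
    forall s, D.[s] != 0 ->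
      coprimep (ln (a + s *: w) v F) (ln (a + s *: w) v F)^`().
Proof.
move=> hF d1 Fv reg.
pose P := line (@polyC K) (fun i => (a i ord0)%:P + (w i ord0)%:P * 'X) v F.
have PE s t : P.[t%:P].[s] = ev F (a + s *: w + t *: v).
  rewrite /P horner_line /mmap horner_sum /ev mevalE; apply: eq_bigr => m _.
  rewrite hornerM hornerC /mmap1 horner_prod; congr (_ * _); apply: eq_bigr => i _.
  by rewrite horner_exp !hornerE !mxE [s * _]mulrC [t * _]mulrC.
have fibE s : fiber s P = ln (a + s *: w) v F.
  by apply: poly_ext => t; rewrite fiberE PE horner_ln.
have secE t : P.[t%:P] = ln (a + t *: v) w F.
  by apply: poly_ext => s; rewrite PE horner_ln addrAC.
have [sP cP] := top_coef_line (@polyC K) (fun i => (a i ord0)%:P + (w i ord0)%:P * 'X) v hF.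
have sPE : size P = d.+1.
  apply/eqP; rewrite eqn_leq sP ltnNge; apply: contraNN Fv => h.
  by rewrite -polyC_eq0 -cP nth_default.
have [|||D D0 HD] := @generic_fiber_separable K P (ev F v) Fv.
- by rewrite /lead_coef sPE.
- by rewrite sPE.
- move=> t; rewrite -!fiberE /fiber -deriv_map -/(fiber 0 P) fibE scale0r addr0.
  by rewrite horner_ln deriv_ln secE deriv_ln scale0r addr0; apply: reg.
by exists D => // s /HD; rewrite fibE.
Qed.

(** The zeros of [F] on a separable line are simple and are zeros of [F] composed with [A]; equal
    degrees make the two restrictions proportional. The factor is a ratio of leading coefficients,
    hence depends on [v] and not on [b]. *)
Lemma separable_line_prop F d A b v :
  F \is d.-homog -> ev F v != 0 ->
  (forall u, ev F u = 0 <-> ev F (A *m u) = 0) ->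
  coprimep (ln b v F) (ln b v F)^`() ->
  forall t, ev F (A *m (b + t *: v)) = ev F (A *m v) / ev F v * ev F (b + t *: v).
Proof.
move=> hF Fv zA sep t; set p := ln b v F; set g := ln (A *m b) (A *m v) F.
have FAv : ev F (A *m v) != 0 by apply: contra_neq Fv => /(zA v).2.
have [sp lp] := ln_top b hF Fv; have [sg lg] := ln_top (A *m b) hF FAv.
have [rs Dp] := closed_field_poly_normal p.
have urs : uniq rs.
  rewrite -separable_prod_XsubC.
  have /eqp_separable <- : lead_coef p *: \prod_(z <- rs) ('X - z%:P) %= \prod_(z <- rs) ('X - z%:P).
    by rewrite eqp_scale // lp.
  by rewrite -Dp unlock.
have : \prod_(z <- rs) ('X - z%:P) %| g.
  apply: uniq_roots_dvdp; last by rewrite uniq_rootsE.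
  apply/allP => z zrs; apply/rootP; rewrite horner_ln scalemxAr -mulmxDr; apply: (zA _).1.
  rewrite -horner_ln -/p Dp; apply/rootP; rewrite rootZ ?lp //.
  by rewrite root_prod_XsubC.
have lp0 : lead_coef p != 0 by rewrite lp.
rewrite -(eqp_dvdl _ (eqp_scale _ lp0)) -Dp => pg.
have : p %= g by rewrite -dvdp_size_eqp // sp sg.
case/eqpP=> [[c1 c2] /= /andP[c10 c20] Dg].
have Dl : c1 * ev F v = c2 * ev F (A *m v) by rewrite -lp -lg -!lead_coefZ Dg.
rewrite mulmxDr -scalemxAr -!horner_ln -/p -/g.
apply: (mulfI c20); rewrite -hornerZ -Dg hornerZ !mulrA -Dl mulfK //.
Qed.

Lemma smooth_nonzero (i0 : 'I_n) F d : F \is d.-homog -> smooth F ->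
  exists v, ev F v != 0.
Proof.
move=> hF smF; pose e i : 'cV[K]_n := delta_mx i ord0.
have [F0|] := eqVneq (ev F (e i0)) 0; last by exists (e i0).
have e0 : e i0 != 0 by apply/cV0Pn; exists i0; rewrite !mxE !eqxx oner_eq0.
have /rV0Pn[i gi] := smF _ e0 F0.
have : ln (e i0) (e i) F != 0.
  apply: contraNneq gi => l0; have := deriv_ln (e i0) (e i) F 0.
  by rewrite scale0r addr0 -colE mxE l0 deriv0 horner0 => <-.
by case/closed_nonrootP=> t; rewrite /root horner_ln; exists (e i0 + t *: e i).
Qed.

Lemma same_zeros_prop F d A : (1 < n)%N ->
  F \is d.-homog -> (1 < d)%N -> smooth F ->
  (forall v, ev F v = 0 <-> ev F (A *m v) = 0) ->
  exists2 c, c != 0 & forall v, ev F (A *m v) = c * ev F v.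
Proof.
move=> n1 hF d1 smF zA; pose i0 := Ordinal (ltnW n1); pose i1 := Ordinal n1.
pose e i : 'cV[K]_n := delta_mx i ord0.
have [v Fv] := smooth_nonzero i0 hF smF.
(* The line has to miss the origin for smoothness to apply at each of its points. *)
have [a av] : exists a, forall t, a + t *: v != 0.
  have /cV0Pn[j vj] : v != 0.
    apply: contraNneq Fv => ->; rewrite -(scale0r v) (ev_homog _ _ hF).
    by rewrite expr0n gtn_eqF ?mul0r // ltnW.
  have [i ij] : exists i, i != j.
    by case: (eqVneq j i0) => [->|h]; [exists i1 | exists i0; rewrite eq_sym].
  exists (e i) => t; apply/negP => /eqP h.
  have := congr1 (fun u : 'cV_n => u j ord0) h.
  rewrite !mxE eqxx andbT eq_sym (negPf ij) add0r => /eqP; rewrite mulf_eq0 (negPf vj) orbF.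
  move=> /eqP t0; have := congr1 (fun u : 'cV_n => u i ord0) h.
  by rewrite !mxE !eqxx t0 mul0r addr0 => /eqP; rewrite oner_eq0.
(* The line meets the zeros of [F] in finitely many points, so one direction [w] avoids all their
   tangent hyperplanes. *)
have [w Hw] : exists w, forall t, ev F (a + t *: v) = 0 ->
     (grad F (a + t *: v) *m w) ord0 ord0 != 0.
  have [rs Dp] := closed_field_poly_normal (ln a v F).
  have [|w /allP Hw] := @avoid_hyperplanes [seq grad F (a + t *: v) | t <- rs & ev F (a + t *: v) == 0].
    by apply/allP => r /mapP[t]; rewrite mem_filter => /andP[/eqP Ft _] ->; apply: smF.
  exists w => t Ft; apply: Hw; apply/mapP; exists t => //; rewrite mem_filter Ft eqxx.
  have : root (ln a v F) t by rewrite /root horner_ln Ft.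
  by rewrite Dp (ln_top a hF Fv).2 rootZ ?Fv // root_prod_XsubC.
have [|D D0 HD] := generic_line_separable hF d1 Fv (a := a) (w := w).
  by move=> t /Hw.
have /closed_nonrootP[s0 /HD] := D0; set a1 := a + s0 *: w => sep1.
have FAv : ev F (A *m v) != 0 by apply: contra_neq Fv => /(zA v).2.
exists (ev F (A *m v) / ev F v) => [|b]; first by rewrite mulf_neq0 ?invr_neq0.
(* Now the line s = 0 is separable, so it has no tangency to test and any second direction is
   allowed; [b - a1] makes s = 1 the line through [b]. *)
have [|E E0 HE] := generic_line_separable hF d1 Fv (a := a1) (w := b - a1).
  move=> t Ft; rewrite -deriv_ln => dt; have := coprimep_root (x := t) sep1.
  by rewrite /root horner_ln Ft eqxx dt eqxx => /(_ isT).
set c := _ / _.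
(* The identity is known outside the roots of [E]. As one between polynomials in s it extends to s =
   1, which gives the point [b]. *)
suff : E * (ln (A *m a1) (A *m (b - a1)) F - c *: ln a1 (b - a1) F) = 0.
  move=> /eqP; rewrite mulf_eq0 (negPf E0) subr_eq0 => /eqP/(congr1 (horner^~ 1)).
  by rewrite hornerZ !horner_ln !scale1r -mulmxDr addrC subrK.
apply: poly_ext => s; rewrite hornerM horner0.
have [->|/HE sep] := eqVneq E.[s] 0; first by rewrite mul0r.
have := separable_line_prop hF Fv zA sep 0; rewrite scale0r addr0 mulmxDr -scalemxAr.
by rewrite hornerD hornerN hornerZ !horner_ln => ->; rewrite subrr mulr0.
Qed.
End ZeroLocus.

(** * The action of an element of order 13 *)

Section LinearChange.
Variables (K : numClosedFieldType) (n : nat).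
Implicit Types (F G : {mpoly K[n]}) (v w : 'cV[K]_n) (A B : 'M[K]_n).

Lemma rowmx_ext (r r' : 'rV[K]_n) :
  (forall w, (r *m w) ord0 ord0 = (r' *m w) ord0 ord0) -> r = r'.
Proof.
move=> rr; apply/rowP => i; have := rr (delta_mx i ord0).
by rewrite -!colE !mxE.
Qed.

Lemma grad_chain F G A c :
  (forall v, ev G v = c * ev F (A *m v)) ->
  forall v, grad G v = c *: (grad F (A *m v) *m A).
Proof.
move=> GF v; apply: rowmx_ext => w.
have := deriv_ln v w G 0; rewrite scale0r addr0 => <-.
have -> : ln v w G = c *: ln (A *m v) (A *m w) F.
  by apply: poly_ext => t; rewrite hornerZ !horner_ln GF mulmxDr -scalemxAr.
by rewrite derivZ hornerZ deriv_ln scale0r addr0 -scalemxAl [RHS]mxE mulmxA.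
Qed.

Lemma grad_homog F d c v : F \is d.+1.-homog -> c != 0 ->
  grad F (c *: v) = c ^+ d *: grad F v.
Proof.
move=> hF c0; rewrite [in RHS](@grad_chain F F c%:M (c ^+ d.+1)^-1) => [|u]; last first.
  by rewrite mul_scalar_mx (ev_homog _ _ hF) mulKf ?expf_neq0.
rewrite mul_scalar_mx mul_mx_scalar !scalerA exprSr invfM.
by rewrite -mulrA divfK // divff ?expf_neq0 // scale1r.
Qed.

Definition comp_lin B F : {mpoly K[n]} :=
  F \mPo [tuple \sum_j B i j *: 'X_j | i < n].

Lemma ev_comp_lin B F v : ev (comp_lin B F) v = ev F (B *m v).
Proof.
rewrite /ev /comp_lin comp_mpoly_meval; apply: meval_eq => i.
rewrite tnth_mktuple mxE raddf_sum; apply: eq_bigr => j _ /=.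
by rewrite mevalZ mevalXU.
Qed.

Lemma comp_lin_homog B F d : F \is d.-homog -> comp_lin B F \is d.-homog.
Proof.
move=> /dhomogP hF; rewrite /comp_lin comp_mpolyE big_seq.
apply: rpred_sum => m mF; have <- : mdeg m = d := hF m mF.
apply: rpredZ; rewrite mdegE.
apply: (big_ind2 (fun (G : {mpoly K[n]}) k => G \is k.-homog)).
- by rewrite dhomog1.
- by move=> G k G' k'; apply: dhomogM.
move=> i _; rewrite tnth_mktuple; have := @dhomogMn n K [measure of mdeg] 1 (\sum_j B i j *: 'X_j)
  (m i).
rewrite mul1n; apply; apply: rpred_sum => j _; apply: rpredZ; rewrite dhomogX; apply/eqP.
exact: mdeg1.
Qed.

Lemma smooth_comp_lin B F : B \in unitmx -> smooth F -> smooth (comp_lin B F).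
Proof.
move=> uB smF v v0; rewrite ev_comp_lin => Fv.
have Bv : B *m v != 0 by apply: contra_neq v0 => h; rewrite -(mulKmx uB v) h mulmx0.
apply: contra_neq (smF _ Bv Fv) => g0.
have h u : ev (comp_lin B F) u = 1 * ev F (B *m u) by rewrite mul1r ev_comp_lin.
have := grad_chain h v; rewrite g0 scale1r => h'.
by rewrite -(mulmxK uB (grad F _)) -h' mul0mx.
Qed.
End LinearChange.

Lemma diagonalize_root_unity (K : fieldType) (n p : nat) (z : K) (A : 'M[K]_n.+1) :
  p.-primitive_root z -> A ^+ p = 1 ->
  exists2 B, B \in unitmx &
    exists a : 'I_n.+1 -> 'I_p, A *m B = B *m diag_mx (\row_i z ^+ a i).
Proof.
move=> pz Ap.
have [P uP /diagonalizable_forPex[d /(simmxP uP) PA]] : diagonalizable A.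
  apply/diagonalizableP; exists [seq z ^+ i | i <- index_iota 0 p].
    rewrite map_inj_in_uniq ?iota_uniq // => i j; rewrite !mem_index_iota /= => ip jp.
    by move=> /eqP; rewrite (eq_prim_root_expr pz) !modn_small // => /eqP.
  rewrite big_map (factor_Xn_sub_1 pz) mxminpoly_min // rmorphB rmorphXn /=.
  by rewrite horner_mx_X rmorph1 Ap subrr.
pose B := invmx P; have uB : B \in unitmx by rewrite unitmx_inv.
have AB : A *m B = B *m diag_mx d.
  by rewrite -[RHS]mulmx1 -(mulmxV uP) !mulmxA -[_ *m _ *m P]mulmxA -PA mulKmx.
have d1 i : d ord0 i ^+ p = 1.
  have Dk k : diag_mx d ^+ k *m P = P *m A ^+ k :> 'M_n.+1.
    elim: k => [|k IHk]; first by rewrite !expr0 mul1mx mulmx1.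
    by rewrite exprS -mulmxE -mulmxA IHk mulmxA -PA -mulmxA mulmxE -exprS.
  have dk k : diag_mx d ^+ k = diag_mx (\row_j d ord0 j ^+ k) :> 'M_n.+1.
    elim: k => [|k IHk]; first by apply/matrixP => u v; rewrite expr0 !mxE.
    rewrite exprS IHk -mulmxE; apply/matrixP => u v; rewrite mul_diag_mx !mxE.
    by case: (u == v); rewrite ?mulr1n ?mulr0n ?mulr0 // exprS.
  have : diag_mx d ^+ p = 1 :> 'M_n.+1.
    by rewrite -[LHS](mulmxK uP) Dk Ap mulmx1 mulmxV.
  by move/matrixP/(_ i i); rewrite dk !mxE eqxx.
exists B => //; exists (fun i => sval (prim_rootP pz (d1 i))).
rewrite AB; congr (_ *m diag_mx _); apply/rowP => i; rewrite mxE.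
by case: (prim_rootP pz (d1 i)).
Qed.

Lemma mderiv_homog (K : numClosedFieldType) (n d : nat) (F : {mpoly K[n]}) i :
  F \is d.+1.-homog -> mderiv i F \is d.-homog.
Proof.
move=> /dhomogP hF; apply/dhomogP => m; rewrite mcoeff_msupp mcoeff_mderiv => mF.
have /hF : (m + U_(i))%MM \in msupp F.
  by rewrite mcoeff_msupp; apply: contraNneq mF => ->; rewrite mul0rn.
by rewrite /= mdegD mdeg1 addn1 => -[].
Qed.

Lemma dvdn_mul_coprime13 k m : (13 %| k * m)%N -> coprime 13 k -> (13 %| m)%N.
Proof. by move=> h c; rewrite -(Gauss_dvdr _ c). Qed.

Section Weights.
Variables (K : numClosedFieldType) (F : {mpoly K[5]}) (z : K) (a : 'I_5 -> nat).
Hypotheses (hF : F \is 5.-homog) (smF : smooth F) (pz : 13.-primitive_root z).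
Let D : 'M[K]_5 := diag_mx (\row_i z ^+ a i).
Hypothesis invF : forall v, ev F (D *m v) = ev F v.
Implicit Types (v : 'cV[K]_5) (c : nat).
Local Notation e i := (delta_mx i ord0 : 'cV[K]_5).

Let z0 : z != 0. Proof. by rewrite (prim_root_eq0 pz). Qed.

Let fixed_weight k (x : K) : x = z ^+ k * x -> x != 0 -> (13 %| k)%N.
Proof.
move=> xE x0; rewrite (prim_order_dvd pz); apply/eqP/(mulIf x0).
by rewrite -xE mul1r.
Qed.

(** Invariance of [F] multiplies its l-th partial derivative by the weight of the l-th coordinate,
    and a quartic evaluated at [z ^+ c *: v] contributes 4 c. *)
Let grad_weight v c l : D *m v = z ^+ c *: v -> grad F v ord0 l != 0 ->
  (13 %| 4 * c + a l)%N.
Proof.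
move=> Dv; apply: fixed_weight.
have h u : ev F u = 1 * ev F (D *m u) by rewrite mul1r invF.
rewrite [in LHS](grad_chain h v) scale1r Dv (grad_homog _ hF) ?expf_neq0 //.
by rewrite mul_mx_diag !mxE exprD mulrAC -exprM mulnC.
Qed.

Let ev_weight v c : D *m v = z ^+ c *: v -> ev F v != 0 -> (13 %| c)%N.
Proof.
move=> Dv Fv; apply: (@dvdn_mul_coprime13 5) => //; apply: fixed_weight Fv.
by rewrite -[in LHS]invF Dv (ev_homog _ _ hF) -exprM mulnC.
Qed.

Let De i : D *m e i = z ^+ a i *: e i.
Proof.
apply/colP => j; rewrite mul_diag_mx !mxE; case: eqVneq => [->|] //=.
by rewrite !mulr0.
Qed.

(** Smoothness at the i-th coordinate point: some monomial x_i^4 x_j occurs in [F], with j = i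
    allowed, and its weight is 0 modulo 13. *)
Lemma weight_closed i : exists j, (13 %| 4 * a i + a j)%N.
Proof.
have [Fe|/(ev_weight (De i)) ai] := eqVneq (ev F (e i)) 0; last first.
  by exists i; rewrite -mulSnr dvdn_mull.
have e0 : e i != 0 by apply/cV0Pn; exists i; rewrite !mxE !eqxx oner_eq0.
by have /rV0Pn[j /(grad_weight (De i))] := smF e0 Fe; exists j.
Qed.

(* On the line spanned by [e i] and [e i'] the only partial derivative of [F]
   that can be nonzero is the [j]-th one, a binary quartic: it has a zero. *)
Lemma weight_no_double i i' j : i != i' -> a i = a i' -> ~~ (13 %| a i)%N ->
  ~ (forall l, (13 %| 4 * a i + a l)%N -> l = j).
Proof.
move=> ii' aii' ai uj.
suff [v [v0 Dv gv]] : exists v, [/\ v != 0, D *m v = z ^+ a i *: v & grad F v ord0 j = 0].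
  have Fv : ev F v = 0 by apply: contraNeq ai => /(ev_weight Dv).
  have /rV0Pn[l gl] := smF v0 Fv; have /uj lj := grad_weight Dv gl.
  by move: gl; rewrite lj gv eqxx.
have De' : D *m e i' = z ^+ a i *: e i' by rewrite aii' De.
have hg := mderiv_homog j hF.
(* A nonzero constant restriction has no root on the affine line; its coefficient of degree 4 is
   then 0, and the zero is the point at infinity [e i']. *)
have [/size_poly1P[c c0 pc]|/closed_rootP[t]] := boolP (size (ln (e i) (e i') (mderiv j F)) == 1%N).
  exists (e i'); split=> //; first by apply/cV0Pn; exists i'; rewrite !mxE !eqxx oner_eq0.
  have [_] : top_coef (ln (e i) (e i') (mderiv j F)) 4 (ev (mderiv j F) (e i')).
    exact: (top_coef_line idfun _ _ hg).
  by rewrite pc coefC mxE => <-.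
rewrite /root horner_ln => /eqP gt.
exists (e i + t *: e i'); split; last by rewrite mxE.
  apply/cV0Pn; exists i; rewrite !mxE !eqxx (negPf ii') mulr0 addr0.
  exact: oner_neq0.
by rewrite mulmxDr -scalemxAr De De' scalerDr scalerA mulrC -scalerA.
Qed.
End Weights.

Lemma extend_perm3 (i1 i2 i3 : 'I_5) : uniq [:: i1; i2; i3] ->
  exists s : 'S_5, [/\ s (inord 0) = i1, s (inord 1) = i2 & s (inord 2) = i3].
Proof.
set l := [:: i1; i2; i3] => ul.
pose r := l ++ [seq x <- enum 'I_5 | x \notin l].
have ur : uniq r.
  rewrite cat_uniq ul filter_uniq ?enum_uniq // andbT.
  by apply/hasPn => x; rewrite mem_filter => /andP[].
have sr : size r = 5.
  have /perm_size -> : perm_eq r (enum 'I_5); last by rewrite size_enum_ord.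
  apply: uniq_perm; rewrite ?enum_uniq // => x.
  by rewrite mem_cat mem_filter mem_enum andbT orbN.
have inj : injective (fun i : 'I_5 => nth i1 r i).
  by move=> i j /eqP; rewrite nth_uniq ?sr // => /eqP/ord_inj.
by exists (perm inj); rewrite !permE !inordK.
Qed.

(** This predicate and the next are computable forms of [weight_closed] and of the configuration
    excluded by [weight_no_double]. *)
Definition closed_weights (l : seq nat) :=
  all (fun u => has (fun w => 13 %| 4 * u + w)%N l) l.

Definition double_weights (l : seq nat) :=
  has (fun p : nat => has (fun p' : nat => has (fun q : nat =>
    [&& p != p', nth 0 l p == nth 0 l p', nth 0 l p != 0 &
        all (fun r => (13 %| 4 * nth 0 l p + nth 0 l r) ==> (r == q)) (iota 0 5)]%N)
    (iota 0 5)) (iota 0 5)) (iota 0 5).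

Lemma weights_check x y : (x < 13)%N -> (y < 13)%N ->
  closed_weights [:: 1; 9; 3; x; y]%N -> ~~ double_weights [:: 1; 9; 3; x; y]%N ->
  x = 0%N /\ y = 0%N.
Proof.
move=> x13 y13.
have : all (fun x => all (fun y => closed_weights [:: 1; 9; 3; x; y]%N ==>
   (double_weights [:: 1; 9; 3; x; y]%N || (x == 0%N) && (y == 0%N))) (iota 0 13)) (iota 0 13).
  by vm_compute.
have mx u : (u < 13)%N -> u \in iota 0 13 by rewrite mem_iota.
move=> /allP/(_ _ (mx _ x13))/allP/(_ _ (mx _ y13)).
by move=> /implyP h /h /orP[->//|/andP[/eqP-> /eqP->]].
Qed.

(** A weight u forces -4 u = 9 u and then 3 u, and the orbit closes since (-4)^3 = 1 modulo 13. The
    two weights left cannot fill a second orbit of length 3; if one of them were nonzero, some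
    repeated weight would have a single partner. The factor [k] stands for passing to a power of the
    matrix, which turns u into 1. *)
Lemma normalize_weights (a : 'I_5 -> 'I_13) :
  (forall i, exists j, (13 %| 4 * a i + a j)%N) ->
  (forall i i' j, i != i' -> a i = a i' -> ~~ (13 %| a i)%N ->
    ~ (forall l, (13 %| 4 * a i + a l)%N -> l = j)) ->
  (exists i, a i != ord0) ->
  exists (k : nat) (s : 'S_5), forall i, ((k * a (s i)) %% 13 = nth 0 [:: 1; 9; 3; 0; 0] i)%N.
Proof.
move=> cl nd [i1 ai1].
have [k k1] : exists k, ((k * a i1) %% 13 = 1)%N.
  have cop : coprime (a i1) 13.
    by rewrite coprime_sym prime_coprime // gtnNdvd // lt0n.
  have a0 : (0 < a i1)%N by rewrite lt0n.
  have [u v Duv _] := egcdnP 13 a0; exists u.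
  by rewrite Duv (eqP cop) modnMDl.
have dk m : (13 %| k * m)%N -> (13 %| m)%N.
  move=> h; apply: (dvdn_mul_coprime13 h); rewrite prime_coprime //.
  by apply/negP => /dvdnP[q Dq]; move: k1; rewrite Dq mulnAC modnMl.
pose b i := ((k * a i) %% 13)%N.
have bl i : (b i < 13)%N by rewrite ltn_mod.
have clb i : exists j, (13 %| 4 * b i + b j)%N.
  have [j aj] := cl i; exists j; rewrite /dvdn /b modnDmr -modnDml modnMmr modnDml.
  by rewrite mulnCA -mulnDr -/(dvdn _ _) dvdn_mull.
have clab i j : (13 %| 4 * a i + a j)%N = (13 %| 4 * b i + b j)%N.
  rewrite /dvdn /b modnDmr -[in RHS]modnDml modnMmr modnDml mulnCA -mulnDr -!/(dvdn _ _).
  by apply/idP/idP => [h|/dk//]; rewrite dvdn_mull.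
have bE i j : b i = b j -> a i = a j.
  wlog ij : i j / (a j <= a i)%N.
    by move=> H e; case: (leqP (a j) (a i)) => [/H->//|/ltnW/H->].
  move=> /eqP; rewrite eqn_mod_dvd ?leq_mul2l ?ij ?orbT // -mulnBr => /dk h.
  apply/val_inj/eqP; rewrite /= eqn_leq ij andbT -subn_eq0.
  apply: contraLR h => h; rewrite gtnNdvd // ?lt0n // (leq_ltn_trans _ (ltn_ord (a i))) ?leq_subr //.
have b1 : b i1 = 1%N by [].
(* Modulo 13, -4 = 9 and -36 = 3. *)
have [i2 h2] := clb i1; have b2 : b i2 = 9%N by move: h2 (bl i2); rewrite b1; lia.
have [i3 h3] := clb i2; have b3 : b i3 = 3%N by move: h3 (bl i3); rewrite b2; lia.
have [|s [s0 s1 s2]] := @extend_perm3 i1 i2 i3.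
  rewrite /= !inE !negb_or !andbT; apply/andP; split; [apply/andP; split|];
  by apply/eqP => /(congr1 b); rewrite ?b1 ?b2 ?b3.
pose x := b (s (inord 3)); pose y := b (s (inord 4)).
have bs i : b (s i) = nth 0%N [:: 1; 9; 3; x; y]%N i.
  have e k' (h : (k' < 5)%N) : Ordinal h = inord k' by apply/val_inj; rewrite /= inordK.
  by case: i => -[|[|[|[|[|//]]]]] h /=; rewrite e ?s0 ?s1 ?s2.
have mem_b i : b i \in [:: 1; 9; 3; x; y]%N.
  by rewrite -(permKV s i) bs mem_nth //= ltn_ord.
have [||||x0 y0] := @weights_check x y; [exact: bl | exact: bl | | |].
- apply/allP => u /(nthP 0%N)[p p5 <-].
  rewrite -[p]/(val (Ordinal p5 : 'I_5)) -bs; have [j hj] := clb (s (Ordinal p5)).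
  by apply/hasP; exists (b j).
- apply/negP => /hasP[p]; rewrite mem_iota => p5 /hasP[p'].
  rewrite mem_iota => p'5 /hasP[q]; rewrite mem_iota => q5.
  move: p5 p'5 q5; rewrite !add0n => p5 p'5 q5 /and4P[pp' bpp' bp0 /allP H].
  pose P := s (Ordinal p5); pose P' := s (Ordinal p'5).
  apply: (nd P P' (s (Ordinal q5))).
  + by rewrite (inj_eq perm_inj).
  + by apply: bE; rewrite !bs /=; apply/eqP.
  + apply: contraNN bp0 => h; rewrite -[p]/(val (Ordinal p5)) -bs /b.
    by rewrite -/(dvdn _ _) dvdn_mull.
  move=> l; rewrite -(permKV s l) clab !bs => hl; congr (s _); apply/val_inj/eqP.
  by apply: (implyP (H (val (s^-1%g l)) _)) => //; rewrite mem_iota add0n /=.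
exists k, s => i; rewrite -/(b _) bs x0 y0 //.
Qed.

(** * Invariant forms and the normal form *)

Section Forms.
Variable R : comNzRingType.
Implicit Types (x y w t s : R) (q f c : nat -> R).

Definition klein x y w := x ^+ 4 * y + y ^+ 4 * w + w ^+ 4 * x.

Definition quadratic q t s := q 0%N * t ^+ 2 + q 1%N * t * s + q 2%N * s ^+ 2.

Definition quintic f t s := f 0%N * t ^+ 5 + f 1%N * t ^+ 4 * s
  + f 2%N * t ^+ 3 * s ^+ 2 + f 3%N * t ^+ 2 * s ^+ 3 + f 4%N * t * s ^+ 4
  + f 5%N * s ^+ 5.

Definition nform q f x y w t s :=
  klein x y w + x * y * w * quadratic q t s + quintic f t s.

Definition preform c q f x y w t s := c 0%N * x ^+ 4 * y + c 1%N * y ^+ 4 * w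
  + c 2%N * w ^+ 4 * x + x * y * w * quadratic q t s + quintic f t s.

Definition dquintic_t f t s := 5%:R * f 0%N * t ^+ 4 + 4%:R * f 1%N * t ^+ 3 * s
  + 3%:R * f 2%N * t ^+ 2 * s ^+ 2 + 2%:R * f 3%N * t * s ^+ 3 + f 4%N * s ^+ 4.

Definition dquintic_s f t s := f 1%N * t ^+ 4 + 2%:R * f 2%N * t ^+ 3 * s
  + 3%:R * f 3%N * t ^+ 2 * s ^+ 2 + 4%:R * f 4%N * t * s ^+ 3
  + 5%:R * f 5%N * s ^+ 4.

Lemma euler_quintic f t s :
  5%:R * quintic f t s = t * dquintic_t f t s + s * dquintic_s f t s.
Proof. by rewrite /quintic /dquintic_t /dquintic_s; ring. Qed.

Definition dpreform c q f x y w t s x' y' w' t' s' :=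
  c 0%N * (4%:R * x ^+ 3 * y * x' + x ^+ 4 * y')
  + c 1%N * (4%:R * y ^+ 3 * w * y' + y ^+ 4 * w')
  + c 2%N * (4%:R * w ^+ 3 * x * w' + w ^+ 4 * x')
  + (x' * y * w + x * y' * w + x * y * w') * quadratic q t s
  + x * y * w * ((2%:R * q 0%N * t + q 1%N * s) * t'
                 + (q 1%N * t + 2%:R * q 2%N * s) * s')
  + dquintic_t f t s * t' + dquintic_s f t s * s'.

End Forms.

Section DerivativeAt.
Variable R : comNzRingType.
Implicit Types p : {poly R}.

(** Derivation and evaluation in one operation: the product rule then produces expressions in scalar
    values, which [ring] can compare. *)
Definition deriv_at p u := p^`().[u].

Lemma deriv_atM p1 p2 u : deriv_at (p1 * p2) u = deriv_at p1 u * p2.[u] + p1.[u] * deriv_at p2 u.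
Proof. by rewrite /deriv_at derivM hornerD !hornerM. Qed.

Lemma deriv_atD p1 p2 u : deriv_at (p1 + p2) u = deriv_at p1 u + deriv_at p2 u.
Proof. by rewrite /deriv_at derivD hornerD. Qed.

Lemma deriv_atC a u : deriv_at a%:P u = 0.
Proof. by rewrite /deriv_at derivC horner0. Qed.

Lemma deriv_atX p n u : deriv_at (p ^+ n) u = n%:R * p.[u] ^+ n.-1 * deriv_at p u.
Proof.
by rewrite /deriv_at deriv_exp hornerMn hornerM horner_exp -mulr_natl mulrCA mulrC.
Qed.
End DerivativeAt.

Section FormDerivative.
Variables (R : comNzRingType) (c q f : nat -> R).

Local Notation lift c := (fun i => (c i)%:P).

Let horner_quadratic (T S : {poly R}) u :
  (quadratic (lift q) T S).[u] = quadratic q T.[u] S.[u].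
Proof. by rewrite /quadratic !(hornerD, hornerM, horner_exp, hornerC). Qed.

Let horner_preform (X Y W T S : {poly R}) u :
  (preform (lift c) (lift q) (lift f) X Y W T S).[u] =
  preform c q f X.[u] Y.[u] W.[u] T.[u] S.[u].
Proof.
rewrite /preform /quintic !hornerD [(_ * _ * _ * quadratic _ _ _).[_]]hornerM.
by rewrite horner_quadratic !(hornerM, horner_exp, hornerC).
Qed.

Let der_preform (X Y W T S : {poly R}) u :
  deriv_at (preform (lift c) (lift q) (lift f) X Y W T S) u =
  dpreform c q f X.[u] Y.[u] W.[u] T.[u] S.[u] (deriv_at X u) (deriv_at Y u) (deriv_at W u)
    (deriv_at T u) (deriv_at S u).
Proof.
rewrite /preform /quintic !deriv_atD [deriv_at (_ * quadratic _ _ _) _]deriv_atM.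
rewrite horner_quadratic /quadratic !deriv_atD !(deriv_atM, deriv_atX, deriv_atC) !(hornerM,
  horner_exp, hornerC).
move: X.[u] Y.[u] W.[u] T.[u] S.[u] (deriv_at X u) (deriv_at Y u) (deriv_at W u) (deriv_at T u)
  (deriv_at S u).
move=> x y w t s x' y' w' t' s'.
rewrite /dpreform /quadratic /dquintic_t /dquintic_s /=; ring.
Qed.

(** The polynomial stays behind an existential; only its values and its derivative at 0 matter when
    it is compared with [ln] by [poly_ext]. *)
Lemma preform_line x y w t s x' y' w' t' s' :
  exists p : {poly R},
    (forall u, p.[u] = preform c q f (x + u * x') (y + u * y') (w + u * w')
                         (t + u * t') (s + u * s'))
    /\ p^`().[0] = dpreform c q f x y w t s x' y' w' t' s'.
Proof.
pose l (a a' : R) := a%:P + 'X * a'%:P.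
have lE a a' u : (l a a').[u] = a + u * a' by rewrite !hornerE.
have dl a a' u : deriv_at (l a a') u = a'.
  by rewrite deriv_atD deriv_atM !deriv_atC /deriv_at derivX hornerC mulr0 hornerC addr0 add0r mul1r.
exists (preform (lift c) (lift q) (lift f) (l x x') (l y y') (l w w') (l t t') (l s s')).
split=> [u|]; first by rewrite horner_preform !lE.
by rewrite [LHS]der_preform !lE !dl !mul0r !addr0.
Qed.

End FormDerivative.

Section Coordinates.
Variable K : numClosedFieldType.
Implicit Types (x y w t s : K) (q f c : nat -> K).

Definition vec5 x y w t s : 'cV[K]_5 := \col_i nth 0 [:: x; y; w; t; s] i.

Lemma vec5E (v : 'cV[K]_5) : v = vec5 (v (inord 0) ord0) (v (inord 1) ord0)
  (v (inord 2) ord0) (v (inord 3) ord0) (v (inord 4) ord0).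
Proof.
apply/colP => -[[|[|[|[|[|//]]]]] h]; rewrite mxE /=;
by congr (v _ _); apply/val_inj; rewrite /= inordK.
Qed.

Lemma big_ord5 (T : Type) (idx : T) (op : Monoid.law idx) (E : 'I_5 -> T) :
  \big[op/idx]_i E i =
    op (op (op (op (E (inord 0)) (E (inord 1))) (E (inord 2))) (E (inord 3)))
       (E (inord 4)).
Proof.
rewrite !big_ord_recr big_ord0 /= Monoid.mul1m.
by do !congr (op _ _); congr (E _); apply/val_inj; rewrite /= inordK.
Qed.

(** An exhaustive check over exponents at most 5. The twelve solutions are the three Klein
    monomials, x y w times a quadratic monomial in (t, s), and the binary quintic monomials. *)
Lemma invariant_exponents m0 m1 m2 m3 m4 :
  (m0 + m1 + m2 + m3 + m4 = 5)%N -> (13 %| m0 + 9 * m1 + 3 * m2)%N ->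
  (m0, m1, m2, m3, m4) \in [:: (4, 1, 0, 0, 0); (0, 4, 1, 0, 0); (1, 0, 4, 0, 0);
    (1, 1, 1, 2, 0); (1, 1, 1, 1, 1); (1, 1, 1, 0, 2);
    (0, 0, 0, 5, 0); (0, 0, 0, 4, 1); (0, 0, 0, 3, 2); (0, 0, 0, 2, 3);
    (0, 0, 0, 1, 4); (0, 0, 0, 0, 5)]%N.
Proof.
move=> s5 w13; set L := (X in _ \in X).
have : all (fun a => all (fun b => all (fun c : nat => all (fun d => all (fun e =>
  ((a + b + c + d + e == 5) && (13 %| a + 9 * b + 3 * c))%N ==>
  ((a, b, c, d, e) \in L)) (iota 0 6)) (iota 0 6)) (iota 0 6)) (iota 0 6)) (iota 0 6).
  by vm_compute.
have mi u : (u <= 5)%N -> u \in iota 0 6 by rewrite mem_iota ltnS.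
have [h0 [h1 [h2 [h3 h4]]]] : (m0 <= 5 /\ m1 <= 5 /\ m2 <= 5 /\ m3 <= 5 /\ m4 <= 5)%N by lia.
move=> /allP/(_ _ (mi _ h0))/allP/(_ _ (mi _ h1))/allP/(_ _ (mi _ h2)).
move=> /allP/(_ _ (mi _ h3))/allP/(_ _ (mi _ h4))/implyP; apply.
by rewrite s5 eqxx.
Qed.

Definition is_preform (h : 'cV[K]_5 -> K) := exists c q f,
  forall x y w t s, h (vec5 x y w t s) = preform c q f x y w t s.

Lemma is_preform0 : is_preform (fun=> 0).
Proof.
exists (fun=> 0), (fun=> 0), (fun=> 0) => *.
by rewrite /preform /quadratic /quintic; ring.
Qed.

Lemma is_preformD g h : is_preform g -> is_preform h -> is_preform (fun v => g v + h v).
Proof.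
move=> [c [q [f gE]]] [c' [q' [f' hE]]].
exists (fun i => c i + c' i), (fun i => q i + q' i), (fun i => f i + f' i) => *.
by rewrite gE hE /preform /quadratic /quintic; ring.
Qed.

Lemma invariant_preform (F : {mpoly K[5]}) (z : K) :
  F \is 5.-homog -> 13.-primitive_root z ->
  (forall v, ev F (diag_mx (\row_i z ^+ nth 0%N [:: 1; 9; 3; 0; 0]%N i) *m v) = ev F v) ->
  is_preform (ev F).
Proof.
move=> /dhomogP hF pz invF; pose b (i : 'I_5) := nth 0%N [:: 1; 9; 3; 0; 0]%N i.
set D := diag_mx _ in invF.
pose wt (m : 'X_{1..5}) := (\sum_i b i * m i)%N.
have evD k v : ev F v = \sum_(m <- msupp F) F@_m * (z ^+ (k * wt m) * \prod_i v i ord0 ^+ m i).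
  have -> : ev F v = ev F (diag_mx (\row_i z ^+ (k * b i)) *m v).
    elim: k => [|k ->].
      by congr ev; apply/colP => i; rewrite mul_diag_mx !mxE mul1r.
    rewrite -invF; congr ev; apply/colP => i.
    by rewrite /D !mul_diag_mx !mxE mulSn exprD mulrA.
  rewrite /ev mevalE; apply: eq_bigr => m _; congr (_ * _).
  rewrite /wt big_distrr expr_sum -big_split; apply: eq_bigr => i _ /=.
  by rewrite mul_diag_mx !mxE exprMn -exprM mulnA.
(* Averaging over the 13 powers of the diagonal matrix removes every monomial whose weight is not
   divisible by 13, by the geometric sum. *)
have avg v : ev F v = \sum_(m <- msupp F) (if (13 %| wt m)%N then F@_m * \prod_i v i ord0 ^+ m i
  else 0).
  have n0 : 13%:R != 0 :> K by rewrite pnatr_eq0.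
  apply: (mulfI n0); rewrite mulr_natl -[in LHS](card_ord 13) -sumr_const.
  rewrite (eq_bigr _ (fun (k : 'I_13) _ => evD k v)) exchange_big mulr_sumr.
  apply: eq_bigr => m _ /=; rewrite -mulr_sumr -mulr_suml.
  case: ifPn => [|]; rewrite (prim_order_dvd pz) => zw.
    rewrite (eq_bigr (fun=> 1)) ?sumr_const ?card_ord ?mul1r; first by ring.
    by move=> k _; rewrite mulnC exprM (eqP zw) expr1n.
  have : (z ^+ wt m - 1) * (\sum_(k < 13) z ^+ (k * wt m)) = 0.
    rewrite (eq_bigr (fun k : 'I_13 => (z ^+ wt m) ^+ k)).
      by rewrite -subrX1 -exprM mulnC exprM (prim_expr_order pz) expr1n subrr.
    by move=> k _; rewrite mulnC exprM.
  by move=> /eqP; rewrite mulf_eq0 subr_eq0 (negPf zw) => /eqP ->; rewrite mul0r !mulr0.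
suff : is_preform (fun v => \sum_(m <- msupp F) (if (13 %| wt m)%N then F@_m * \prod_i v i ord0 ^+
  m i else 0)).
  by move=> [c [q [f h]]]; exists c, q, f => *; rewrite avg h.
(* Induction on the support as a mere list; each monomial retained is itself a [preform] with a
   single nonzero coefficient. *)
have hdeg : {in msupp F, forall m, mdeg m = 5} by move=> m /hF.
elim: (msupp F : seq _) hdeg => [_|m r IHr hdeg].
  by have [c [q [f h]]] := is_preform0; exists c, q, f => *; rewrite big_nil -h.
have /is_preformD H : is_preform (fun v => \sum_(m <- r) (if (13 %| wt m)%N then F@_m * \prod_i v i
  ord0 ^+ m i else 0)).
  by apply: IHr => m' h; apply: hdeg; rewrite inE h orbT.
suff /H[c [q [f h]]] : is_preform (fun v => if (13 %| wt m)%N then F@_m * \prod_i v i ord0 ^+ m i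
  else 0).
  by exists c, q, f => *; rewrite big_cons addrC h.
have [w13|_] := boolP (13 %| wt m)%N; last exact: is_preform0.
have := hdeg m (mem_head _ _); rewrite mdegE big_ord5 => m5.
have := w13; rewrite /wt big_ord5 /b !inordK //= mul1n !mul0n !addn0 => w13'.
have pE x y w t s : \prod_i (vec5 x y w t s) i ord0 ^+ m i =
   x ^+ m (inord 0) * y ^+ m (inord 1) * w ^+ m (inord 2) * t ^+ m (inord 3) * s ^+ m (inord 4).
  by rewrite big_ord5 !mxE !inordK.
have := invariant_exponents m5 w13'; rewrite !inE.
pose d k (j : nat) : K := if j == k then F@_m else 0.
pose o (j : nat) : K := 0.
have solve c q f : (forall x y w t s, F@_m * (x ^+ m (inord 0) * y ^+ m (inord 1) * w ^+ m (inord
  2) * t ^+ m (inord 3) * s ^+ m (inord 4)) = preform c q f x y w t s) ->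
   is_preform (fun v : 'cV_5 => F@_m * \prod_i v i ord0 ^+ m i).
  by move=> h; exists c, q, f => *; rewrite pE h.
(* Twelve cases, in the order of the list in [invariant_exponents]. *)
do 11?[case/orP]; move=> /eqP[e0 e1 e2 e3 e4];
  rewrite e0 e1 e2 e3 e4 in solve.
all: [> apply: (solve (d 0%N) o o) | apply: (solve (d 1%N) o o) | apply: (solve (d 2%N) o o)
  | apply: (solve o (d 0%N) o) | apply: (solve o (d 1%N) o) | apply: (solve o (d 2%N) o)
  | apply: (solve o o (d 0%N)) | apply: (solve o o (d 1%N)) | apply: (solve o o (d 2%N))
  | apply: (solve o o (d 3%N)) | apply: (solve o o (d 4%N)) | apply: (solve o o (d 5%N))];
  by move=> *; rewrite /preform /quadratic /quintic /d /o /=; ring.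
Qed.
End Coordinates.

Section NormalForm.
Variable K : numClosedFieldType.
Implicit Types (F G : {mpoly K[5]}) (z : K).

Lemma linear_vec5 (x y w t s x' y' w' t' s' u : K) :
  vec5 x y w t s + u *: vec5 x' y' w' t' s' =
  vec5 (x + u * x') (y + u * y') (w + u * w') (t + u * t') (s + u * s').
Proof. by apply/colP => -[[|[|[|[|[|//]]]]] h]; rewrite !mxE. Qed.

Lemma vec5_eq0 (x y w t s : K) : vec5 x y w t s = 0 ->
  [/\ x = 0, y = 0, w = 0, t = 0 & s = 0].
Proof.
move=> h; have E i : vec5 x y w t s i ord0 = 0 by rewrite h mxE.
have := E (inord 0); have := E (inord 1); have := E (inord 2); have := E (inord 3).
by have := E (inord 4); rewrite !mxE !inordK.
Qed.

Lemma grad_preform G c q f :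
  (forall x y w t s, ev G (vec5 x y w t s) = preform c q f x y w t s) ->
  forall x y w t s x' y' w' t' s',
  (grad G (vec5 x y w t s) *m vec5 x' y' w' t' s') ord0 ord0 =
  dpreform c q f x y w t s x' y' w' t' s'.
Proof.
move=> GE x y w t s x' y' w' t' s'.
have := deriv_ln (vec5 x y w t s) (vec5 x' y' w' t' s') G 0.
rewrite scale0r addr0 => <-.
have [p [pE <-]] := preform_line c q f x y w t s x' y' w' t' s'.
by congr (_^`().[_]); apply: poly_ext => u; rewrite horner_ln linear_vec5 GE pE.
Qed.

Definition smooth_quintic (f : nat -> K) := forall t s,
  dquintic_t f t s = 0 -> dquintic_s f t s = 0 -> t = 0 /\ s = 0.

Lemma smooth_preform G c q f : smooth G ->
  (forall x y w t s, ev G (vec5 x y w t s) = preform c q f x y w t s) ->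
  [/\ c 0%N != 0, c 1%N != 0, c 2%N != 0 & smooth_quintic f].
Proof.
move=> smG GE.
have sing x y w t s : preform c q f x y w t s = 0 ->
    (forall x' y' w' t' s', dpreform c q f x y w t s x' y' w' t' s' = 0) ->
    [/\ x = 0, y = 0, w = 0, t = 0 & s = 0].
  move=> e0 d0; apply: vec5_eq0; apply/eqP; apply/negPn/negP => v0.
  have := smG _ v0; rewrite GE e0 => /(_ erefl); apply/negP; rewrite negbK; apply/eqP.
  apply: rowmx_ext => v; rewrite [v]vec5E (grad_preform GE) d0.
  by rewrite mul0mx mxE.
split.
- apply/eqP => c0; case: (sing 1 0 0 0 0) => [|x' y' w' t' s'|/eqP]; last by rewrite oner_eq0.
    by rewrite /preform /quadratic /quintic c0; ring.
  by rewrite /dpreform /quadratic /dquintic_t /dquintic_s c0; ring.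
- apply/eqP => c0; case: (sing 0 1 0 0 0) => [|x' y' w' t' s'|_ /eqP]; last by rewrite oner_eq0.
    by rewrite /preform /quadratic /quintic c0; ring.
  by rewrite /dpreform /quadratic /dquintic_t /dquintic_s c0; ring.
- apply/eqP => c0; case: (sing 0 0 1 0 0) => [|x' y' w' t' s'|_ _ /eqP]; last by rewrite oner_eq0.
    by rewrite /preform /quadratic /quintic c0; ring.
  by rewrite /dpreform /quadratic /dquintic_t /dquintic_s c0; ring.
move=> t s dt ds; have [||//] := sing 0 0 0 t s.
  have : 5%:R * quintic f t s = 0 by rewrite euler_quintic dt ds; ring.
  move=> /eqP; rewrite mulf_eq0 pnatr_eq0 /= => /eqP h.
  by rewrite /preform h; ring.
by move=> *; rewrite /dpreform dt ds; ring.
Qed.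

Lemma preform_rescale (c q f : nat -> K) : c 0%N != 0 -> c 1%N != 0 -> c 2%N != 0 ->
  exists a b d (q' : nat -> K), [/\ a != 0, b != 0, d != 0 &
    forall x y w t s, preform c q f (a * x) (b * y) (d * w) t s = nform q' f x y w t s].
Proof.
move E0 : (c 0%N) => c0; move E1 : (c 1%N) => c1; move E2 : (c 2%N) => c2.
move=> h0 h1 h2.
(* Solving c0 a^4 b = 1 for b and c1 b^4 d = 1 for d turns the third condition c2 d^4 a = 1 into an
   equation for a^65. *)
pose a := 65.-root (c1 ^+ 4 / (c0 ^+ 16 * c2)).
have aE : a ^+ 65 = c1 ^+ 4 / (c0 ^+ 16 * c2) by rewrite /a rootCK.
have a0 : a != 0.
  have : a ^+ 65 != 0 by rewrite aE mulf_neq0 ?invr_neq0 ?mulf_neq0 ?expf_neq0.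
  by rewrite expf_eq0.
pose b := (c0 * a ^+ 4)^-1; pose d := (c1 * b ^+ 4)^-1.
have b0 : b != 0 by rewrite invr_neq0 ?mulf_neq0 ?expf_neq0.
have d0 : d != 0 by rewrite invr_neq0 ?mulf_neq0 ?expf_neq0.
exists a, b, d, (fun i => a * b * d * q i); split=> // x y w t s.
have e0 : c0 * a ^+ 4 * b = 1 by rewrite /b mulfV // mulf_neq0 ?expf_neq0.
have e1 : c1 * b ^+ 4 * d = 1 by rewrite /d mulfV // mulf_neq0 ?expf_neq0.
have e2 : c2 * d ^+ 4 * a = 1.
  have -> : c2 * d ^+ 4 * a = c2 * c0 ^+ 16 / c1 ^+ 4 * a ^+ 65.
    by rewrite /d /b; field; rewrite h0 h1 a0.
  by rewrite aE; field; rewrite h0 h1 h2.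
rewrite /preform /nform /klein E0 E1 E2.
transitivity ((c0 * a ^+ 4 * b) * (x ^+ 4 * y) + (c1 * b ^+ 4 * d) * (y ^+ 4 * w)
  + (c2 * d ^+ 4 * a) * (w ^+ 4 * x) + a * b * d * x * y * w * quadratic q t s + quintic f t s).
  by ring.
by rewrite e0 e1 e2 /quadratic; ring.
Qed.

Lemma scalar_exp (A : 'M[K]_5) c k v F d : F \is d.-homog ->
  (forall v, ev F (A *m v) = c * ev F v) -> ev F (A ^+ k *m v) = c ^+ k * ev F v.
Proof.
move=> hF AF; elim: k => [|k IHk]; first by rewrite !expr0 mul1mx mul1r.
by rewrite exprS -mulmxE -mulmxA AF IHk exprS mulrA.
Qed.

Theorem normal_form F (A : 'M[K]_5) c mu z :
  F \is 5.-homog -> smooth F -> 13.-primitive_root z ->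
  (forall v, ev F (A *m v) = c * ev F v) ->
  A ^+ 13 = mu%:M -> mu != 0 -> (forall a, A <> a%:M) ->
  exists2 B, B \in unitmx & exists q f, smooth_quintic f /\
    forall x y w t s, ev F (B *m vec5 x y w t s) = nform q f x y w t s.
Proof.
move=> hF smF pz AF A13 mu0 nA.
(* First correction: [d *: A] has 13th power 1 and multiplies [F] by [c1 = d ^+ 5 * c], a 13th root
   of unity. *)
pose d := 13.-root mu^-1; have dE : d ^+ 13 = mu^-1 by rewrite /d rootCK.
have [v Fv] := smooth_nonzero ord0 hF smF.
pose c1 := d ^+ 5 * c.
have c13 : c1 ^+ 13 = 1.
  apply: (mulIf Fv); rewrite mul1r /c1 exprMn -exprM mulnC exprM dE.
  rewrite -mulrA -(scalar_exp _ _ hF AF) A13 mul_scalar_mx (ev_homog _ _ hF) mulrA.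
  by rewrite -exprMn mulVf // expr1n mul1r.
(* Second correction: the extra factor c1^5 keeps the 13th power equal to 1 and changes the
   multiplier to c1^26 = 1. *)
pose A2 := (c1 ^+ 5 * d) *: A.
have d0 : d != 0 by apply: contra_eq_neq dE => ->; rewrite expr0n eq_sym invr_eq0.
have c10 : c1 != 0 by apply: contra_eq_neq c13 => ->; rewrite expr0n eq_sym oner_eq0.
have A2F u : ev F (A2 *m u) = ev F u.
  rewrite /A2 -scalemxAl (ev_homog _ _ hF) AF mulrA exprMn -exprM -[_ * _ * c]mulrA -/c1.
  by rewrite -exprSr -[(5 * 5).+1]/(13 * 2)%N exprM c13 expr1n mul1r.
have A213 : A2 ^+ 13 = 1.
  rewrite /A2 exprZn A13 exprMn dE -exprM -[(5 * 13)%N]/(13 * 5)%N exprM c13 expr1n mul1r.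
  by rewrite scale_scalar_mx mulVf.
have [B uB [a AB]] := diagonalize_root_unity pz A213.
pose G := comp_lin B F; have hG : G \is 5.-homog := comp_lin_homog B hF.
have smG : smooth G := smooth_comp_lin uB smF.
have invG u : ev G (diag_mx (\row_i z ^+ a i) *m u) = ev G u.
  by rewrite !ev_comp_lin mulmxA -AB -mulmxA A2F.
have [||k [s ks]] := normalize_weights (weight_closed hG smG pz invG).
- move=> i i' j ii' /(congr1 val) aa' ai; exact: (weight_no_double hG smG pz invG ii' aa' ai).
- case: (pickP (fun i => a i != ord0)) => [i ai|a0]; first by exists i.
  (* If all weights were 0, [A2] would be the identity and [A] a scalar. *)
  case: (nA (c1 ^+ 5 * d)^-1).
  have : A2 = 1%:M.
    rewrite -[A2](mulmxK uB) AB.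
    have -> : diag_mx (\row_i z ^+ a i) = 1%:M.
      rewrite -diag_const_mx; congr diag_mx; apply/rowP => i; rewrite !mxE.
      by have /negbFE/eqP-> := a0 i.
    by rewrite mulmx1 mulmxV.
  move=> h; rewrite -scalemx1 -h /A2 scalerA mulVf ?scale1r //.
  by rewrite mulf_neq0 ?expf_neq0.
pose P : 'M[K]_5 := perm_mx s^-1; have uP : P \in unitmx by rewrite unitmx_perm.
pose G2 := comp_lin P G; have hG2 : G2 \is 5.-homog := comp_lin_homog P hG.
have smG2 : smooth G2 := smooth_comp_lin uP smG.
have invGk m u : ev G (diag_mx (\row_i z ^+ (m * a i)) *m u) = ev G u.
  elim: m u => [|m IHm] u.
    by congr ev; apply/colP => i; rewrite mul_diag_mx !mxE mul1r.
  rewrite -[RHS]IHm -[RHS]invG; congr ev; apply/colP => i.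
  by rewrite !mul_diag_mx !mxE mulSn exprD mulrA.
have [u|c2 [q [f G2E]]] := invariant_preform hG2 pz.
  rewrite !(ev_comp_lin P G) -[RHS](invGk k); congr ev; apply/colP => i.
  by rewrite -!row_permE !mul_diag_mx !mxE -ks (prim_expr_mod pz) permKV.
have [c0 c1' c2' smf] := smooth_preform smG2 G2E.
have [x [y [w [q' [x0 y0 w0 E]]]]] := preform_rescale q f c0 c1' c2'.
pose B3 : 'M[K]_5 := diag_mx (vec5 x y w 1 1)^T.
exists (B *m P *m B3).
  rewrite !unitmx_mul uB uP /= unitmxE det_diag unitfE prodf_seq_neq0.
  apply/allP => -[[|[|[|[|[|//]]]]] h] _; rewrite !mxE //= ?oner_neq0 //.
exists q', f; split=> // x1 y1 w1 t1 s1.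
rewrite -!mulmxA -2!ev_comp_lin -/G -/G2 -E -G2E; congr ev.
by apply/colP => -[[|[|[|[|[|//]]]]] h]; rewrite mul_diag_mx !mxE //= mul1r.
Qed.
End NormalForm.

(** * Hessians *)

Section Hessian.
Variables (R : comNzRingType) (q f : nat -> R).
Implicit Types (x y w t s : R).

Definition dquad_t t s := 2%:R * q 0%N * t + q 1%N * s.
Definition dquad_s t s := q 1%N * t + 2%:R * q 2%N * s.
Definition dquintic_tt t s := 20%:R * f 0%N * t ^+ 3 + 12%:R * f 1%N * t ^+ 2 * s
  + 6%:R * f 2%N * t * s ^+ 2 + 2%:R * f 3%N * s ^+ 3.
Definition dquintic_ts t s := 4%:R * f 1%N * t ^+ 3 + 6%:R * f 2%N * t ^+ 2 * s
  + 6%:R * f 3%N * t * s ^+ 2 + 4%:R * f 4%N * s ^+ 3.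
Definition dquintic_ss t s := 2%:R * f 2%N * t ^+ 3 + 6%:R * f 3%N * t ^+ 2 * s
  + 12%:R * f 4%N * t * s ^+ 2 + 20%:R * f 5%N * s ^+ 3.

Definition grad_seq x y w t s := [::
  4%:R * x ^+ 3 * y + w ^+ 4 + y * w * quadratic q t s;
  4%:R * y ^+ 3 * w + x ^+ 4 + x * w * quadratic q t s;
  4%:R * w ^+ 3 * x + y ^+ 4 + x * y * quadratic q t s;
  x * y * w * dquad_t t s + dquintic_t f t s;
  x * y * w * dquad_s t s + dquintic_s f t s].

Definition hess_seq x y w t s :=
  let Q := quadratic q t s in let Qt := dquad_t t s in let Qs := dquad_s t s in
  [:: [:: 12%:R * x ^+ 2 * y; 4%:R * x ^+ 3 + w * Q; 4%:R * w ^+ 3 + y * Q; y * w * Qt; y * w * Qs];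
      [:: 4%:R * x ^+ 3 + w * Q; 12%:R * y ^+ 2 * w; 4%:R * y ^+ 3 + x * Q; x * w * Qt; x * w * Qs];
      [:: 4%:R * w ^+ 3 + y * Q; 4%:R * y ^+ 3 + x * Q; 12%:R * w ^+ 2 * x; x * y * Qt; x * y * Qs];
      [:: y * w * Qt; x * w * Qt; x * y * Qt;
          2%:R * q 0%N * (x * y * w) + dquintic_tt t s; q 1%N * (x * y * w) + dquintic_ts t s];
      [:: y * w * Qs; x * w * Qs; x * y * Qs;
          q 1%N * (x * y * w) + dquintic_ts t s; 2%:R * q 2%N * (x * y * w) + dquintic_ss t s]].

End Hessian.

Section HessianDerivative.
Variables (R : comNzRingType) (q f : nat -> R).

Let deriv_atN n u : deriv_at (n%:R : {poly R}) u = 0.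
Proof. by rewrite -[n%:R](rmorph_nat (@polyC R)) deriv_atC. Qed.

Let hornerN n u : (n%:R : {poly R}).[u] = n%:R.
Proof. by rewrite -[in LHS](rmorph_nat (@polyC R)) hornerC. Qed.

Local Notation lift c := (fun i => (c i)%:P).

Let horner_grad (X Y W T S : {poly R}) u i : (i < 5)%N ->
  (nth 0 (grad_seq (lift q) (lift f) X Y W T S) i).[u] =
  nth 0 (grad_seq q f X.[u] Y.[u] W.[u] T.[u] S.[u]) i.
Proof.
case: i => [|[|[|[|[|//]]]]] _ /=;
rewrite /quadratic /dquad_t /dquad_s /dquintic_t /dquintic_s;
by rewrite !(hornerD, hornerM, horner_exp, hornerC, hornerN).
Qed.

Let der_grad (X Y W T S : {poly R}) u i : (i < 5)%N ->
  deriv_at (nth 0 (grad_seq (lift q) (lift f) X Y W T S) i) u =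
  let r := nth [::] (hess_seq q f X.[u] Y.[u] W.[u] T.[u] S.[u]) i in
  nth 0 r 0 * deriv_at X u + nth 0 r 1 * deriv_at Y u + nth 0 r 2 * deriv_at W u
  + nth 0 r 3 * deriv_at T u + nth 0 r 4 * deriv_at S u.
Proof.
case: i => [|[|[|[|[|//]]]]] _ /=;
rewrite /quadratic /dquad_t /dquad_s /dquintic_t /dquintic_s;
rewrite !deriv_atD !(deriv_atM, deriv_atD, deriv_atX, deriv_atC, deriv_atN) !(hornerD, hornerM,
  horner_exp, hornerC, hornerN);
move: X.[u] Y.[u] W.[u] T.[u] S.[u] (deriv_at X u) (deriv_at Y u) (deriv_at W u) (deriv_at T u)
  (deriv_at S u);
move=> x y w t s x' y' w' t' s';
rewrite /dquintic_tt /dquintic_ts /dquintic_ss /=; ring.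
Qed.

Lemma grad_line x y w t s x' y' w' t' s' i : (i < 5)%N ->
  exists p : {poly R},
    (forall u, p.[u] = nth 0 (grad_seq q f (x + u * x') (y + u * y') (w + u * w')
                         (t + u * t') (s + u * s')) i)
    /\ p^`().[0] = let r := nth [::] (hess_seq q f x y w t s) i in
  nth 0 r 0 * x' + nth 0 r 1 * y' + nth 0 r 2 * w' + nth 0 r 3 * t' + nth 0 r 4 * s'.
Proof.
move=> i5; pose l (a a' : R) := a%:P + 'X * a'%:P.
have lE a a' u : (l a a').[u] = a + u * a' by rewrite !hornerE.
have dl a a' u : deriv_at (l a a') u = a'.
  by rewrite deriv_atD deriv_atM !deriv_atC /deriv_at derivX hornerC mulr0 hornerC addr0 add0r mul1r.
exists (nth 0 (grad_seq (lift q) (lift f) (l x x') (l y y') (l w w') (l t t') (l s s')) i).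
split=> [u|]; first by rewrite horner_grad // !lE.
by rewrite [LHS](der_grad _ _ _ _ _ _ i5) !lE !dl !mul0r !addr0.
Qed.

End HessianDerivative.

Section Symmetry.
Variables (K : numClosedFieldType) (q f : nat -> K).
Implicit Types (v w : 'cV[K]_5) (A : 'M[K]_5).

Local Notation "v `# k" := (v (inord k) ord0) (at level 2, k at level 0).

Definition nform_at v := nform q f v`#0 v`#1 v`#2 v`#3 v`#4.
Definition grad_at v : 'rV[K]_5 :=
  \row_i nth 0 (grad_seq q f v`#0 v`#1 v`#2 v`#3 v`#4) i.
Definition hess_at v : 'M[K]_5 :=
  \matrix_(i, j) nth 0 (nth [::] (hess_seq q f v`#0 v`#1 v`#2 v`#3 v`#4) i) j.

Lemma vec5_at (x y w t s : K) k : (k < 5)%N ->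
  (vec5 x y w t s)`#k = nth 0 [:: x; y; w; t; s] k.
Proof. by move=> k5; rewrite mxE inordK. Qed.

Lemma nform_line v w : exists p : {poly K},
  (forall u, p.[u] = nform_at (v + u *: w)) /\ p^`().[0] = (grad_at v *m w) ord0 ord0.
Proof.
have [p [pE dp]] := preform_line (fun=> 1) q f v`#0 v`#1 v`#2 v`#3 v`#4
   w`#0 w`#1 w`#2 w`#3 w`#4.
exists p; split=> [u|].
  by rewrite pE /nform_at /preform /nform /klein !mxE; ring.
rewrite dp !mxE big_ord5 !mxE !inordK //= /dpreform /dquad_t /dquad_s; ring.
Qed.

Lemma grad_at_line v w i : exists p : {poly K},
  (forall u, p.[u] = grad_at (v + u *: w) ord0 i) /\ p^`().[0] = (hess_at v *m w) i ord0.
Proof.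
have [p [pE dp]] := grad_line q f v`#0 v`#1 v`#2 v`#3 v`#4
   w`#0 w`#1 w`#2 w`#3 w`#4 (ltn_ord i).
exists p; split=> [u|]; first by rewrite pE !mxE.
by rewrite dp mxE big_ord5 !mxE !inordK.
Qed.

Lemma colmx_ext m (B C : 'M[K]_(m, 5)) : (forall w, B *m w = C *m w) -> B = C.
Proof.
move=> h; apply/matrixP => i j.
by have /colP/(_ i) := h (delta_mx j ord0); rewrite -!colE !mxE.
Qed.

Section Chain.
Variables (A : 'M[K]_5) (l : K).
Hypothesis NA : forall v, nform_at (A *m v) = l * nform_at v.

Lemma grad_at_chain v : grad_at (A *m v) *m A = l *: grad_at v.
Proof.
apply: rowmx_ext => w; have [p [pE dp]] := nform_line v w.
have [p' [pE' dp']] := nform_line (A *m v) (A *m w).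
rewrite -mulmxA -dp' -scalemxAl [RHS]mxE -dp -hornerZ -derivZ.
congr (_^`().[_]); apply: poly_ext => u.
by rewrite pE' hornerZ pE scalemxAr -mulmxDr NA.
Qed.

(** Since [A] will be invertible, the rank of the Hessian is the same at [v] and at [A *m v]: this
    is the invariant that locates the line x = y = w = 0. *)
Lemma hess_at_chain v : A^T *m hess_at (A *m v) *m A = l *: hess_at v.
Proof.
apply: colmx_ext => w; apply/colP => i.
have [p [pE dp]] := grad_at_line v w i.
have /fin_all_exists[p' Hp'] := grad_at_line (A *m v) (A *m w).
rewrite -scalemxAl [RHS]mxE -dp -hornerZ -derivZ -!mulmxA mxE.
transitivity ((\sum_k A k i *: p' k)^`().[0]).
  rewrite raddf_sum horner_sum; apply: eq_bigr => k _ /=.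
  by rewrite derivZ hornerZ (Hp' k).2 !mxE.
congr (_^`().[_]); apply: poly_ext => u.
rewrite hornerZ pE horner_sum.
have /rowP/(_ i) := grad_at_chain (v + u *: w).
rewrite !mxE => <-; apply: eq_bigr => k _.
by rewrite hornerZ (Hp' k).1 mulmxDr -scalemxAr mulrC.
Qed.

End Chain.
End Symmetry.

Section Rank.
Variable K : fieldType.

Definition minor (H : nat -> nat -> K) i1 i2 i3 j1 j2 j3 :=
  H i1 j1 * (H i2 j2 * H i3 j3 - H i2 j3 * H i3 j2)
  - H i1 j2 * (H i2 j1 * H i3 j3 - H i2 j3 * H i3 j1)
  + H i1 j3 * (H i2 j1 * H i3 j2 - H i2 j2 * H i3 j1).

Lemma det3 (M : 'M[K]_3) :
  \det M = minor (fun i j => M (inord i) (inord j)) 0 1 2 0 1 2.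
Proof.
pose g a b := M (inord a) (inord b).
have Mg i j : M i j = g i j by rewrite /g !inord_val.
rewrite (expand_det_row _ ord0) !big_ord_recl big_ord0 /cofactor.
rewrite !(expand_det_row _ ord0) !big_ord_recl !big_ord0 /cofactor !det_mx11 !mxE.
rewrite !Mg /= /bump /= !addn0 !add1n /minor -!/(g _ _).
by rewrite !expr2 !expr1 !expr0; ring.
Qed.

Lemma minor_eq0 (H : 'M[K]_5) i1 i2 i3 j1 j2 j3 : (\rank H <= 2)%N ->
  minor (fun i j => H (inord i) (inord j)) i1 i2 i3 j1 j2 j3 = 0.
Proof.
move=> rH; pose r (l : seq nat) (i : 'I_3) : 'I_5 := inord (nth 0%N l i).
pose M := mxsub (r [:: i1; i2; i3]) (r [:: j1; j2; j3]) H.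
have := det3 M; rewrite /minor !mxE /r !inordK //= => <-.
apply/eqP; apply: contraTT rH; rewrite -unitfE -unitmxE -row_free_unit -ltnNge.
move=> /eqP rM; rewrite -[X in (X <= _)%N]rM /M (_ : mxsub _ _ H = rowsub (r [:: i1; i2; i3]) 1%:M
  *m H *m
  colsub (r [:: j1; j2; j3]) 1%:M).
  by rewrite (leq_trans (mxrankM_maxl _ _)) ?mxrankM_maxr.
by rewrite mulmx_colsub mul_rowsub_mx mul1mx mulmx1; apply/matrixP => i j; rewrite !mxE.
Qed.
End Rank.

Section LowRank.
Variables (K : numClosedFieldType) (q f : nat -> K).
Hypothesis smf : smooth_quintic f.
Local Notation hess := (hess_at q f).
Implicit Types x y w t s : K.

(** By Euler's relation the binary Hessian applied to (t, s) is 4 times the gradient of the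
    quintic. *)
Lemma dquintic_eq0 t s :
  dquintic_tt f t s * t + dquintic_ts f t s * s = 0 ->
  dquintic_ts f t s * t + dquintic_ss f t s * s = 0 -> t = 0 /\ s = 0.
Proof.
have n4 : 4%:R != 0 :> K by rewrite pnatr_eq0.
move=> ht hs; apply: smf; apply: (mulfI n4); rewrite mulr0.
  by rewrite -[RHS]ht /dquintic_t /dquintic_tt /dquintic_ts; ring.
by rewrite -[RHS]hs /dquintic_s /dquintic_ss /dquintic_ts; ring.
Qed.

(** The body is that of [P123], so this matrix is a generator of [G9] and [G16] by conversion. *)
Definition cycle_coords : 'M[K]_5 := perm_mx (cyc3 (inord 0) (inord 1) (inord 2)).

Lemma cycle_coordsE x y w t s :
  cycle_coords *m vec5 x y w t s = vec5 y w x t s.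
Proof.
have u : uniq [:: inord 0; inord 1; inord 2 : 'I_5].
  by rewrite /= !inE -!val_eqE /= !inordK.
have [e0 e1 e2] := cyc3E u.
rewrite [LHS]vec5E /cycle_coords -row_permE !mxE e0 e1 e2 !inordK //=.
have e k : (2 < k < 5)%N -> cyc3 (inord 0) (inord 1) (inord 2) (inord k) = inord k :> 'I_5.
  move=> /andP[k2 k5]; rewrite /cyc3 permM !tpermD // -val_eqE /= !inordK //; lia.
by rewrite !e // !inordK.
Qed.

Lemma rank_hess_cycle x y w t s :
  \rank (hess (vec5 y w x t s)) = \rank (hess (vec5 x y w t s)).
Proof.
have uC : cycle_coords \in unitmx by apply: unitmx_perm.
have NC v : nform_at q f (cycle_coords *m v) = 1 * nform_at q f v.
  rewrite [v]vec5E cycle_coordsE /nform_at !vec5_at //= /nform /klein; ring.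
have := hess_at_chain NC (vec5 x y w t s); rewrite scale1r cycle_coordsE => <-.
rewrite mxrankMfree ?row_free_unit // eqmxMfull // row_full_unit.
by rewrite unitmx_tr.
Qed.

Lemma hess_atE x y w t s i j : (i < 5)%N -> (j < 5)%N ->
  hess (vec5 x y w t s) (inord i) (inord j) = nth 0 (nth [::] (hess_seq q f x y w t s) i) j.
Proof. by move=> i5 j5; rewrite mxE !vec5_at // !inordK. Qed.

Let minors x y w t s : (\rank (hess (vec5 x y w t s)) <= 2)%N ->
  forall i1 i2 i3 j1 j2 j3, all (fun i => i < 5)%N [:: i1; i2; i3; j1; j2; j3] ->
  minor (fun i j => nth 0 (nth [::] (hess_seq q f x y w t s) i) j) i1 i2 i3 j1 j2 j3 = 0.
Proof.
move=> rH i1 i2 i3 j1 j2 j3 /and5P[h1 h2 h3 h4 /and3P[h5 h6 _]].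
by have := minor_eq0 i1 i2 i3 j1 j2 j3 rH; rewrite /minor !hess_atE.
Qed.

(** At w = 0 the minors on the coordinates x, y and one of t, s are -16 x^6 times a second
    derivative of f, so t = s = 0. The minor on x, y, w is then -192 x^2 y^7. *)
Lemma low_rank_x x y t s : (\rank (hess (vec5 x y 0 t s)) <= 2)%N -> x != 0 ->
  [/\ y = 0, t = 0 & s = 0].
Proof.
move=> /minors rH x0.
have nz (c a b : K) : c * x ^+ 6 * a = b -> b = 0 -> c != 0 -> a = 0.
  move=> <- h c0; have cx : c * x ^+ 6 != 0 by rewrite mulf_neq0 ?expf_neq0.
  by apply: (mulfI cx); rewrite h mulr0.
have n16 : - 16%:R != 0 :> K by rewrite oppr_eq0 pnatr_eq0.
have tt : dquintic_tt f t s = 0.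
  by apply: (nz _ _ _ _ (rH 0 1 3 0 1 3 isT)%N n16); rewrite /minor /=; ring.
have ts : dquintic_ts f t s = 0.
  by apply: (nz _ _ _ _ (rH 0 1 3 0 1 4 isT)%N n16); rewrite /minor /=; ring.
have ss : dquintic_ss f t s = 0.
  by apply: (nz _ _ _ _ (rH 0 1 4 0 1 4 isT)%N n16); rewrite /minor /=; ring.
have [t0 s0] : t = 0 /\ s = 0 by apply: dquintic_eq0; rewrite ?tt ?ts ?ss; ring.
split=> //; have := rH 0 1 2 0 1 2 isT; rewrite t0 s0 /minor /quadratic /= => h.
have n192 : - 192%:R * x ^+ 2 != 0 :> K by rewrite mulf_neq0 ?expf_neq0 ?oppr_eq0 ?pnatr_eq0.
have : y ^+ 7 = 0 by apply: (mulfI n192); rewrite mulr0 -[RHS]h /quadratic; ring.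
by move=> /eqP; rewrite expf_eq0 => /eqP.
Qed.

(** The three cases are the line, the three coordinate points off it, and the region x y w nonzero,
    about which nothing more is asserted. *)
Variant low_rank_spec x y w t s : Prop :=
| LowRankLine of x = 0 & y = 0 & w = 0
| LowRankAxis of t = 0 & s = 0 & [|| (x != 0) && (y == 0) && (w == 0),
    (x == 0) && (y != 0) && (w == 0) | (x == 0) && (y == 0) && (w != 0)]
| LowRankOpen of x != 0 & y != 0 & w != 0.

Lemma low_rankP x y w t s : (\rank (hess (vec5 x y w t s)) <= 2)%N ->
  low_rank_spec x y w t s.
Proof.
move=> rH; have rH1 := rH; rewrite -rank_hess_cycle in rH1.
have rH2 := rH1; rewrite -rank_hess_cycle in rH2.
have [x0|x0] := eqVneq x 0; have [y0|y0] := eqVneq y 0; have [w0|w0] := eqVneq w 0;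
  try (by constructor).
- move: rH2; rewrite x0 y0 => /low_rank_x/(_ w0)[_ t0 s0].
  by constructor=> //; rewrite !eqxx w0.
- move: rH1; rewrite x0 w0 => /low_rank_x/(_ y0)[_ t0 s0].
  by constructor=> //; rewrite !eqxx y0.
- by move: rH1; rewrite x0 => /low_rank_x/(_ y0)[h]; rewrite h eqxx in w0.
- move: rH; rewrite y0 w0 => /low_rank_x/(_ x0)[_ t0 s0].
  by constructor=> //; rewrite !eqxx x0.
- by move: rH2; rewrite y0 => /low_rank_x/(_ w0)[h]; rewrite h eqxx in x0.
- by move: rH; rewrite w0 => /low_rank_x/(_ x0)[h]; rewrite h eqxx in y0.
Qed.
End LowRank.

(** * Block decomposition *)

Section RatioEquations.
Variable K : numClosedFieldType.
Implicit Types x y w a b N r : K.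

(** Here (x, y, w) belongs to a point of the image of the line, and (a, b, 0) to a kernel vector of
    the Hessian there. The entry [N] contains q; the combination of a times the first equation and
    -b times the second eliminates it and leaves x^2 a^2 = y w b^2. The third equation is the
    gradient condition. *)
Lemma ratio_exists x y w a b N : x != 0 -> y != 0 -> w != 0 ->
  (a != 0) || (b != 0) ->
  12%:R * x ^+ 2 * y * a + N * b = 0 -> N * a + 12%:R * y ^+ 2 * w * b = 0 ->
  4%:R * a ^+ 3 * b * x + a ^+ 4 * y + b ^+ 4 * w = 0 ->
  exists2 r, r ^+ 2 + 4%:R * r + 1 = 0 & x ^+ 4 * y * r ^+ 2 = y ^+ 4 * w.
Proof.
move=> x0 y0 w0 ab e1 e2 e3.
have n12 : 12%:R != 0 :> K by rewrite pnatr_eq0.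
have a0 : a != 0.
  apply: contraTneq ab => a0; rewrite a0 eqxx /= negbK.
  move: e2; rewrite a0 mulr0 add0r => /eqP.
  by rewrite mulf_eq0 (negPf (mulf_neq0 (mulf_neq0 n12 (expf_neq0 2 y0)) w0)).
have b0 : b != 0.
  apply: contraTneq ab => b0; rewrite b0 eqxx orbF negbK.
  move: e1; rewrite b0 mulr0 addr0 => /eqP.
  by rewrite mulf_eq0 (negPf (mulf_neq0 (mulf_neq0 n12 (expf_neq0 2 x0)) y0)).
have e4 : x ^+ 2 * a ^+ 2 = y * w * b ^+ 2.
  have c0 : 12%:R * y != 0 by rewrite mulf_neq0.
  apply: (mulfI c0); apply/eqP; rewrite -subr_eq0; apply/eqP.
  transitivity (a * (12%:R * x ^+ 2 * y * a + N * b) - b * (N * a + 12%:R * y ^+ 2 * w * b)).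
    by ring.
  by rewrite e1 e2 !mulr0 subr0.
(* With this r, the third equation becomes r^2 + 4 r + 1 = 0 after x^2 a^2 = y w b^2 is inserted. *)
exists (a * y / (x * b)).
  have c0 : a ^+ 2 * b ^+ 2 * x ^+ 2 != 0 by rewrite !mulf_neq0 ?expf_neq0.
  apply: (mulfI c0); rewrite mulr0.
  transitivity (a ^+ 2 * y * (4%:R * a * b * x + a ^+ 2 * y) + a ^+ 2 * b ^+ 2 * x ^+ 2).
    by field; rewrite x0 b0.
  transitivity (y * (4%:R * a ^+ 3 * b * x + a ^+ 4 * y + b ^+ 4 * w)
    + b ^+ 2 * (x ^+ 2 * a ^+ 2 - y * w * b ^+ 2)); first by ring.
  by rewrite e3 e4 subrr !mulr0 addr0.
have -> : x ^+ 4 * y * (a * y / (x * b)) ^+ 2 = y ^+ 3 * (x ^+ 2 * a ^+ 2) / b ^+ 2.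
  by field; rewrite x0 b0.
by rewrite e4; field.
Qed.

(** The roots are -2 plus or minus the square root of 3. The identities are Euclid's algorithm for
    r^2 + 4 r + 1 with r^2 - 1 and with r^6 - 1; it ends in the nonzero constants 12 and 3. *)
Let root_pow r : r ^+ 2 + 4%:R * r + 1 = 0 -> r ^+ 2 != 1 /\ r ^+ 6 != 1.
Proof.
move=> rr; split; apply/eqP => h.
  have r4 : 4%:R * r + 2%:R = 0.
    transitivity ((r ^+ 2 + 4%:R * r + 1) - (r ^+ 2 - 1)); first by ring.
    by rewrite rr h subrr subr0.
  suff : 12%:R = 0 :> K by apply/eqP; rewrite pnatr_eq0.
  transitivity ((4%:R * r + 2%:R) * (4%:R * r + 14%:R)
    - 16%:R * (r ^+ 2 + 4%:R * r + 1)); first by ring.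
  by rewrite r4 rr mul0r mulr0 subrr.
have n30 : 30%:R != 0 :> K by rewrite pnatr_eq0.
have r26 : 26%:R * r + 7%:R = 0.
  apply: (mulfI n30); rewrite mulr0.
  transitivity ((r ^+ 2 + 4%:R * r + 1)
     * (r ^+ 4 - 4%:R * r ^+ 3 + 15%:R * r ^+ 2 - 56%:R * r + 209%:R) - (r ^+ 6 - 1)).
    by ring.
  by rewrite rr h mul0r subrr subr0.
suff : 3%:R = 0 :> K by apply/eqP; rewrite pnatr_eq0.
transitivity ((26%:R * r + 7%:R) * (26%:R * r + 97%:R)
  - 676%:R * (r ^+ 2 + 4%:R * r + 1)); first by ring.
by rewrite r26 rr mul0r mulr0 subrr.
Qed.

(** Around the cycle, (r1 r2 r3)^2 = 1. The two roots of the quadratic are inverse to each other, so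
    r1 r2 r3 is a root or the cube of a root, against [root_pow]. *)
Lemma ratio_contradiction x y w r1 r2 r3 : x != 0 -> y != 0 ->
  r1 ^+ 2 + 4%:R * r1 + 1 = 0 -> r2 ^+ 2 + 4%:R * r2 + 1 = 0 -> r3 ^+ 2 + 4%:R * r3 + 1 = 0 ->
  x ^+ 4 * y * r1 ^+ 2 = y ^+ 4 * w -> y ^+ 4 * w * r2 ^+ 2 = w ^+ 4 * x ->
  w ^+ 4 * x * r3 ^+ 2 = x ^+ 4 * y -> False.
Proof.
move=> x0 y0 h1 h2 h3 e1 e2 e3.
have E0 : x ^+ 4 * y != 0 by rewrite mulf_neq0 ?expf_neq0.
have P1 : (r1 * r2 * r3) ^+ 2 = 1.
  by apply: (mulfI E0); rewrite mulr1 -[RHS]e3 -e2 -e1; ring.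
have other r : r ^+ 2 + 4%:R * r + 1 = 0 -> r = r1 \/ r * r1 = 1.
  move=> h; have : (r - r1) * (r + r1 + 4%:R) = 0.
    transitivity ((r ^+ 2 + 4%:R * r + 1) - (r1 ^+ 2 + 4%:R * r1 + 1)); first by ring.
    by rewrite h h1 subrr.
  move=> /eqP; rewrite mulf_eq0 => /orP[|/eqP h']; first by rewrite subr_eq0 => /eqP; left.
  right; transitivity (r1 * (r + r1 + 4%:R) - (r1 ^+ 2 + 4%:R * r1 + 1) + 1); first by ring.
  by rewrite h' h1 mulr0 subrr add0r.
have [/eqP n2 /eqP n6] := root_pow h1; have [/eqP m2 _] := root_pow h2.
case: (other r2 h2) (other r3 h3) => [E2|E2] [E3|E3].
- by apply: n6; rewrite -[RHS]P1 E2 E3; ring.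
- apply: n2; rewrite -[RHS]P1 E2 -[_ * r3]mulrA [r1 * r3]mulrC E3 mulr1 //.
- by apply: n2; rewrite -[RHS]P1 E3 [r1 * r2]mulrC E2 mul1r.
have E : r2 = r3.
  have r10 : r1 != 0 by apply: contra_eq_neq E2 => ->; rewrite mulr0 eq_sym oner_eq0.
  by apply: (mulIf r10); rewrite E2 E3.
by apply: m2; rewrite -[RHS]P1 -E [r1 * r2]mulrC E2 mul1r.
Qed.
End RatioEquations.

Section BlockDiagonal.
Variables (K : numClosedFieldType) (q f : nat -> K) (A : 'M[K]_5) (l : K).
Hypotheses (smf : smooth_quintic f) (uA : A \in unitmx) (l0 : l != 0).
Hypothesis NA : forall v, nform_at q f (A *m v) = l * nform_at q f v.
Local Notation hess := (hess_at q f).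
Local Notation "v `# k" := (v (inord k) ord0) (at level 2, k at level 0).
Implicit Types (v u : 'cV[K]_5) (a b c t s : K).

(** [W] is the image of the line x = y = w = 0 and [U] that of the plane t = s = 0. *)
Let W t s := A *m vec5 0 0 0 t s.
Let U a b c := A *m vec5 a b c 0 0.

(** On the line x = y = w = 0 the Hessian annihilates the first three directions; the chain rule
    transports this by [A]. *)
Let hess_WU t s a b c : hess (W t s) *m U a b c = 0.
Proof.
have h : A^T *m (hess (W t s) *m U a b c) = 0.
  rewrite /U !mulmxA (hess_at_chain NA) -scalemxAl.
  rewrite (_ : _ *m _ = 0) ?scaler0 //; apply/colP => i.
  rewrite mxE big_ord5 !mxE !inordK //=.
  by case: i => -[|[|[|[|[|//]]]]] h /=; ring.
by rewrite -(mulKmx (_ : A^T \in unitmx) (_ *m _)) ?unitmx_tr // h mulmx0.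
Qed.

Let grad_UW t s a b c : (grad_at q f (U a b c) *m W t s) ord0 ord0 = 0.
Proof.
rewrite /W mulmxA (grad_at_chain NA) -scalemxAl mxE mxE big_ord5 !mxE !inordK //=.
by rewrite /quadratic /dquad_t /dquad_s /dquintic_t /dquintic_s; ring.
Qed.

Let grad_dot u v : (grad_at q f u *m v) ord0 ord0 =
  let r := grad_seq q f u`#0 u`#1 u`#2 u`#3 u`#4 in
  nth 0 r 0 * v`#0 + nth 0 r 1 * v`#1 + nth 0 r 2 * v`#2 + nth 0 r 3 * v`#3 + nth 0 r 4 * v`#4.
Proof. by rewrite mxE big_ord5 !mxE !inordK. Qed.

Let rank_W t s : (\rank (hess (W t s)) <= 2)%N.
Proof.
have -> : \rank (hess (W t s)) = \rank (hess (vec5 0 0 0 t s)).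
  have := hess_at_chain NA (vec5 0 0 0 t s); rewrite -/(W t s) => h.
  rewrite -(mxrank_scale_nz (hess (vec5 _ _ _ _ _)) l0) -h.
  by rewrite mxrankMfree ?row_free_unit // eqmxMfull // row_full_unit unitmx_tr.
pose B : 'M[K]_(5, 2) := \matrix_(i, j) (i == j + 3 :> nat)%N%:R.
pose C : 'M[K]_(2, 5) := \matrix_(i, j) hess (vec5 0 0 0 t s) (inord (i + 3)) j.
suff -> : hess (vec5 0 0 0 t s) = B *m C.
  by rewrite (leq_trans (mxrankM_maxl _ _)) // rank_leq_col.
apply/matrixP => i j; rewrite [RHS]mxE !big_ord_recl big_ord0 !mxE !inordK //= addr0.
rewrite /bump /=.
case: i => -[|[|[|[|[|//]]]]] hi /=; rewrite ?mul1r ?mul0r ?addr0 ?add0r //.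
all: case: j => -[|[|[|[|[|//]]]]] hj /=; ring.
Qed.

Let low t s : low_rank_spec (W t s)`#0 (W t s)`#1 (W t s)`#2 (W t s)`#3 (W t s)`#4.
Proof. by apply: (low_rankP (q := q) smf); rewrite -vec5E; exact: rank_W. Qed.

Let WE t s : W t s = t *: W 1 0 + s *: W 0 1.
Proof.
rewrite /W !scalemxAr -mulmxDr; congr (A *m _); apply/colP => i; rewrite !mxE.
by case: i => -[|[|[|[|[|//]]]]] hi /=; ring.
Qed.

Let WD t s t' s' : W (t + t') (s + s') = W t s + W t' s'.
Proof. by rewrite WE [W t s]WE [W t' s']WE !scalerDl addrACA. Qed.

Let W_eq0 t s : W t s = 0 -> t = 0 /\ s = 0.
Proof.
move=> h; have := mulKmx uA (vec5 0 0 0 t s); rewrite -/(W t s) h mulmx0.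
by move=> /esym/vec5_eq0[].
Qed.

Let WC t s k : (W t s)`#k = t * (W 1 0)`#k + s * (W 0 1)`#k.
Proof. by rewrite {1}WE [LHS]mxE [X in X + _]mxE [X in _ + X]mxE. Qed.

Let WDC t s t' s' k : (W (t + t') (s + s'))`#k = (W t s)`#k + (W t' s')`#k.
Proof. by rewrite WD [LHS]mxE. Qed.

Let W_zero_coord k : exists t s, (t != 0) || (s != 0) /\ (W t s)`#k = 0.
Proof.
have [h|h] := eqVneq ((W 1 0)`#k) 0.
  by exists 1, 0; rewrite oner_neq0.
exists (- (W 0 1)`#k), (W 1 0)`#k; rewrite h orbT; split=> //.
by rewrite WC; ring.
Qed.

Let low_not_two t s : [|| [&& (W t s)`#0 != 0, (W t s)`#1 != 0 & (W t s)`#2 == 0],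
   [&& (W t s)`#0 != 0, (W t s)`#1 == 0 & (W t s)`#2 != 0]
 | [&& (W t s)`#0 == 0, (W t s)`#1 != 0 & (W t s)`#2 != 0]] = false.
Proof.
case: (low t s) => [-> -> ->|_ _|]; first by rewrite eqxx.
  by case: (_`#0 == 0); case: (_`#1 == 0); case: (_`#2 == 0).
by case: (_`#0 == 0); case: (_`#1 == 0); case: (_`#2 == 0).
Qed.

(** Choose points of the image with first, second and third coordinate 0; none is open. If all three
    were coordinate points, the sum of two of them would have exactly two nonzero entries among x,
    y, w, which [low_not_two] forbids. *)
Let W_meets : exists t s, (t != 0) || (s != 0) /\
  [/\ (W t s)`#0 = 0, (W t s)`#1 = 0 & (W t s)`#2 = 0].
Proof.
have [t0 [s0 [n0 h0]]] := W_zero_coord 0.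
have [t1 [s1 [n1 h1]]] := W_zero_coord 1.
have [t2 [s2 [n2 h2]]] := W_zero_coord 2.
have P1 := low_not_two (t0 + t1) (s0 + s1); have P2 := low_not_two (t0 + t2) (s0 + s2).
rewrite !WDC h0 h1 h2 ?add0r ?addr0 in P1 P2.
case: (low t0 s0) => [? ? ?|_ _ a0|]; [by exists t0, s0| |by rewrite h0 eqxx].
case: (low t1 s1) => [? ? ?|_ _ a1|]; [by exists t1, s1| |by rewrite h1 eqxx].
case: (low t2 s2) => [? ? ?|_ _ a2|]; [by exists t2, s2| |by rewrite h2 eqxx].
rewrite h0 eqxx /= in a0; rewrite h1 eqxx !andbT !andbF /= in a1.
rewrite h2 eqxx !andbT !andbF orbF in a2.
case/orP: a0 => /andP[y0 w0].
  rewrite (eqP w0) add0r in P1; case/orP: a1 => /andP[x1 w1].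
    by rewrite x1 y0 w1 in P1.
  by rewrite (eqP x1) eqxx y0 w1 in P1.
rewrite (eqP y0) add0r in P1 P2; case/orP: a1 => /andP[x1 w1].
  by rewrite (eqP w1) addr0 x1 w0 eqxx /= in P1.
case/orP: a2 => /andP[x2 y2].
  by rewrite x2 (eqP y2) w0 eqxx in P2.
by rewrite (eqP x2) y2 w0 eqxx in P2.
Qed.

(** If [W t s] were a coordinate point, adding the point [W t0 s0] of the original line would give
    nonzero t or s beside one nonzero entry among x, y, w, which is not a low rank point. *)
Let W_open t s t0 s0 : (t0 != 0) || (s0 != 0) ->
  (W t0 s0)`#0 = 0 -> (W t0 s0)`#1 = 0 -> (W t0 s0)`#2 = 0 ->
  ~ [/\ (W t s)`#0 = 0, (W t s)`#1 = 0 & (W t s)`#2 = 0] ->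
  [/\ (W t s)`#0 != 0, (W t s)`#1 != 0 & (W t s)`#2 != 0].
Proof.
move=> n0 x0 y0 w0 nl; case: (low t s) => [x y w|t3 s4 ax|//]; first by case: nl.
case: (low (t + t0) (s + s0)); rewrite !WDC ?x0 ?y0 ?w0 ?t3 ?s4 ?addr0 ?add0r.
- by move=> x y w; case: nl.
- move=> t03 s04; have : W t0 s0 = 0.
    by rewrite [LHS]vec5E x0 y0 w0 t03 s04; apply/colP => -[[|[|[|[|[|//]]]]] hi]; rewrite !mxE.
  by move/W_eq0 => [t00 s00]; rewrite t00 s00 eqxx in n0.
by move=> h1 h2 h3; move: ax; rewrite (negPf h1) (negPf h2) (negPf h3).
Qed.

Let U_two_equations (p r : 'I_5) : exists a b c,
  [/\ U a b c != 0, U a b c p ord0 = 0 & U a b c r ord0 = 0].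
Proof.
pose M : 'M[K]_(3, 2) := \matrix_(i, j) A (if j == ord0 then p else r) (inord i).
have : kermx M != 0.
  by rewrite -mxrank_eq0 mxrank_ker subn_eq0 -ltnNge (leq_ltn_trans (rank_leq_col _)).
case/rowV0Pn => x xM x0; have {}xM : x *m M = 0 by apply/sub_kermxP.
have UE i : U (x ord0 ord0) (x ord0 (inord 1)) (x ord0 (inord 2)) i ord0
    = \sum_(j < 3) x ord0 j * A i (inord j).
  rewrite /U mxE big_ord5 !mxE !inordK //= !mulr0 !addr0 !big_ord_recl big_ord0 addr0.
  rewrite addrA ![A i _ * _]mulrC; congr (_ * _ + x _ _ * A i _ + x _ _ * A i _);
  by apply/val_inj; rewrite /= ?inordK.
exists (x ord0 ord0), (x ord0 (inord 1)), (x ord0 (inord 2)); split.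
- apply: contra_neq x0 => h; have := mulKmx uA (vec5 (x ord0 ord0) (x ord0 (inord 1)) (x ord0
  (inord 2)) 0 0).
  rewrite -/(U _ _ _) h mulmx0 => /esym/vec5_eq0[e0 e1 e2 _ _].
  apply/rowP => i; rewrite mxE.
  case: i => -[|[|[|//]]] hi; [rewrite -e0|rewrite -e1|rewrite -e2];
  by congr (x _ _); apply/val_inj; rewrite /= ?inordK.
- rewrite UE; have /rowP/(_ ord0) := xM; rewrite !mxE => xM0; rewrite -[RHS]xM0.
  by apply: eq_bigr => j _; rewrite mxE.
rewrite UE; have /rowP/(_ (lift ord0 ord0)) := xM; rewrite !mxE => xM0; rewrite -[RHS]xM0.
by apply: eq_bigr => j _; rewrite mxE.
Qed.

Let hess_row t s x y w t' s' a b c k : W t s = vec5 x y w t' s' -> (k < 5)%N ->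
  let r := nth [::] (hess_seq q f x y w t' s') k in
  nth 0 r 0 * (U a b c)`#0 + nth 0 r 1 * (U a b c)`#1 + nth 0 r 2 * (U a b c)`#2
  + nth 0 r 3 * (U a b c)`#3 + nth 0 r 4 * (U a b c)`#4 = 0.
Proof.
move=> WV k5 r; transitivity ((hess (W t s) *m U a b c) (inord k) ord0); last first.
  by rewrite hess_WU mxE.
by rewrite [RHS]mxE [RHS]big_ord5 WV /= !hess_atE.
Qed.

(** At a common point of the two lines, the Hessian relation ties the last two coordinates of [U]
    together: one of them vanishes as soon as the other does. Two conditions on a space of dimension
    3 thus achieve three zeros. *)
Let U_plane t0 s0 k : (t0 != 0) || (s0 != 0) ->
  (W t0 s0)`#0 = 0 -> (W t0 s0)`#1 = 0 -> (W t0 s0)`#2 = 0 ->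
  exists a b c, [/\ U a b c != 0, (U a b c)`#k = 0, (U a b c)`#3 = 0 & (U a b c)`#4 = 0].
Proof.
move=> n0 x0 y0 w0.
pose t := (W t0 s0)`#3; pose s := (W t0 s0)`#4.
have WV : W t0 s0 = vec5 0 0 0 t s by rewrite [LHS]vec5E x0 y0 w0.
have rows a b c :
   dquintic_tt f t s * (U a b c)`#3 + dquintic_ts f t s * (U a b c)`#4 = 0 /\
   dquintic_ts f t s * (U a b c)`#3 + dquintic_ss f t s * (U a b c)`#4 = 0.
  split; [have := hess_row a b c WV (isT : 3 < 5)%N
         | have := hess_row a b c WV (isT : 4 < 5)%N] => /= E;
  by rewrite -[RHS]E; ring.
have [tt0|tt0] := boolP ((dquintic_tt f t s != 0) || (dquintic_ts f t s != 0)).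
  have [a [b [c [U0 Uk U4]]]] := U_two_equations (inord k) (inord 4).
  exists a, b, c; split=> //; have [e1 e2] := rows a b c.
  move: e1 e2; rewrite U4 !mulr0 !addr0 => /eqP + /eqP; rewrite !mulf_eq0.
  by case/orP: tt0 => /negPf-> /=; [move=> /eqP | move=> _ /eqP].
have [a [b [c [U0 Uk U3]]]] := U_two_equations (inord k) (inord 3).
exists a, b, c; split=> //; have [_] := rows a b c.
move: tt0; rewrite negb_or !negbK => /andP[/eqP tt0 /eqP ts0].
rewrite ts0 mul0r add0r => /eqP; rewrite mulf_eq0 => /orP[/eqP ss0|/eqP//].
have [] := @dquintic_eq0 _ f smf t s; rewrite ?tt0 ?ts0 ?ss0 ?mul0r ?addr0 // => e1 e2.
have : W t0 s0 = 0.
  by rewrite WV e1 e2; apply/colP => -[[|[|[|[|[|//]]]]] hi]; rewrite !mxE.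
by move/W_eq0 => [t00 s00]; rewrite t00 s00 eqxx in n0.
Qed.

Let W_line t s : [/\ (W t s)`#0 = 0, (W t s)`#1 = 0 & (W t s)`#2 = 0].
Proof.
have [t0 [s0 [n0 [x00 y00 w00]]]] := W_meets.
apply: contrapT => nl; have [x0 y0 w0] := W_open n0 x00 y00 w00 nl.
set x := (W t s)`#0 in x0 *; set y := (W t s)`#1 in y0 *; set w := (W t s)`#2 in w0 *.
(* The entries off the diagonal in the Klein block of the Hessian; each use of [ratio_exists]
   eliminates one of them. *)
pose N0 := 4%:R * x ^+ 3 + w * quadratic q (W t s)`#3 (W t s)`#4.
pose N1 := 4%:R * y ^+ 3 + x * quadratic q (W t s)`#3 (W t s)`#4.
pose N2 := 4%:R * w ^+ 3 + y * quadratic q (W t s)`#3 (W t s)`#4.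
have eqs a b c : (U a b c)`#3 = 0 -> (U a b c)`#4 = 0 ->
  let a' := (U a b c)`#0 in let b' := (U a b c)`#1 in let c' := (U a b c)`#2 in
  [/\ 12%:R * x ^+ 2 * y * a' + N0 * b' + N2 * c' = 0,
     N0 * a' + 12%:R * y ^+ 2 * w * b' + N1 * c' = 0,
     N2 * a' + N1 * b' + 12%:R * w ^+ 2 * x * c' = 0 &
     (4%:R * a' ^+ 3 * b' + c' ^+ 4) * x + (4%:R * b' ^+ 3 * c' + a' ^+ 4) * y
     + (4%:R * c' ^+ 3 * a' + b' ^+ 4) * w = 0].
  move=> U3 U4 a' b' c'.
  have WV := vec5E (W t s).
  split.
  - by have := hess_row a b c WV (isT : 0 < 5)%N; rewrite /= U3 U4 !mulr0 !addr0.
  - by have := hess_row a b c WV (isT : 1 < 5)%N; rewrite /= U3 U4 !mulr0 !addr0.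
  - by have := hess_row a b c WV (isT : 2 < 5)%N; rewrite /= U3 U4 !mulr0 !addr0.
  have := grad_UW t s a b c; rewrite grad_dot U3 U4 /=.
  rewrite -/a' -/b' -/c' -/x -/y -/w /quadratic /dquad_t /dquad_s /dquintic_t /dquintic_s => E.
  by rewrite -[RHS]E; ring.
have nonzero a b c : U a b c != 0 -> (U a b c)`#3 = 0 -> (U a b c)`#4 = 0 ->
   [|| (U a b c)`#0 != 0, (U a b c)`#1 != 0 | (U a b c)`#2 != 0].
  move=> U0 U3 U4; apply: contraNT U0; rewrite !negb_or !negbK => /and3P[/eqP e0 /eqP e1 /eqP e2].
  apply/eqP; rewrite [LHS]vec5E U3 U4 e0 e1 e2.
  by apply/colP => -[[|[|[|[|[|//]]]]] hi]; rewrite !mxE.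
have [r1 h1 e1] : exists2 r, r ^+ 2 + 4%:R * r + 1 = 0 & x ^+ 4 * y * r ^+ 2 = y ^+ 4 * w.
  have [a [b [c [U0 Uk U3 U4]]]] := U_plane 2 n0 x00 y00 w00.
  have [E1 E2 E3 E4] := eqs a b c U3 U4; have := nonzero _ _ _ U0 U3 U4.
  rewrite Uk in E1 E2 E3 E4 *; rewrite eqxx orbF => ab.
  apply: (ratio_exists x0 y0 w0 ab (N := N0)).
  - by rewrite -[RHS]E1; ring.
  - by rewrite -[RHS]E2; ring.
  - by rewrite -[RHS]E4; ring.
have [r2 h2 e2] : exists2 r, r ^+ 2 + 4%:R * r + 1 = 0 & y ^+ 4 * w * r ^+ 2 = w ^+ 4 * x.
  have [a [b [c [U0 Uk U3 U4]]]] := U_plane 0 n0 x00 y00 w00.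
  have [E1 E2 E3 E4] := eqs a b c U3 U4; have := nonzero _ _ _ U0 U3 U4.
  rewrite Uk in E1 E2 E3 E4 *; rewrite eqxx /= => ab.
  apply: (ratio_exists y0 w0 x0 ab (N := N1)).
  - by rewrite -[RHS]E2; ring.
  - by rewrite -[RHS]E3; ring.
  - by rewrite -[RHS]E4; ring.
have [r3 h3 e3] : exists2 r, r ^+ 2 + 4%:R * r + 1 = 0 & w ^+ 4 * x * r ^+ 2 = x ^+ 4 * y.
  have [a [b [c [U0 Uk U3 U4]]]] := U_plane 1 n0 x00 y00 w00.
  have [E1 E2 E3 E4] := eqs a b c U3 U4; have := nonzero _ _ _ U0 U3 U4.
  rewrite Uk in E1 E2 E3 E4 *; rewrite eqxx /= orbC => ab.
  apply: (ratio_exists w0 x0 y0 ab (N := N2)).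
  - by rewrite -[RHS]E3; ring.
  - by rewrite -[RHS]E1; ring.
  - by rewrite -[RHS]E4; ring.
exact: (ratio_contradiction x0 y0 h1 h2 h3 e1 e2 e3).
Qed.

(** The image of the line is the line itself, so it contains the point whose t, s coordinates are
    those of this very [U a b c]. There the Hessian relation says that (t, s) is in the kernel of
    its own binary Hessian, and [dquintic_eq0] applies. *)
Let U_block a b c : (U a b c)`#3 = 0 /\ (U a b c)`#4 = 0.
Proof.
set k3 := _`#3; set k4 := _`#4.
pose p3 := (W 1 0)`#3; pose p4 := (W 1 0)`#4; pose r3 := (W 0 1)`#3; pose r4 := (W 0 1)`#4.
have W0 t s : t * p3 + s * r3 = 0 -> t * p4 + s * r4 = 0 -> t = 0 /\ s = 0.
  move=> e3 e4; apply: W_eq0; have [e0 e1 e2] := W_line t s.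
  rewrite [LHS]vec5E e0 e1 e2 !(WC t s) e3 e4.
  by apply/colP => -[[|[|[|[|[|//]]]]] hi]; rewrite !mxE.
have D0 : p3 * r4 - p4 * r3 != 0.
  apply/eqP => D0.
  have [|| r30 p30] := W0 r3 (- p3); [by ring | by rewrite -[RHS]oppr0 -D0; ring |].
  have [|| r40 p40] := W0 r4 (- p4); [by rewrite -[RHS]D0; ring | by ring |].
  have [|| /eqP] := W0 1 0; last by rewrite oner_eq0.
    by rewrite -[p3]opprK p30; ring.
  by rewrite -[p4]opprK p40; ring.
(* Cramer's rule for [W t s] with last coordinates [k3] and [k4]. *)
pose t := (k3 * r4 - k4 * r3) / (p3 * r4 - p4 * r3).
pose s := (p3 * k4 - p4 * k3) / (p3 * r4 - p4 * r3).
have WV : W t s = vec5 0 0 0 k3 k4.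
  have [e0 e1 e2] := W_line t s; rewrite [LHS]vec5E e0 e1 e2; congr (vec5 _ _ _ _ _).
    by rewrite (WC t s) -/p3 -/r3 /t /s; field.
  by rewrite (WC t s) -/p4 -/r4 /t /s; field.
apply: (dquintic_eq0 smf); [have := hess_row a b c WV (isT : 3 < 5)%N
  | have := hess_row a b c WV (isT : 4 < 5)%N] => /= E;
by rewrite -[RHS]E -/k3 -/k4; ring.
Qed.

Theorem block_diagonal (i j : 'I_5) : (i < 3)%N != (j < 3)%N -> A i j = 0.
Proof.
have -> : A i j = (A *m (delta_mx j ord0 : 'cV_5)) i ord0 by rewrite -colE mxE.
have iE k (hk : (k < 5)%N) : Ordinal hk = inord k by apply/val_inj; rewrite /= inordK.
have deltaE k (hk : (k < 5)%N) : (delta_mx (Ordinal hk) ord0 : 'cV[K]_5) =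
    vec5 (k == 0%N)%:R (k == 1%N)%:R (k == 2%N)%:R (k == 3%N)%:R (k == 4%N)%:R.
  apply/colP => m; rewrite !mxE eqxx andbT -val_eqE /=.
  by case: m => -[|[|[|[|[|//]]]]] hm /=; rewrite eq_sym.
case: j => j hj; rewrite deltaE /=.
have WP t s k : (k < 3)%N -> (A *m vec5 0 0 0 t s)`#k = 0.
  by case: (W_line t s) k => e0 e1 e2 [|[|[|//]]].
have UP a b c k : (2 < k < 5)%N -> (A *m vec5 a b c 0 0)`#k = 0.
  by have [e3 e4] := U_block a b c; case: k => [|[|[|[|[|//]]]]].
case: i => i hi; rewrite iE /=.
case: j hj => [|[|[|[|[|//]]]]] hj; rewrite /= ?mulr0n => ij;
  [apply: UP | apply: UP | apply: UP | apply: WP | apply: WP];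
  by move: ij; rewrite inordK //; case: i hi => [|[|[|[|[|]]]]].
Qed.
End BlockDiagonal.

(** * The Klein part *)

Section KleinHessian.
Variable K : numClosedFieldType.
Implicit Types x y w a b c : K.

(* Up to a factor [64], the Hessian determinant of the Klein-type quintic. *)
Definition klein_hess x y w := 29%:R * (x * y * w) ^+ 3
  - 3%:R * (x ^+ 2 * y ^+ 7 + y ^+ 2 * w ^+ 7 + w ^+ 2 * x ^+ 7).

Definition dklein_hess x y w a b c :=
    (87%:R * x ^+ 2 * (y * w) ^+ 3 - 3%:R * (2%:R * x * y ^+ 7 + 7%:R * w ^+ 2 * x ^+ 6)) * a
  + (87%:R * y ^+ 2 * (x * w) ^+ 3 - 3%:R * (2%:R * y * w ^+ 7 + 7%:R * x ^+ 2 * y ^+ 6)) * b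
  + (87%:R * w ^+ 2 * (x * y) ^+ 3 - 3%:R * (2%:R * w * x ^+ 7 + 7%:R * y ^+ 2 * w ^+ 6)) * c.

Lemma klein_hess_line x y w a b c : exists p : {poly K},
  (forall u, p.[u] = klein_hess (x + u * a) (y + u * b) (w + u * c))
  /\ p^`().[0] = dklein_hess x y w a b c.
Proof.
pose l (d d' : K) := d%:P + 'X * d'%:P.
have lE d d' u : (l d d').[u] = d + u * d' by rewrite !hornerE.
have dl d d' : (l d d')^`().[0] = d'.
  by rewrite derivD derivC derivM derivX derivC mulr0 mul1r addr0 add0r hornerC.
have : exists2 L : K -> K -> {poly K}, (forall d d' u, (L d d').[u] = d + u * d')
   & forall d d', (L d d')^`().[0] = d' by exists l.
case=> {l lE dl} L LE dL.
exists (29%:R%:P * (L x a * L y b * L w c) ^+ 3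
  - 3%:R%:P * (L x a ^+ 2 * L y b ^+ 7 + L y b ^+ 2 * L w c ^+ 7 + L w c ^+ 2 * L x a ^+ 7)).
split=> [u|]; first by rewrite !(hornerD, hornerN, hornerM, horner_exp, hornerC) !LE.
rewrite !(derivD, derivN, derivM, deriv_exp, derivC) /=.
rewrite !(hornerD, hornerN, hornerM, hornerMn, horner_exp, hornerC) !LE !dL.
by rewrite /dklein_hess; ring.
Qed.

(** In the monomials A, B, C and m = (x y w)^3, the operators x d/dx, y d/dy, w d/dw give 29 m = 2 A
    + 7 C and its rotations, so A = B = C. As A B C = m^3, it follows that 29^3 A^3 = 9^3 A^3, and
    23660 = 29^3 - 9^3. *)
Lemma klein_hess_singular x y w : (forall a b c, dklein_hess x y w a b c = 0) ->
  [/\ x * y = 0, y * w = 0 & w * x = 0].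
Proof.
move=> h; have h1 := h 1 0 0; have h2 := h 0 1 0; have h3 := h 0 0 1.
rewrite /dklein_hess in h1 h2 h3.
pose A := x ^+ 2 * y ^+ 7; pose B := y ^+ 2 * w ^+ 7; pose C := w ^+ 2 * x ^+ 7.
pose m := (x * y * w) ^+ 3.
have n3 : 3%:R != 0 :> K by rewrite pnatr_eq0.
have e1 : 29%:R * m = 2%:R * A + 7%:R * C.
  apply/eqP; rewrite -subr_eq0; apply/eqP/(mulfI n3); rewrite mulr0 -[RHS](mulr0 x) -[in RHS]h1.
  by rewrite /A /C /m; ring.
have e2 : 29%:R * m = 2%:R * B + 7%:R * A.
  apply/eqP; rewrite -subr_eq0; apply/eqP/(mulfI n3); rewrite mulr0 -[RHS](mulr0 y) -[in RHS]h2.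
  by rewrite /A /B /m; ring.
have e3 : 29%:R * m = 2%:R * C + 7%:R * B.
  apply/eqP; rewrite -subr_eq0; apply/eqP/(mulfI n3); rewrite mulr0 -[RHS](mulr0 w) -[in RHS]h3.
  by rewrite /B /C /m; ring.
have n39 : 39%:R != 0 :> K by rewrite pnatr_eq0.
have AB : A = B.
  apply: (mulfI n39); apply/eqP; rewrite -subr_eq0; apply/eqP.
  transitivity (7%:R * ((2%:R * B + 7%:R * A) - (2%:R * C + 7%:R * B))
    + 2%:R * ((2%:R * A + 7%:R * C) - (2%:R * B + 7%:R * A))); first by ring.
  by rewrite -e1 -e2 -e3 subrr !mulr0 addr0.
have AC : A = C.
  have n7 : 7%:R != 0 :> K by rewrite pnatr_eq0.
  apply: (mulfI n7); apply/eqP; rewrite -subr_eq0; apply/eqP.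
  transitivity ((2%:R * B + 7%:R * A) - (2%:R * A + 7%:R * C) + 2%:R * (A - B)); first by ring.
  by rewrite -e1 -e2 AB !subrr mulr0 addr0.
have A0 : A = 0.
  have n : 23660%:R != 0 :> K by rewrite pnatr_eq0.
  have A3 : 23660%:R * A ^+ 3 = 0.
    transitivity (24389%:R * (A * B * C) - (2%:R * A + 7%:R * A) ^+ 3).
      by rewrite -AB -AC; ring.
    by rewrite {3}AC -e1 /A /B /C /m; ring.
  by move/eqP: A3; rewrite mulf_eq0 (negPf n) expf_eq0 => /eqP.
have zero p q : p ^+ 2 * q ^+ 7 = 0 :> K -> p * q = 0.
  by move=> /eqP; rewrite mulf_eq0 !expf_eq0 /= => /orP[]/eqP->; rewrite ?mul0r ?mulr0.
by split; apply: zero; rewrite -?/A -?/B -?/C -?AB -?AC A0.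
Qed.
End KleinHessian.

Lemma big_ord3 (T : Type) (idx : T) (op : Monoid.law idx) (E : 'I_3 -> T) :
  \big[op/idx]_i E i = op (op (E (inord 0)) (E (inord 1))) (E (inord 2)).
Proof.
rewrite !big_ord_recr big_ord0 /= Monoid.mul1m.
by do !congr (op _ _); congr (E _); apply/val_inj; rewrite /= inordK.
Qed.

Lemma block_stable (K : numClosedFieldType) (q f : nat -> K) (l : K) (A : 'M[K]_5) x y w k :
  smooth_quintic f -> A \in unitmx -> l != 0 ->
  (forall v, nform_at q f (A *m v) = l * nform_at q f v) -> (2 < k < 5)%N ->
  (A *m vec5 x y w 0 0) (inord k) ord0 = 0.
Proof.
move=> smf uA l0 NA /andP[k2 k5]; have b j : (j < 3)%N -> A (inord k) (inord j) = 0.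
  move=> j3; apply: (block_diagonal smf uA l0 NA); rewrite !inordK ?j3 ?(ltn_trans j3) //.
  by rewrite ltnNge k2.
by rewrite mxE big_ord5 !mxE !inordK //= (b 0%N) // (b 1%N) // (b 2%N) //; ring.
Qed.

Section KleinPart.
Variables (K : numClosedFieldType) (q f : nat -> K) (l : K).
Hypotheses (smf : smooth_quintic f) (l0 : l != 0).
Local Notation "v `# k" := (v (inord k) ord0) (at level 2, k at level 0).
Implicit Types (A : 'M[K]_5) (x y w t s : K).

Definition semi_invariance A := forall v, nform_at q f (A *m v) = l * nform_at q f v.

Lemma klein_semi_invariant A : A \in unitmx -> semi_invariance A ->
  forall x y w, klein (A *m vec5 x y w 0 0)`#0 (A *m vec5 x y w 0 0)`#1
    (A *m vec5 x y w 0 0)`#2 = l * klein x y w.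
Proof.
move=> uA NA x y w; have := NA (vec5 x y w 0 0).
rewrite /nform_at /nform (@block_stable _ _ _ _ _ _ _ _ 3%N smf uA l0 NA isT) (@block_stable _ _ _
  _ _ _ _ _ 4%N smf uA l0 NA isT) /quadratic /quintic !vec5_at //= => E.
transitivity (l * (klein x y w + 0)); last by rewrite addr0.
have -> : klein x y w + 0 = klein x y w + x * y * w * (q 0 * 0 ^+ 2 + q 1 * 0 * 0 + q 2 * 0 ^+ 2)
  + (f 0 * 0 ^+ 5 + f 1 * 0 ^+ 4 * 0 + f 2 * 0 ^+ 3 * 0 ^+ 2 + f 3 * 0 ^+ 2 * 0 ^+ 3 + f 4 * 0 * 0
    ^+ 4 + f 5 * 0 ^+ 5) by ring.
rewrite -E; ring.
Qed.

Lemma quintic_semi_invariant A : A \in unitmx -> semi_invariance A ->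
  forall t s, quintic f (A *m vec5 0 0 0 t s)`#3 (A *m vec5 0 0 0 t s)`#4 = l * quintic f t s.
Proof.
move=> uA NA t s; have := NA (vec5 0 0 0 t s).
have bl := block_diagonal smf uA l0 NA.
have U3 k : (k < 3)%N -> (A *m vec5 0 0 0 t s)`#k = 0.
  move=> k3; have k5 : (k < 5)%N by rewrite (leq_trans k3).
  have b j : (2 < j < 5)%N -> A (inord k) (inord j) = 0.
    by move=> /andP[j2 j5]; apply: bl; rewrite !inordK ?k3 // ltnNge j2.
  by rewrite mxE big_ord5 !mxE !inordK //= (b 3%N) // (b 4%N) //; ring.
rewrite /nform_at /nform (U3 0%N) // (U3 1%N) // (U3 2%N) // /klein !vec5_at //= => E.
transitivity (l * (0 ^+ 4 * 0 + 0 ^+ 4 * 0 + 0 ^+ 4 * 0 + 0 * 0 * 0 * quadratic q t s + quintic f t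
  s)); last by ring.
by rewrite -E; ring.
Qed.

(** On t = s = 0 the Klein block of the Hessian transforms by the Klein block of [A] alone, and its
    determinant is 64 times [klein_hess]. *)
Let hess_det A : A \in unitmx -> semi_invariance A ->
  exists2 d, d != 0 & forall x y w, klein_hess (A *m vec5 x y w 0 0)`#0
    (A *m vec5 x y w 0 0)`#1 (A *m vec5 x y w 0 0)`#2 = d * klein_hess x y w.
Proof.
move=> uA NA; have bl := block_diagonal smf uA l0 NA.
pose P : 'M[K]_3 := \matrix_(i, j) A (inord i) (inord j).
pose N (H : 'M[K]_5) : 'M[K]_3 := \matrix_(i, j) H (inord i) (inord j).
pose M v := N (hess_at q f v).
have ij_eq (i j : 'I_3) : (inord i == inord j :> 'I_5) = (i == j).
  rewrite -!val_eqE /= !inordK //; apply: ltn_trans (ltn_ord _) _ => //.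
have PMP v : P^T *m M (A *m v) *m P = l *: M v.
  apply/matrixP => i j; have i5 : (i < 5)%N by apply: ltn_trans (ltn_ord i) _.
  have j5 : (j < 5)%N by apply: ltn_trans (ltn_ord j) _.
  have b3 k (m : 'I_3) : (2 < k < 5)%N -> A (inord k) (inord m) = 0.
    move=> /andP[k3 k5]; have m3 := ltn_ord m; have m5 : (m < 5)%N by apply: ltn_trans m3 _.
    by apply: bl; rewrite !inordK // m3 ltnNge k3.
  have /matrixP/(_ (inord i) (inord j)) := hess_at_chain NA v.
  rewrite /M; move: (hess_at q f (A *m v)) (hess_at q f v) => H H0 E.
  rewrite [RHS]mxE [X in l * X]mxE; have -> : l * H0 (inord i) (inord j) = (l *: H0) (inord i)
    (inord j) by rewrite [RHS]mxE.
  rewrite -E ![in RHS]mxE big_ord5 ![in RHS]mxE !big_ord5 ![in RHS]mxE.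
  rewrite !(b3 3%N) // !(b3 4%N) // ![in LHS]mxE big_ord3 ![in LHS]mxE !big_ord3 ![in LHS]mxE
    !inordK //.
  by rewrite /=; ring.
have detM x y w : \det (M (vec5 x y w 0 0)) = 64%:R * klein_hess x y w.
  rewrite det3 /minor !mxE !inordK //= /quadratic /klein_hess; ring.
(* The value of [klein_hess] at (1, 1, 1) is 29 - 9 = 20. *)
have uP : \det P != 0.
  apply/eqP => P0; have := PMP (vec5 1 1 1 0 0) => /(congr1 determinant).
  rewrite !det_mulmx P0 mulr0 detZ detM => /esym/eqP.
  rewrite mulf_eq0 expf_eq0 (negPf l0) /= (_ : _ * _ = 64%:R * 20%:R); last first.
    by rewrite /klein_hess; ring.
  by rewrite mulf_eq0 !pnatr_eq0.
exists (l ^+ 3 / \det P ^+ 2) => [|x y w].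
  by rewrite mulf_neq0 ?invr_eq0 ?expf_neq0.
have n64 : 64%:R != 0 :> K by rewrite pnatr_eq0.
apply: (mulfI n64); rewrite -detM mulrCA -detM.
have <- : A *m vec5 x y w 0 0 =
    vec5 (A *m vec5 x y w 0 0)`#0 (A *m vec5 x y w 0 0)`#1 (A *m vec5 x y w 0 0)`#2 0 0.
  by rewrite [LHS]vec5E (@block_stable _ _ _ _ _ _ _ _ 3%N smf uA l0 NA isT) (@block_stable _ _ _ _
    _ _ _ _ 4%N smf uA l0 NA isT).
have := PMP (vec5 x y w 0 0) => /(congr1 determinant).
by rewrite !det_mulmx det_tr detZ => E; apply: (mulfI uP); apply: (mulfI uP);
   rewrite [LHS]mulrC E; field.
Qed.

(** A column of the Klein block is the image of a coordinate point, which is singular on the Hessian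
    curve; its image is singular too, hence has at most one nonzero entry. *)
Lemma column_products A : A \in unitmx -> semi_invariance A -> forall j, (j < 3)%N ->
  let p k := A (inord k) (inord j) in
  [/\ p 0%N * p 1%N = 0, p 1%N * p 2%N = 0 & p 2%N * p 0%N = 0].
Proof.
move=> uA NA j j3 p; have [d d0 hA] := hess_det uA NA.
pose e0 : K := (j == 0%N)%:R; pose e1 : K := (j == 1%N)%:R; pose e2 : K := (j == 2%N)%:R.
have pE k : (A *m vec5 e0 e1 e2 0 0)`#k = p k.
  rewrite mxE big_ord5 !mxE !inordK //= /e0 /e1 /e2 /p.
  by case: j j3 {p e0 e1 e2} => [|[|[|//]]] _ /=; ring.
have uA' : invmx A \in unitmx by rewrite unitmx_inv.
have NA' v : nform_at q f (invmx A *m v) = l^-1 * nform_at q f v.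
  by apply: (mulfI l0); rewrite -NA mulKVmx // mulVKf.
have l0' : l^-1 != 0 by rewrite invr_eq0.
apply: klein_hess_singular => a b c.
(* The derivative at the image in direction (a, b, c) is compared with the derivative at the
   coordinate point in the direction pulled back by [A]. *)
pose v := invmx A *m vec5 a b c 0 0.
have vE : v = vec5 v`#0 v`#1 v`#2 0 0.
  rewrite [LHS]vec5E; congr (vec5 _ _ _ _ _);
  by apply: (block_stable _ _ _ smf uA' l0' NA').
have [p1 [p1E dp1]] := klein_hess_line (p 0%N) (p 1%N) (p 2%N) a b c.
have [p2 [p2E dp2]] := klein_hess_line e0 e1 e2 v`#0 v`#1 v`#2.
have E : p1 = d *: p2.
  apply: poly_ext => u; rewrite hornerZ p2E p1E -hA.
  have -> : A *m vec5 (e0 + u * v`#0) (e1 + u * v`#1) (e2 + u * v`#2) 0 0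
    = A *m vec5 e0 e1 e2 0 0 + u *: vec5 a b c 0 0.
    have <- : A *m v = vec5 a b c 0 0 by rewrite /v mulKVmx.
    rewrite scalemxAr -mulmxDr; congr (A *m _).
    by rewrite {4}vE linear_vec5 !mulr0 !addr0.
  have cE (x y : 'cV[K]_5) k : (x + u *: y)`#k = x`#k + u * y`#k by rewrite !mxE.
  by rewrite !cE !pE !vec5_at.
rewrite -dp1 E derivZ hornerZ dp2 /dklein_hess /e0 /e1 /e2.
by case: j j3 {p e0 e1 e2 pE p1 p1E dp1 p2 p2E dp2 E} => [|[|[|//]]] _ /=; ring.
Qed.
End KleinPart.

Section Blocks.
Variable K : numClosedFieldType.
Implicit Types (D : 'M[K]_3) (T : 'M[K]_2).

Definition bmx D T : 'M[K]_5 := block_mx D 0 0 T : 'M[K]_(3 + 2).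

Lemma bmxM D D' T T' : bmx D T *m bmx D' T' = bmx (D *m D') (T *m T').
Proof.
rewrite /bmx (mulmx_block D 0 0 T D' 0 0 T').
by rewrite !mulmx0 !mul0mx !addr0 add0r.
Qed.

Lemma bmxZ c D T : c *: bmx D T = bmx (c *: D) (c *: T).
Proof. by rewrite /bmx (scale_block_mx c D 0 0 T) !scaler0. Qed.

Lemma bmx_unit D T : (bmx D T \in unitmx) = (D \in unitmx) && (T \in unitmx).
Proof. by rewrite !unitmxE /bmx (det_ublock D 0 T) unitrM. Qed.

Lemma bmxE (A : 'M[K]_5) : (forall i j : 'I_5, (i < 3)%N != (j < 3)%N -> A i j = 0) ->
  A = bmx (\matrix_(i, j) A (inord i) (inord j)) (\matrix_(i, j) A (inord (3 + i)) (inord (3 + j))).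
Proof.
move=> h; pose B : 'M[K]_(3 + 2) := A; rewrite -[LHS](@submxK K 3 2 3 2 B) /bmx.
have l5 (i : 'I_3) : (i < 5)%N by apply: ltn_trans (ltn_ord i) _.
have r5 (i : 'I_2) : (3 + i < 5)%N by rewrite -[5%N]/(3 + 2)%N ltn_add2l.
have -> : ulsubmx B = \matrix_(i, j) A (inord i) (inord j).
  by apply/matrixP => i j; rewrite !mxE; congr (A _ _); apply/val_inj; rewrite /= inordK.
have -> : drsubmx B = \matrix_(i, j) A (inord (3 + i)) (inord (3 + j)).
  by apply/matrixP => i j; rewrite !mxE; congr (A _ _); apply/val_inj; rewrite /= inordK.
have -> : ursubmx B = 0.
  by apply/matrixP => i j; rewrite !mxE; apply: h; rewrite /= ltn_ord ltnNge leq_addr.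
have -> : dlsubmx B = 0.
  by apply/matrixP => i j; rewrite !mxE; apply: h; rewrite /= ltn_ord ltnNge leq_addr.
by [].
Qed.

Lemma bmx_vec5 D T x y w t s (v := D *m \col_i nth 0 [:: x; y; w] i)
    (u := T *m \col_i nth 0 [:: t; s] i) :
  bmx D T *m vec5 x y w t s = vec5 (v (inord 0) ord0) (v (inord 1) ord0) (v (inord 2) ord0)
    (u (inord 0) ord0) (u (inord 1) ord0).
Proof.
have -> : vec5 x y w t s = col_mx (\col_i nth 0 [:: x; y; w] i) (\col_i nth 0 [:: t; s] i) :>
  'cV[K]_(3 + 2).
  apply/colP => i; rewrite !mxE; case: splitP => j ij; rewrite mxE ij.
    by case: j {ij} => -[|[|[|//]]].
  by case: j {ij} => -[|[|//]].
rewrite /bmx (mul_block_col D 0 0 T) !mul0mx addr0 add0r -/v -/u; clearbody v u.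
apply/colP => i; rewrite !mxE; case: splitP => j ij; rewrite ij.
  by case: j {ij} => -[|[|[|//]]] hj /=; congr (v _ _); apply/val_inj; rewrite /= inordK.
by case: j {ij} => -[|[|//]] hj /=; congr (u _ _); apply/val_inj; rewrite /= inordK.
Qed.
End Blocks.

Section KleinNormalForm.
Variables (K : numClosedFieldType) (q f : nat -> K) (l z : K).
Hypotheses (smf : smooth_quintic f) (l0 : l != 0) (pz : 13.-primitive_root z).
Local Notation semi_inv := (semi_invariance q f l).
Local Notation "v `# k" := (v (inord k) ord0) (at level 2, k at level 0).
Local Notation C := (cycle_coords K).
Implicit Types (A : 'M[K]_5).

Definition klein_diag (k : nat) : 'M[K]_3 :=
  diag_mx (\row_i nth 0 [:: z ^+ k; (z ^- 4) ^+ k; (z ^+ 3) ^+ k] i).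

Definition quintic_invariant (T : 'M[K]_2) := forall t s,
  quintic f (T (inord 0) (inord 0) * t + T (inord 0) (inord 1) * s)
            (T (inord 1) (inord 0) * t + T (inord 1) (inord 1) * s) = quintic f t s.

Lemma semi_inv_cycle A : semi_inv A -> semi_inv (C *m A).
Proof.
move=> NA v; rewrite -mulmxA -NA; move: (A *m v) => u.
rewrite [u]vec5E cycle_coordsE /nform_at !vec5_at //= /nform /klein; ring.
Qed.

Lemma cycle_unit : C \in unitmx. Proof. exact: unitmx_perm. Qed.

Lemma cycle_row A j : [/\ (C *m A) (inord 0) j = A (inord 1) j,
  (C *m A) (inord 1) j = A (inord 2) j & (C *m A) (inord 2) j = A (inord 0) j].
Proof.
have u : uniq [:: inord 0; inord 1; inord 2 : 'I_5].
  by rewrite /= !inE -!val_eqE /= !inordK.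
by have [e0 e1 e2] := cyc3E u; rewrite /cycle_coords -row_permE !mxE e0 e1 e2.
Qed.

(** Powers of the cyclic permutation bring a nonzero entry of the first column to the corner; that
    column cannot vanish. *)
Let first_column A : A \in unitmx -> semi_inv A ->
  exists i, [/\ C ^+ i *m A \in unitmx, semi_inv (C ^+ i *m A) &
    (C ^+ i *m A) (inord 0) (inord 0) != 0].
Proof.
move=> uA NA; have [C0 C1 C2] := cycle_row A (inord 0).
have uCA : C *m A \in unitmx by rewrite unitmx_mul cycle_unit.
have [h0|h0] := eqVneq (A (inord 0) (inord 0)) 0; last first.
  by exists 0%N; rewrite expr0 mul1mx.
have [h1|h1] := eqVneq (A (inord 1) (inord 0)) 0; last first.
  by exists 1%N; rewrite expr1 C0; split=> //; apply: semi_inv_cycle.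
exists 2%N; rewrite expr2 -mulmxE -mulmxA; split.
- by rewrite unitmx_mul cycle_unit.
- by do 2!apply: semi_inv_cycle.
have [-> _ _] := cycle_row (C *m A) (inord 0); rewrite C1; apply/eqP => h2.
have bl := block_diagonal smf uA l0 NA.
have : A *m vec5 1 0 0 0 0 = 0.
  have E k : (A *m vec5 1 0 0 0 0)`#k = A (inord k) (inord 0).
    by rewrite mxE big_ord5 !mxE !inordK //=; ring.
  rewrite [LHS]vec5E !E h0 h1 h2 (bl (inord 3)) ?(bl (inord 4)) ?inordK //.
  by apply/colP => -[[|[|[|[|[|//]]]]] hi]; rewrite !mxE.
move=> h; have := mulKmx uA (vec5 1 0 0 0 0); rewrite h mulmx0 => /esym/vec5_eq0[/eqP].
by rewrite oner_eq0.
Qed.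

Let diagonal A : A \in unitmx -> semi_inv A -> A (inord 0) (inord 0) != 0 ->
  let p i j := A (inord i) (inord j) in
  [/\ p 1%N 0%N = 0 /\ p 2%N 0%N = 0, p 0%N 1%N = 0 /\ p 2%N 1%N = 0, p 0%N 2%N = 0 /\ p 1%N 2%N = 0 &
   [/\ p 0%N 0%N ^+ 4 * p 1%N 1%N = l, p 1%N 1%N ^+ 4 * p 2%N 2%N = l & p 2%N 2%N ^+ 4 * p 0%N 0%N
     = l]].
Proof.
move=> uA NA p00 p.
have n2 : 2%:R * l != 0 by rewrite mulf_neq0 ?pnatr_eq0.
have [P0 _ P0'] := column_products smf l0 uA NA (isT : 0 < 3)%N.
have [P1 P1' P1''] := column_products smf l0 uA NA (isT : 1 < 3)%N.
have [P2 P2' P2''] := column_products smf l0 uA NA (isT : 2 < 3)%N.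
have p10 : p 1%N 0%N = 0 by move/eqP: P0; rewrite mulf_eq0 (negPf p00) => /eqP.
have p20 : p 2%N 0%N = 0 by move/eqP: P0'; rewrite mulf_eq0 (negPf p00) orbF => /eqP.
have inv x y w : klein (p 0 0 * x + p 0 1 * y + p 0 2 * w) (p 1 0 * x + p 1 1 * y + p 1 2 * w)
    (p 2 0 * x + p 2 1 * y + p 2 2 * w) = l * klein x y w.
  rewrite -(klein_semi_invariant smf l0 uA NA) /p.
  by congr klein; rewrite mxE big_ord5 !mxE !inordK //= !mulr0 !addr0.
(* Otherwise the second column is zero or sits in the third row. On w = 0 the transformed cycle is
   then 0 or a multiple of x y^4, while it should be l x^4 y; the values at y = 1 and y = 2 tell
   these apart. *)
have p11 : p 1%N 1%N != 0.
  apply/eqP => h11; have [h21|h21] := eqVneq (p 2%N 1%N) 0.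
    move/eqP: l0; apply; have := inv 1 1 0; rewrite p10 p20 h11 h21 /klein => E.
    by transitivity (l * (1 ^+ 4 * 1 + 1 ^+ 4 * 0 + 0 ^+ 4 * 1)); [ring | rewrite -E; ring].
  have h01 : p 0%N 1%N = 0 by move/eqP: P1''; rewrite mulf_eq0 (negPf h21) => /eqP.
  have E1 := inv 1 1 0; have E2 := inv 1 2%:R 0; move: E1 E2.
  rewrite p10 p20 h11 h01 /klein => E1 E2.
  have : 7%:R * (2%:R * l) = 0.
    transitivity (16%:R * (l * (1 ^+ 4 * 1 + 1 ^+ 4 * 0 + 0 ^+ 4 * 1)) -
      l * (1 ^+ 4 * 2%:R + 2%:R ^+ 4 * 0 + 0 ^+ 4 * 1)); first by ring.
    by rewrite -E1 -E2; ring.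
  by apply/eqP; rewrite mulf_neq0 // pnatr_eq0.
have p01 : p 0%N 1%N = 0 by move/eqP: P1; rewrite mulf_eq0 (negPf p11) orbF => /eqP.
have p21 : p 2%N 1%N = 0 by move/eqP: P1'; rewrite mulf_eq0 (negPf p11) => /eqP.
have p22 : p 2%N 2%N != 0.
  apply/eqP => h22; have [h12|h12] := eqVneq (p 1%N 2%N) 0.
    move/eqP: l0; apply; have := inv 1 0 1; rewrite p10 p20 h22 h12 /klein => E.
    by transitivity (l * (1 ^+ 4 * 0 + 0 ^+ 4 * 1 + 1 ^+ 4 * 1)); [ring | rewrite -E; ring].
  have h02 : p 0%N 2%N = 0 by move/eqP: P2; rewrite mulf_eq0 (negPf h12) orbF => /eqP.
  have E1 := inv 1 0 1; have E2 := inv 1 0 2%:R; move: E1 E2.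
  rewrite p10 p20 h22 h02 /klein => E1 E2.
  have : 7%:R * (2%:R * l) = 0.
    transitivity (l * (1 ^+ 4 * 0 + 0 ^+ 4 * 2%:R + 2%:R ^+ 4 * 1)
      - 2%:R * (l * (1 ^+ 4 * 0 + 0 ^+ 4 * 1 + 1 ^+ 4 * 1))); first by ring.
    by rewrite -E1 -E2; ring.
  by apply/eqP; rewrite mulf_neq0 // pnatr_eq0.
have p02 : p 0%N 2%N = 0 by move/eqP: P2''; rewrite mulf_eq0 (negPf p22) => /eqP.
have p12 : p 1%N 2%N = 0 by move/eqP: P2'; rewrite mulf_eq0 (negPf p22) orbF => /eqP.
move: inv; rewrite p10 p20 p01 p21 p02 p12 /klein => inv; split=> //; split.
- transitivity (l * (1 ^+ 4 * 1 + 1 ^+ 4 * 0 + 0 ^+ 4 * 1)); [rewrite -inv|]; ring.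
- transitivity (l * (0 ^+ 4 * 1 + 1 ^+ 4 * 1 + 1 ^+ 4 * 0)); [rewrite -inv|]; ring.
- transitivity (l * (1 ^+ 4 * 0 + 0 ^+ 4 * 1 + 1 ^+ 4 * 1)); [rewrite -inv|]; ring.
Qed.

Theorem klein_part A : A \in unitmx -> semi_inv A ->
  exists i k c T, [/\ c != 0, T \in unitmx, quintic_invariant T &
    C ^+ i *m A = c *: bmx (klein_diag k) T].
Proof.
move=> uA0 NA0; have [i [uA NA p00]] := first_column uA0 NA0.
exists i; move: (C ^+ i *m A) uA NA p00 => {uA0 NA0} {}A uA NA p00.
have [[p10 p20] [p01 p21] [p02 p12] [e0 e1 e2]] := diagonal uA NA p00.
set c1 := A (inord 0) (inord 0) in p00 e0 e1 e2.
set c2 := A (inord 1) (inord 1) in e0 e1 e2.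
set c3 := A (inord 2) (inord 2) in e0 e1 e2.
(* Dividing by [c0] makes the multiplier of the quintic equal to 1; the entries of the Klein block
   then become d, d^-4, d^16 with d^65 = 1. *)
pose c0 := 5.-root l; have c05 : c0 ^+ 5 = l by rewrite rootCK.
have c00 : c0 != 0 by apply: contra_eq_neq c05 => ->; rewrite expr0n eq_sym.
have d2 : c2 / c0 = (c1 / c0) ^- 4.
  have n : c1 ^+ 4 != 0 by rewrite expf_neq0.
  apply: (mulfI n); rewrite mulrA e0 -c05; field; rewrite c00 p00 //.
have d3 : c3 / c0 = (c1 / c0) ^+ 16.
  have c20 : c2 != 0.
    by apply: contra_eq_neq e0 => ->; rewrite mulr0 eq_sym.
  have n : c2 ^+ 4 != 0 by rewrite expf_neq0.
  apply: (mulfI n); rewrite mulrA e1 -c05.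
  have -> : c2 = c0 * (c1 / c0) ^- 4 by rewrite -d2 mulrCA divff // mulr1.
  by field; rewrite c00 p00.
have d65 : (c1 / c0) ^+ 65 = 1.
  have := e2; have -> : c3 = c0 * (c1 / c0) ^+ 16 by rewrite -d3 mulrCA divff // mulr1.
  have -> : (c1 / c0) ^+ 65 = (c0 * (c1 / c0) ^+ 16) ^+ 4 * c1 / c0 ^+ 5 by field.
  by move=> ->; rewrite c05 divff.
have d0 : c1 / c0 != 0 by rewrite mulf_neq0 ?invr_eq0.
move: d0 d2 d3 d65; move Dd : (c1 / c0) => d d0 d2 d3 d65.
(* Chinese remainders for 65 = 5 * 13: 26 is 1 modulo 5 and 0 modulo 13, 40 is the opposite, and 26
   + 40 = 66. The fifth root of unity [eps] equals its powers -4 and 16, so it goes into the scalar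
   [c]. *)
pose eps := d ^+ 26; have eps5 : eps ^+ 5 = 1.
  by rewrite /eps -exprM -[(26 * 5)%N]/(65 * 2)%N exprM d65 expr1n.
have eps0 : eps != 0 by rewrite expf_neq0.
have d13 : (d ^+ 40) ^+ 13 = 1 by rewrite -exprM -[(40 * 13)%N]/(65 * 8)%N exprM d65 expr1n.
have [k Dk] := prim_rootP pz d13.
have dE : d = eps * z ^+ k by rewrite -Dk /eps -exprD -[(26 + 40)%N]/(65 + 1)%N exprD d65 mul1r.
have bl := block_diagonal smf uA l0 NA.
pose c := c0 * eps; have cn0 : c != 0 by rewrite mulf_neq0.
pose T : 'M[K]_2 := c^-1 *: \matrix_(i, j) A (inord (3 + i)) (inord (3 + j)).
have AE : A = c *: bmx (klein_diag k) T.
  rewrite [LHS](bmxE bl) bmxZ /T scalerA divff // scale1r; congr bmx.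
  apply/matrixP => i' j'; rewrite !mxE.
  have z0 : z != 0 by rewrite (prim_root_eq0 pz).
  have c1E : c1 = c * z ^+ k by rewrite /c -mulrA -dE -Dd mulrCA divff // mulr1.
  have c2E : c2 = c * (z ^- 4) ^+ k.
    rewrite (_ : c2 = c0 * d ^- 4); last by rewrite -d2 mulrCA divff // mulr1.
    have -> : d ^- 4 = eps / eps ^+ 5 * (z ^+ k) ^- 4 by rewrite dE; field; rewrite eps0 expf_neq0.
    by rewrite eps5 divr1 /c -mulrA exprVn -!exprM mulnC.
  have c3E : c3 = c * (z ^+ 3) ^+ k.
    rewrite (_ : c3 = c0 * d ^+ 16); last by rewrite -d3 mulrCA divff // mulr1.
    have e16 : eps ^+ 16 = eps.
      by rewrite -[16%N]/(5 * 3 + 1)%N exprD exprM eps5 expr1n mul1r.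
    have z16 : (z ^+ k) ^+ 16 = (z ^+ 3) ^+ k.
      by rewrite -exprM mulnC exprM -(prim_expr_mod pz 16).
    by rewrite dE exprMn e16 z16 mulrA.
  case: i' => -[|[|[|//]]] hi; case: j' => -[|[|[|//]]] hj;
  rewrite /= ?mulr1n ?mulr0n ?mulr0 //.
clearbody T; exists k, c, T; split=> //.
- move: uA; rewrite AE bmxZ bmx_unit => /andP[_].
  by rewrite unitmxZ ?unitfE.
move=> t s; apply: (mulfI l0); have c5 : c ^+ 5 = l by rewrite /c exprMn eps5 mulr1.
have sc a b : quintic f (c * a) (c * b) = l * quintic f a b by rewrite -c5 /quintic; ring.
rewrite -[RHS](quintic_semi_invariant smf l0 uA NA) AE -scalemxAl bmx_vec5.
have cE (x : 'cV[K]_5) k' : (c *: x)`#k' = c * x`#k' by rewrite mxE.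
rewrite !cE !vec5_at //= sc; congr (_ * quintic f _ _);
by rewrite [RHS]mxE !big_ord_recl big_ord0 !mxE addr0; congr (T _ _ * _ + T _ _ * _);
   apply/val_inj; rewrite /= inordK.
Qed.
End KleinNormalForm.

(** * Binary quintics *)

Section QuinticSubstitution.
Variable K : numClosedFieldType.
Implicit Types (f g : nat -> K) (T S M : 'M[K]_2) (v w : 'cV[K]_2) (a b c d t s : K).

Local Notation "v `# k" := (v (inord k) ord0) (at level 2, k at level 0).

Definition quintic_at f v := quintic f v`#0 v`#1.

Definition vec2 t s : 'cV[K]_2 := \col_i nth 0 [:: t; s] i.

Definition mx2 a b c d : 'M[K]_2 := \matrix_(i, j) nth 0 (nth [::] [:: [:: a; b]; [:: c; d]] i) j.

(** Explicit coefficients of the substituted form: invariance becomes six polynomial equations in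
    the matrix entries. *)
Definition subst_quintic f a b c d : nat -> K := nth 0 [::
    f 0%N * a ^+ 5
    + f 1%N * a ^+ 4 * c
    + f 2%N * a ^+ 3 * c ^+ 2
    + f 3%N * a ^+ 2 * c ^+ 3
    + f 4%N * a * c ^+ 4
    + f 5%N * c ^+ 5;
    f 0%N * 5%:R * a ^+ 4 * b
    + f 1%N * (a ^+ 4 * d + 4%:R * a ^+ 3 * b * c)
    + f 2%N * (2%:R * a ^+ 3 * c * d + 3%:R * a ^+ 2 * b * c ^+ 2)
    + f 3%N * (3%:R * a ^+ 2 * c ^+ 2 * d + 2%:R * a * b * c ^+ 3)
    + f 4%N * (4%:R * a * c ^+ 3 * d + b * c ^+ 4)
    + f 5%N * 5%:R * c ^+ 4 * d;
    f 0%N * 10%:R * a ^+ 3 * b ^+ 2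
    + f 1%N * (4%:R * a ^+ 3 * b * d + 6%:R * a ^+ 2 * b ^+ 2 * c)
    + f 2%N * (a ^+ 3 * d ^+ 2 + 6%:R * a ^+ 2 * b * c * d + 3%:R * a * b ^+ 2 * c ^+ 2)
    + f 3%N * (3%:R * a ^+ 2 * c * d ^+ 2 + 6%:R * a * b * c ^+ 2 * d + b ^+ 2 * c ^+ 3)
    + f 4%N * (6%:R * a * c ^+ 2 * d ^+ 2 + 4%:R * b * c ^+ 3 * d)
    + f 5%N * 10%:R * c ^+ 3 * d ^+ 2;
    f 0%N * 10%:R * a ^+ 2 * b ^+ 3
    + f 1%N * (6%:R * a ^+ 2 * b ^+ 2 * d + 4%:R * a * b ^+ 3 * c)
    + f 2%N * (3%:R * a ^+ 2 * b * d ^+ 2 + 6%:R * a * b ^+ 2 * c * d + b ^+ 3 * c ^+ 2)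
    + f 3%N * (a ^+ 2 * d ^+ 3 + 6%:R * a * b * c * d ^+ 2 + 3%:R * b ^+ 2 * c ^+ 2 * d)
    + f 4%N * (4%:R * a * c * d ^+ 3 + 6%:R * b * c ^+ 2 * d ^+ 2)
    + f 5%N * 10%:R * c ^+ 2 * d ^+ 3;
    f 0%N * 5%:R * a * b ^+ 4
    + f 1%N * (4%:R * a * b ^+ 3 * d + b ^+ 4 * c)
    + f 2%N * (3%:R * a * b ^+ 2 * d ^+ 2 + 2%:R * b ^+ 3 * c * d)
    + f 3%N * (2%:R * a * b * d ^+ 3 + 3%:R * b ^+ 2 * c * d ^+ 2)
    + f 4%N * (a * d ^+ 4 + 4%:R * b * c * d ^+ 3)
    + f 5%N * 5%:R * c * d ^+ 4;
    f 0%N * b ^+ 5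
    + f 1%N * b ^+ 4 * d
    + f 2%N * b ^+ 3 * d ^+ 2
    + f 3%N * b ^+ 2 * d ^+ 3
    + f 4%N * b * d ^+ 4
    + f 5%N * d ^+ 5].


Lemma subst_quinticE f a b c d t s :
  quintic f (a * t + b * s) (c * t + d * s) = quintic (subst_quintic f a b c d) t s.
Proof. rewrite /quintic /subst_quintic /=; ring. Qed.

Lemma vec2E v : v = vec2 v`#0 v`#1.
Proof.
apply/colP => -[[|[|//]]] hi; rewrite mxE /=;
by congr (v _ _); apply/val_inj; rewrite /= inordK.
Qed.

Lemma mx2E T : T = mx2 (T (inord 0) (inord 0)) (T (inord 0) (inord 1))
  (T (inord 1) (inord 0)) (T (inord 1) (inord 1)).
Proof.
apply/matrixP => -[[|[|//]]] hi -[[|[|//]]] hj; rewrite mxE /=;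
by congr (T _ _); apply/val_inj; rewrite /= inordK.
Qed.

Lemma vec2_at t s : (vec2 t s)`#0 = t /\ (vec2 t s)`#1 = s.
Proof. by rewrite !mxE !inordK. Qed.

Lemma mx2_vec2 a b c d t s : mx2 a b c d *m vec2 t s = vec2 (a * t + b * s) (c * t + d * s).
Proof.
apply/colP => -[[|[|//]]] hi; rewrite !mxE !big_ord_recl big_ord0 !mxE /= addr0 //.
Qed.

Lemma mx2M a b c d a' b' c' d' : mx2 a b c d *m mx2 a' b' c' d' =
  mx2 (a * a' + b * c') (a * b' + b * d') (c * a' + d * c') (c * b' + d * d').
Proof.
apply/matrixP => -[[|[|//]]] hi -[[|[|//]]] hj;
by rewrite !mxE !big_ord_recl big_ord0 !mxE /= addr0.
Qed.

Lemma det_mx2 a b c d : \det (mx2 a b c d) = a * d - b * c.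
Proof.
rewrite (expand_det_row _ ord0) !big_ord_recl big_ord0 /cofactor !det_mx11 !mxE /=.
by rewrite !expr0 !expr1; ring.
Qed.

Lemma quintic_at_subst f S : exists g, forall v, quintic_at f (S *m v) = quintic_at g v.
Proof.
rewrite [S]mx2E; eexists => v.
by rewrite [v]vec2E mx2_vec2 /quintic_at !(proj1 (vec2_at _ _)) !(proj2 (vec2_at _ _)) subst_quinticE.
Qed.

Lemma quintic_coef_inj f g : (forall t s, quintic f t s = quintic g t s) ->
  forall i, (i < 6)%N -> f i = g i.
Proof.
move=> fg; pose P (h : nat -> K) := \poly_(i < 6) h i.
have PE h s : (P h).[s] = quintic h 1 s.
  by rewrite horner_poly !big_ord_recl big_ord0 /= /quintic; ring.
have E : P f = P g by apply: poly_ext => s; rewrite !PE fg.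
by move=> i i6; have := congr1 (coefp i) E; rewrite /= !coef_poly i6.
Qed.

Lemma quintic_invariantP f T :
  quintic_invariant f T <-> forall v, quintic_at f (T *m v) = quintic_at f v.
Proof.
split=> [h v|h t s].
  by rewrite [v]vec2E {1}[T]mx2E mx2_vec2 /quintic_at !(proj1 (vec2_at _ _)) !(proj2 (vec2_at _ _)).
have := h (vec2 t s).
by rewrite {1}[T]mx2E mx2_vec2 /quintic_at !(proj1 (vec2_at _ _)) !(proj2 (vec2_at _ _)).
Qed.

Lemma invariant_subst f g S T M : (forall v, quintic_at f (S *m v) = quintic_at g v) ->
  quintic_invariant f T -> T *m S = S *m M -> quintic_invariant g M.
Proof.
move=> fg /quintic_invariantP hT TS; apply/quintic_invariantP => v.
by rewrite -!fg mulmxA -TS -mulmxA hT.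
Qed.

Let quintic_line f v w : exists p : {poly K},
  (forall u, p.[u] = quintic_at f (v + u *: w))
  /\ p^`().[0] = dquintic_t f v`#0 v`#1 * w`#0 + dquintic_s f v`#0 v`#1 * w`#1.
Proof.
pose o (i : nat) : K := 0.
have [p [pE dp]] := preform_line o o f 0 0 0 v`#0 v`#1 0 0 0 w`#0 w`#1.
exists p; split=> [u|].
  rewrite pE /quintic_at !mxE /preform /quadratic /o; ring.
rewrite dp /dpreform /quadratic /o; ring.
Qed.

Lemma smooth_subst f g S : smooth_quintic f -> S \in unitmx ->
  (forall v, quintic_at f (S *m v) = quintic_at g v) -> smooth_quintic g.
Proof.
move=> smf uS fg t s gt gs.
have df w : dquintic_t f (S *m vec2 t s)`#0 (S *m vec2 t s)`#1 * w`#0 +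
    dquintic_s f (S *m vec2 t s)`#0 (S *m vec2 t s)`#1 * w`#1 = 0.
  have [p [pE dp]] := quintic_line f (S *m vec2 t s) w.
  have [p' [pE' dp']] := quintic_line g (vec2 t s) (invmx S *m w).
  rewrite -dp (_ : p = p'); last first.
    apply: poly_ext => u; rewrite pE pE' -fg; congr quintic_at.
    by rewrite mulmxDr -scalemxAr mulKVmx.
  by rewrite dp' !(proj1 (vec2_at _ _)) !(proj2 (vec2_at _ _)) gt gs !mul0r addr0.
have [|| e0 e1] := smf (S *m vec2 t s)`#0 (S *m vec2 t s)`#1.
- have := df (vec2 1 0); rewrite !(proj1 (vec2_at _ _)) !(proj2 (vec2_at _ _)).
  by rewrite mulr1 mulr0 addr0.
- have := df (vec2 0 1); rewrite !(proj1 (vec2_at _ _)) !(proj2 (vec2_at _ _)).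
  by rewrite mulr1 mulr0 add0r.
have S0 : S *m vec2 t s = 0.
  by rewrite [LHS]vec2E e0 e1; apply/colP => -[[|[|//]]] hi; rewrite !mxE.
have v0 : vec2 t s = 0 by rewrite -[LHS](mulKmx uS) S0 mulmx0.
by have [] := vec2_at t s; rewrite v0 !mxE.
Qed.
End QuinticSubstitution.

Section QuinticGroup.
Variable K : numClosedFieldType.
Implicit Types (f g : nat -> K) (T S M : 'M[K]_2) (a b c d t s : K).

Lemma invariant_mx2 g a b c d : quintic_invariant g (mx2 a b c d) ->
  forall i, (i < 6)%N -> subst_quintic g a b c d i = g i.
Proof.
move=> h; apply: quintic_coef_inj => t s; rewrite -subst_quinticE.
by have := h t s; rewrite !mxE !inordK.
Qed.

(** Neither (1, 0) nor (0, 1) is a multiple zero. *)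
Lemma smooth_quintic_ends g : smooth_quintic g ->
  ((g 0%N != 0) || (g 1%N != 0)) /\ ((g 5%N != 0) || (g 4%N != 0)).
Proof.
move=> smg; split; rewrite -negb_and; apply/negP => /andP[/eqP e0 /eqP e1].
  have [||h _] := smg 1 0; last by move/eqP: h; rewrite oner_eq0.
    by rewrite /dquintic_t e0; ring.
  by rewrite /dquintic_s e1; ring.
have [||_ h] := smg 0 1; last by move/eqP: h; rewrite oner_eq0.
  by rewrite /dquintic_t e1; ring.
by rewrite /dquintic_s e0; ring.
Qed.

(* A nonsemisimple matrix moves the two leading coefficients of a smooth form. *)
Let no_jordan g a b : smooth_quintic g -> a != 0 ->
  quintic_invariant g (mx2 a b 0 a) -> b = 0.
Proof.
move=> /smooth_quintic_ends[ends _] a0 /invariant_mx2 inv.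
have n5 : 5%:R != 0 :> K by rewrite pnatr_eq0.
have n4 : 4%:R != 0 :> K by rewrite pnatr_eq0.
have [g0|g0] := eqVneq (g 0%N) 0.
  rewrite g0 eqxx /= in ends; have a5 : a ^+ 5 = 1.
    by apply: (mulfI ends); rewrite mulr1 -[RHS](inv 1%N isT) /subst_quintic /= g0; ring.
  have n : g 1%N * 4%:R * a ^+ 4 != 0 by rewrite !mulf_neq0 ?expf_neq0.
  apply: (mulfI n); rewrite mulr0.
  transitivity (subst_quintic g a b 0 a 2 - g 2%N - g 2%N * (a ^+ 5 - 1)).
    by rewrite /subst_quintic /= g0; ring.
  by rewrite inv // a5 !subrr mulr0 subrr.
have a5 : a ^+ 5 = 1.
  by apply: (mulfI g0); rewrite mulr1 -[RHS](inv 0%N isT) /subst_quintic /=; ring.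
have n : g 0%N * 5%:R * a ^+ 4 != 0 by rewrite !mulf_neq0 ?expf_neq0.
apply: (mulfI n); rewrite mulr0.
transitivity (subst_quintic g a b 0 a 1 - g 1%N - g 1%N * (a ^+ 5 - 1)).
  by rewrite /subst_quintic /=; ring.
by rewrite inv // a5 !subrr mulr0 subrr.
Qed.

Let triangular T : exists2 S, S \in unitmx & exists a b d, T *m S = S *m mx2 a b 0 d.
Proof.
(* The transpose is used because [eigenvalueP] provides row vectors. *)
have /closed_rootP[a] : size (char_poly T^T) != 1%N by rewrite size_char_poly.
rewrite -eigenvalue_root_char => /eigenvalueP[u uT u0].
have Tu : T *m u^T = a *: u^T by rewrite -[T]trmxK -trmx_mul uT linearZ.
pose u0' := u ord0 (inord 0); pose u1' := u ord0 (inord 1).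
have uE : u^T = vec2 u0' u1'.
  by rewrite [LHS]vec2E !mxE.
have un : (u0' != 0) || (u1' != 0).
  apply: contraNT u0; rewrite negb_or !negbK => /andP[/eqP e0 /eqP e1].
  by rewrite -[u]trmxK uE e0 e1; apply/eqP/rowP => -[[|[|//]]] hi; rewrite !mxE.
have [S uS Sc] : exists2 S, S \in unitmx & S *m vec2 1 0 = u^T.
  have [e0|e0] := eqVneq u0' 0.
    exists (mx2 u0' 1 u1' 0); last by rewrite mx2_vec2 uE !mulr1 !mulr0 !addr0.
    by rewrite unitmxE det_mx2 unitfE mulr0 mul1r sub0r oppr_eq0; rewrite e0 eqxx in un.
  exists (mx2 u0' 0 u1' 1); last by rewrite mx2_vec2 uE !mulr1 !mulr0 !addr0.
  by rewrite unitmxE det_mx2 unitfE mulr1 mul0r subr0.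
exists S => //; pose M := invmx S *m T *m S.
have TS : T *m S = S *m M by rewrite /M !mulmxA mulmxV // mul1mx.
have : M *m vec2 1 0 = vec2 a 0.
  rewrite /M -!mulmxA Sc Tu -Sc -scalemxAr mulKmx //.
  by apply/colP => -[[|[|//]]] hi; rewrite !mxE /= ?mulr1 ?mulr0.
rewrite [M]mx2E mx2_vec2 => H.
exists a, (M (inord 0) (inord 1)), (M (inord 1) (inord 1)).
rewrite TS [in LHS](mx2E M); congr (_ *m mx2 _ _ _ _).
  by have [<- _] := vec2_at a 0; rewrite -H !mxE !inordK //= mulr1 mulr0 addr0.
by have [_ <-] := vec2_at a 0; rewrite -H !mxE !inordK //= mulr1 mulr0 addr0.
Qed.

Let diagonal_form f T : smooth_quintic f -> T \in unitmx -> quintic_invariant f T ->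
  (forall c, T <> c%:M) -> exists S g a d, [/\ S \in unitmx,
    forall v, quintic_at f (S *m v) = quintic_at g v, T *m S = S *m mx2 a 0 0 d,
    a != d & (a != 0) && (d != 0)].
Proof.
move=> smf uT inv nT; have [S uS [a [b [d TS]]]] := triangular T.
have [g gE] := quintic_at_subst f S.
have : (a != 0) && (d != 0).
  have : T *m S \in unitmx by rewrite unitmx_mul uT.
  by rewrite TS unitmx_mul uS unitmxE det_mx2 unitfE mulr0 subr0 mulf_eq0 negb_or.
move=> ad0; have /andP[a0 d0] := ad0.
have [ad|ad] := eqVneq a d.
  case: (nT a); have b0 : b = 0.
    apply: (no_jordan (smooth_subst smf uS gE) a0).
    by apply: (invariant_subst gE inv); rewrite TS ad.
  rewrite -[T](mulmxK uS) TS b0 -ad (_ : mx2 a 0 0 a = a%:M).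
    by rewrite mul_mx_scalar -scalemxAl mulmxV // scalemx1.
  by apply/matrixP => -[[|[|//]]] hi -[[|[|//]]] hj; rewrite !mxE.
(* Its second column is the eigenvector for d, which exists as a and d differ. *)
pose S2 := mx2 1 (b / (d - a)) 0 1.
have uS2 : S2 \in unitmx by rewrite unitmxE det_mx2 unitfE !mulr0 subr0 mulr1 oner_neq0.
have [g2 g2E] := quintic_at_subst f (S *m S2).
exists (S *m S2), g2, a, d; split=> //; first by rewrite unitmx_mul uS.
rewrite mulmxA TS -!mulmxA /S2 !mx2M; congr (_ *m mx2 _ _ _ _); try ring.
by field; rewrite subr_eq0 eq_sym.
Qed.

Let diag_coef g a d : quintic_invariant g (mx2 a 0 0 d) ->
  forall i, (i < 6)%N -> g i != 0 -> a ^+ (5 - i) * d ^+ i = 1.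
Proof.
move=> /invariant_mx2 inv i i6 gi; apply: (mulfI gi); rewrite mulr1 -[RHS]inv //=.
by case: i i6 {gi} => [|[|[|[|[|[|//]]]]]] _; rewrite /subst_quintic /=; ring.
Qed.

Let swap_form g : forall v, quintic_at g (mx2 0 1 1 0 *m v) =
  quintic_at (fun i => g (5 - i)%N) v.
Proof.
move=> v; rewrite [v]vec2E mx2_vec2 /quintic_at !(proj1 (vec2_at _ _)) !(proj2 (vec2_at _ _)).
by rewrite /quintic /=; ring.
Qed.

Definition loop_like g := [/\ g 0%N != 0, g 4%N != 0 & [/\ g 1%N = 0, g 3%N = 0 & g 5%N = 0]].

(** With a^5 = 1 and r = d / a different from 1, a coefficient g_i can be nonzero only if r^i = 1.
    By smoothness g_5 or g_4 is nonzero, so r has order 5, or order 4 or 2; g_2 survives only for r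
    = -1. *)
Let classify_ends g a d : smooth_quintic g -> quintic_invariant g (mx2 a 0 0 d) ->
  a != d -> a != 0 -> d != 0 -> g 0%N != 0 ->
  (g 5%N != 0 /\ forall i, (0 < i < 5)%N -> g i = 0) \/
  (loop_like g /\ (g 2%N = 0 \/ d = - a /\ a ^+ 5 = 1)).
Proof.
move=> smg inv ad a0 d0 g0; have D := diag_coef inv.
have a5 : a ^+ 5 = 1 by have := D 0%N isT g0; rewrite expr0 mulr1.
have [_ ends] := smooth_quintic_ends smg.
pose r := d / a; have dE : d = a * r by rewrite /r mulrCA divff // mulr1.
have r1 : r != 1 by apply: contra_neq ad => h; rewrite dE h mulr1.
have rD i : (i < 6)%N -> g i != 0 -> r ^+ i = 1.
  move=> i6 gi; have := D i i6 gi.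
  by rewrite dE exprMn mulrA -exprD subnK // a5 mul1r.
have zero i : (i < 6)%N -> (r ^+ i = 1 -> r = 1) -> g i = 0.
  by move=> i6 h; apply: contraNeq r1 => /(rD i i6)/h ->.
have z1 : g 1%N = 0 by apply: zero => //; rewrite expr1.
have [g5|g5] := eqVneq (g 5%N) 0; last first.
  have r5 := rD 5%N isT g5; left; split=> // -[|[|[|[|[|//]]]]] // _.
  - apply: zero => // r2; transitivity ((r ^+ 2) ^+ 2 * r); first by rewrite r2 expr1n mul1r.
    by rewrite -exprM -exprSr.
  - apply: zero => // r3; transitivity (r ^+ 5 * r); first by rewrite r5 mul1r.
    by rewrite -exprSr -[6%N]/(3 * 2)%N exprM r3 expr1n.
  - apply: zero => // r4; transitivity (r ^+ 4 * r); first by rewrite r4 mul1r.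
    by rewrite -exprSr.
right; rewrite g5 eqxx /= in ends; have r4 := rD 4%N isT ends.
have z3 : g 3%N = 0.
  apply: zero => // r3; transitivity (r ^+ 3 * r); first by rewrite r3 mul1r.
  by rewrite -exprSr.
split; first by split.
have [g2|g2] := eqVneq (g 2%N) 0; [by left | right; split=> //].
have := rD 2%N isT g2 => /eqP; rewrite -subr_eq0 subr_sqr_1 mulf_eq0 subr_eq0 (negPf r1) /=.
by rewrite addr_eq0 dE => /eqP ->; rewrite mulrN1.
Qed.

Lemma classify_quintic f T : smooth_quintic f -> T \in unitmx -> quintic_invariant f T ->
  (forall c, T <> c%:M) -> exists S g, [/\ S \in unitmx,
    forall v, quintic_at f (S *m v) = quintic_at g v &
    [\/ [/\ g 0%N != 0, g 5%N != 0 & forall i, (0 < i < 5)%N -> g i = 0],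
        [/\ g 1%N != 0, g 4%N != 0 & [/\ g 0%N = 0, g 2%N = 0, g 3%N = 0 & g 5%N = 0]] |
        loop_like g /\ (g 2%N = 0 \/ exists2 a, a ^+ 5 = 1 & T *m S = S *m mx2 a 0 0 (- a))]].
Proof.
move=> smf uT inv nT; have [S [g [a [d [uS gE TS ad /andP[a0 d0]]]]]] := diagonal_form smf uT inv nT.
have smg := smooth_subst smf uS gE; have invg := invariant_subst gE inv TS.
have [g0|g0] := eqVneq (g 0%N) 0; last first.
  exists S, g; split=> //; case: (classify_ends smg invg ad a0 d0 g0) => [[g5 gi]|[t2 h]].
    by constructor 1.
  constructor 3; split=> //; case: h => [h|[da a5]]; [by left|right].
  by exists a => //; rewrite -da.
(* The case g_0 = 0, g_5 nonzero is reduced to the previous one by exchanging t and s, which also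
   exchanges a and d. *)
have [g5|g5] := eqVneq (g 5%N) 0; last first.
  pose W : 'M[K]_2 := mx2 0 1 1 0; pose g' i := g (5 - i)%N.
  have uW : W \in unitmx by rewrite unitmxE det_mx2 unitfE mul0r sub0r mulr1 oppr_eq0 oner_eq0.
  have g'E v : quintic_at f (S *m W *m v) = quintic_at g' v.
    by rewrite -mulmxA gE swap_form.
  have uSW : S *m W \in unitmx by rewrite unitmx_mul uS.
  have TSW : T *m (S *m W) = S *m W *m mx2 d 0 0 a.
    by rewrite mulmxA TS -!mulmxA !mx2M; congr (_ *m mx2 _ _ _ _); ring.
  have da : d != a by rewrite eq_sym.
  have [[/= ]|[t2 h]] := classify_ends (smooth_subst smf uSW g'E) (invariant_subst g'E inv TSW) da
    d0 a0 g5.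
    by rewrite /g' subnn g0 eqxx.
  exists (S *m W), g'; split=> //; constructor 3; split=> //.
  case: h => [h|[da' a5]]; [by left|right].
  by exists d => //; rewrite TSW da'.
have [e1 e4] := smooth_quintic_ends smg; rewrite g0 eqxx /= in e1; rewrite g5 eqxx /= in e4.
have D := diag_coef invg; have D1 := D 1%N isT e1; have D4 := D 4%N isT e4.
exists S, g; split=> //; constructor 2; split=> //.
split=> //; apply/eqP; apply: contraNT ad => gi; apply/eqP.
  have := D 2%N isT gi; rewrite -D1 /= expr1.
  have n' : a ^+ 3 * d != 0 by rewrite mulf_neq0 ?expf_neq0.
  by move=> E; apply: (mulfI n'); transitivity (a ^+ 4 * d); [ring | rewrite -E; ring].
have := D 3%N isT gi; rewrite -D4 /= expr1.
have n' : a * d ^+ 3 != 0 by rewrite mulf_neq0 ?expf_neq0.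
move=> E; apply: (mulfI n'); transitivity (a ^+ 2 * d ^+ 3); first by ring.
by rewrite E; ring.
Qed.
End QuinticGroup.

(** * Stabilizers of binary quintics *)

Section QuinticStabilizers.
Variable K : numClosedFieldType.
Implicit Types (f g : nat -> K) (T S M : 'M[K]_2) (a b c d t s w : K).

(** This predicate and the next two describe the linear stabilizers of t^5 + s^5, of t^4 s + s^5 and
    of t^4 s + t s^4. *)
Definition is_fermat M := exists a b, [/\ a ^+ 5 = 1, b ^+ 5 = 1 &
  M = mx2 a 0 0 b \/ M = mx2 0 a b 0].

Definition is_loop M := exists a w, [/\ a ^+ 5 = 1, w ^+ 4 = 1 & M = mx2 (a * w) 0 0 a].

Definition is_dihedral M := exists a w, [/\ a ^+ 5 = 1, w ^+ 3 = 1 &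
  M = mx2 (a * w) 0 0 (a * w ^+ 2) \/ M = mx2 0 (a * w) (a * w ^+ 2) 0].

Let unit_mx2 a b c d : mx2 a b c d \in unitmx -> a * d - b * c != 0.
Proof. by rewrite unitmxE det_mx2 unitfE. Qed.

Let diag_or_antidiag a b c d : a * d - b * c != 0 -> a * c = 0 -> b * d = 0 ->
  [/\ b = 0, c = 0, a != 0 & d != 0] \/ [/\ a = 0, d = 0, b != 0 & c != 0].
Proof.
move=> D ac bd; have [a0|a0] := eqVneq a 0.
  have bc : b * c != 0 by move: D; rewrite a0 mul0r sub0r oppr_eq0.
  move: bc; rewrite mulf_eq0 negb_or => /andP[b0 c0]; right; split=> //.
  by move/eqP: bd; rewrite mulf_eq0 (negPf b0) => /eqP.
have c0 : c = 0 by move/eqP: ac; rewrite mulf_eq0 (negPf a0) => /eqP.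
have d0 : d != 0 by move: D; rewrite c0 mulr0 subr0 mulf_eq0 negb_or => /andP[].
by left; split=> //; move/eqP: bd; rewrite mulf_eq0 (negPf d0) orbF => /eqP.
Qed.

(* These two stabilizers and the next one are found with the quadratic covariant
   [(g, g)_4] of a binary quintic: it is proportional to [t s], [t s] and [t ^ 2]. *)
Let fermat_stabilizer g M : g 0%N = 1 -> g 5%N = 1 -> (forall i, (0 < i < 5)%N -> g i = 0) ->
  M \in unitmx -> quintic_invariant g M -> is_fermat M.
Proof.
move=> g0 g5 gi; rewrite [M]mx2E; move: (M _ _) (M _ _) (M _ _) (M _ _) => d c b a.
move=> /unit_mx2 D /invariant_mx2 inv.
have I0 := inv 0%N isT; have I1 := inv 1%N isT; have I2 := inv 2%N isT.
have I3 := inv 3%N isT; have I4 := inv 4%N isT; have I5 := inv 5%N isT.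
rewrite /subst_quintic /= g0 g5 !gi // in I0 I1 I2 I3 I4 I5.
(* The t^2 coefficient of the covariant is 20 g_0 g_4 - 8 g_1 g_3 + 3 g_2^2. The covariant of t^5 +
   s^5 is 100 t s; substitution changes its t^2 and s^2 coefficients from 0 to 100 D^4 a c and 100
   D^4 b d, with D = a d - b c, and invariance makes both 0. *)
have n : 100%:R * (a * d - b * c) ^+ 4 != 0 by rewrite mulf_neq0 ?expf_neq0 ?pnatr_eq0.
have ac : a * c = 0.
  apply: (mulfI n); rewrite mulr0.
  transitivity (20%:R * (a ^+ 5 + c ^+ 5) * (5%:R * (a * b ^+ 4 + c * d ^+ 4))
    - 8%:R * (5%:R * (a ^+ 4 * b + c ^+ 4 * d)) * (10%:R * (a ^+ 2 * b ^+ 3 + c ^+ 2 * d ^+ 3))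
    + 3%:R * (10%:R * (a ^+ 3 * b ^+ 2 + c ^+ 3 * d ^+ 2)) ^+ 2); first by ring.
  have -> : 5%:R * (a * b ^+ 4 + c * d ^+ 4) = 0 by rewrite -[RHS]I4; ring.
  have -> : 5%:R * (a ^+ 4 * b + c ^+ 4 * d) = 0 by rewrite -[RHS]I1; ring.
  have -> : 10%:R * (a ^+ 3 * b ^+ 2 + c ^+ 3 * d ^+ 2) = 0 by rewrite -[RHS]I2; ring.
  by ring.
have bd : b * d = 0.
  apply: (mulfI n); rewrite mulr0.
  transitivity (20%:R * (b ^+ 5 + d ^+ 5) * (5%:R * (b * a ^+ 4 + d * c ^+ 4))
    - 8%:R * (5%:R * (b ^+ 4 * a + d ^+ 4 * c)) * (10%:R * (b ^+ 2 * a ^+ 3 + d ^+ 2 * c ^+ 3))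
    + 3%:R * (10%:R * (b ^+ 3 * a ^+ 2 + d ^+ 3 * c ^+ 2)) ^+ 2); first by ring.
  have -> : 5%:R * (b * a ^+ 4 + d * c ^+ 4) = 0 by rewrite -[RHS]I1; ring.
  have -> : 5%:R * (b ^+ 4 * a + d ^+ 4 * c) = 0 by rewrite -[RHS]I4; ring.
  have -> : 10%:R * (b ^+ 3 * a ^+ 2 + d ^+ 3 * c ^+ 2) = 0 by rewrite -[RHS]I3; ring.
  by ring.
case: (diag_or_antidiag D ac bd) => [[b0 c0 _ _]|[a0 d0 _ _]].
  exists a, d; split; last by rewrite b0 c0; left.
    by rewrite -[RHS]I0 c0; ring.
  by rewrite -[RHS]I5 b0; ring.
exists b, c; split; last by rewrite a0 d0; right.
  by rewrite -[RHS]I5 d0; ring.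
by rewrite -[RHS]I0 a0; ring.
Qed.

Let dihedral_stabilizer g M : g 1%N = 1 -> g 4%N = 1 ->
  [/\ g 0%N = 0, g 2%N = 0, g 3%N = 0 & g 5%N = 0] ->
  M \in unitmx -> quintic_invariant g M -> is_dihedral M.
Proof.
move=> g1 g4 [g0 g2 g3 g5]; rewrite [M]mx2E; move: (M _ _) (M _ _) (M _ _) (M _ _) => d c b a.
move=> /unit_mx2 D /invariant_mx2 inv.
have I0 := inv 0%N isT; have I1 := inv 1%N isT; have I2 := inv 2%N isT.
have I3 := inv 3%N isT; have I4 := inv 4%N isT; have I5 := inv 5%N isT.
rewrite /subst_quintic /= g0 g1 g2 g3 g4 g5 in I0 I1 I2 I3 I4 I5.
(* The covariant of t^4 s + t s^4 is -12 t s. *)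
have n : - 12%:R * (a * d - b * c) ^+ 4 != 0.
  by rewrite mulf_neq0 ?expf_neq0 ?oppr_eq0 ?pnatr_eq0.
(* The two conditions give (v / u)^3 = 1, and x = u^2 / v is then a fifth root of unity. *)
have solve u v : u ^+ 4 * v = 1 -> u * v ^+ 4 = 1 -> exists x w,
    [/\ x ^+ 5 = 1, w ^+ 3 = 1, u = x * w & v = x * w ^+ 2].
  move=> e1 e2; have u0 : u != 0.
    by apply: contra_eq_neq e1 => ->; rewrite expr0n mul0r eq_sym oner_eq0.
  have v0 : v != 0.
    by apply: contra_eq_neq e1 => ->; rewrite mulr0 eq_sym oner_eq0.
  have w3 : (v / u) ^+ 3 = 1.
    transitivity (u * v ^+ 4 / (u ^+ 4 * v)); first by field; rewrite u0 v0.
    by rewrite e1 e2 divff ?oner_neq0.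
  exists (u ^+ 2 / v), (v / u); split=> //.
  - transitivity ((u ^+ 4 * v) ^+ 4 / (u * v ^+ 4) ^+ 2 / (u ^+ 4 * v)); first by field; rewrite u0 v0.
    by rewrite e1 e2 !expr1n !divr1.
  - by field; rewrite u0 v0.
  - by field; rewrite u0 v0.
have ac : a * c = 0.
  apply: (mulfI n); rewrite mulr0.
  transitivity (20%:R * (a ^+ 4 * c + a * c ^+ 4) * (4%:R * a * b ^+ 3 * d + b ^+ 4 * c + 4%:R * b
    * c * d ^+ 3 + a * d ^+ 4)
    - 8%:R * (4%:R * a ^+ 3 * b * c + a ^+ 4 * d + b * c ^+ 4 + 4%:R * a * c ^+ 3 * d)
        * (6%:R * a ^+ 2 * b ^+ 2 * d + 4%:R * a * b ^+ 3 * c + 6%:R * b * c ^+ 2 * d ^+ 2 + 4%:R *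
          a * c * d ^+ 3)
    + 3%:R * (6%:R * a ^+ 2 * b ^+ 2 * c + 4%:R * a ^+ 3 * b * d + 4%:R * b * c ^+ 3 * d + 6%:R * a
      * c ^+ 2 * d ^+ 2) ^+ 2); first by ring.
  have -> : a ^+ 4 * c + a * c ^+ 4 = 0 by rewrite -[RHS]I0; ring.
  have -> : 6%:R * a ^+ 2 * b ^+ 2 * d + 4%:R * a * b ^+ 3 * c + 6%:R * b * c ^+ 2 * d ^+ 2 + 4%:R
    * a * c * d ^+ 3 = 0.
    by rewrite -[RHS]I3; ring.
  have -> : 6%:R * a ^+ 2 * b ^+ 2 * c + 4%:R * a ^+ 3 * b * d + 4%:R * b * c ^+ 3 * d + 6%:R * a *
    c ^+ 2 * d ^+ 2 = 0.
    by rewrite -[RHS]I2; ring.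
  by ring.
have bd : b * d = 0.
  apply: (mulfI n); rewrite mulr0.
  transitivity (20%:R * (b ^+ 4 * d + b * d ^+ 4) * (4%:R * a ^+ 3 * b * c + a ^+ 4 * d + b * c ^+
    4 + 4%:R * a * c ^+ 3 * d)
    - 8%:R * (6%:R * a ^+ 2 * b ^+ 2 * c + 4%:R * a ^+ 3 * b * d + 4%:R * b * c ^+ 3 * d + 6%:R * a
      * c ^+ 2 * d ^+ 2)
       * (4%:R * a * b ^+ 3 * d + b ^+ 4 * c + 4%:R * b * c * d ^+ 3 + a * d ^+ 4)
    + 3%:R * (6%:R * a ^+ 2 * b ^+ 2 * d + 4%:R * a * b ^+ 3 * c + 6%:R * b * c ^+ 2 * d ^+ 2 +
      4%:R * a * c * d ^+ 3) ^+ 2); first by ring.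
  have -> : b ^+ 4 * d + b * d ^+ 4 = 0 by rewrite -[RHS]I5; ring.
  have -> : 6%:R * a ^+ 2 * b ^+ 2 * c + 4%:R * a ^+ 3 * b * d + 4%:R * b * c ^+ 3 * d + 6%:R * a *
    c ^+ 2 * d ^+ 2 = 0.
    by rewrite -[RHS]I2; ring.
  have -> : 6%:R * a ^+ 2 * b ^+ 2 * d + 4%:R * a * b ^+ 3 * c + 6%:R * b * c ^+ 2 * d ^+ 2 + 4%:R
    * a * c * d ^+ 3 = 0.
    by rewrite -[RHS]I3; ring.
  by ring.
case: (diag_or_antidiag D ac bd) => [[b0 c0 _ _]|[a0 d0 _ _]].
  have [||x [w [x5 w3 -> ->]]] := solve a d.
  - by rewrite -[RHS]I1 b0 c0; ring.
  - by rewrite -[RHS]I4 b0 c0; ring.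
  by exists x, w; rewrite b0 c0; split=> //; left.
have [||x [w [x5 w3 -> ->]]] := solve b c.
- by rewrite -[RHS]I4 a0 d0; ring.
- by rewrite -[RHS]I1 a0 d0; ring.
by exists x, w; rewrite a0 d0; split=> //; right.
Qed.

Let loop_stabilizer g M : loop_like g -> g 2%N = 0 ->
  M \in unitmx -> quintic_invariant g M -> exists a w, [/\ a ^+ 5 = 1, w ^+ 4 = 1 & M = mx2 a 0 0
    (a * w)].
Proof.
move=> [g0 g4 [g1 g3 g5]] g2; rewrite [M]mx2E; move: (M _ _) (M _ _) (M _ _) (M _ _) => d c b a.
move=> /unit_mx2 D /invariant_mx2 inv.
have I0 := inv 0%N isT; have I1 := inv 1%N isT; have I2 := inv 2%N isT.
have I3 := inv 3%N isT; have I4 := inv 4%N isT; have I5 := inv 5%N isT.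
rewrite /subst_quintic /= g1 g2 g3 g5 in I0 I1 I2 I3 I4 I5.
move: (g 0%N) (g 4%N) g0 g4 I0 I1 I2 I3 I4 I5 => p r p0 r0 I0 I1 I2 I3 I4 I5.
(* The covariant of p t^5 + r t s^4 is 20 p r t^2, so the vanishing of its s^2 coefficient after
   substitution gives b^2 = 0. *)
have n : 20%:R * (p * r) * (a * d - b * c) ^+ 4 != 0.
  by rewrite !mulf_neq0 ?expf_neq0 ?pnatr_eq0.
have b0 : b = 0.
  apply/eqP; rewrite -[_ == 0](@expf_eq0 _ b 2); apply/eqP/(mulfI n); rewrite mulr0.
  transitivity (20%:R * (5%:R * p * a ^+ 4 * b + r * (b * c ^+ 4 + 4%:R * a * c ^+ 3 * d)) * (p * b
    ^+ 5 + r * b * d ^+ 4)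
    - 8%:R * (10%:R * p * a ^+ 3 * b ^+ 2 + r * (4%:R * b * c ^+ 3 * d + 6%:R * a * c ^+ 2 * d ^+ 2))
       * (5%:R * p * a * b ^+ 4 + r * (4%:R * b * c * d ^+ 3 + a * d ^+ 4))
    + 3%:R * (10%:R * p * a ^+ 2 * b ^+ 3 + r * (6%:R * b * c ^+ 2 * d ^+ 2 + 4%:R * a * c * d ^+
      3)) ^+ 2); first by ring.
  have -> : p * b ^+ 5 + r * b * d ^+ 4 = 0 by rewrite -[RHS]I5; ring.
  have -> : 10%:R * p * a ^+ 3 * b ^+ 2 + r * (4%:R * b * c ^+ 3 * d + 6%:R * a * c ^+ 2 * d ^+ 2) = 0.
    by rewrite -[RHS]I2; ring.
  have -> : 10%:R * p * a ^+ 2 * b ^+ 3 + r * (6%:R * b * c ^+ 2 * d ^+ 2 + 4%:R * a * c * d ^+ 3) = 0.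
    by rewrite -[RHS]I3; ring.
  by ring.
have : a * d != 0 by move: D; rewrite b0 mul0r subr0.
rewrite mulf_eq0 negb_or => /andP[a0 d0].
have c0 : c = 0.
  have n' : 4%:R * r * a * d ^+ 3 != 0 by rewrite !mulf_neq0 ?expf_neq0 ?pnatr_eq0.
  by apply: (mulfI n'); rewrite mulr0 -[RHS]I3 b0; ring.
have a5 : a ^+ 5 = 1 by apply: (mulfI p0); rewrite mulr1 -[RHS]I0 c0; ring.
have ad : a * d ^+ 4 = 1 by apply: (mulfI r0); rewrite mulr1 -[RHS]I4 b0; ring.
exists a, (d / a); split=> //.
  transitivity (a * d ^+ 4 / a ^+ 5); first by field.
  by rewrite ad a5 divr1.
by rewrite b0 c0; congr (mx2 _ _ _ _); field.
Qed.

Let mx2_scalar a : mx2 a 0 0 a = a%:M.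
Proof.
by apply/matrixP => -[[|[|//]]] hi -[[|[|//]]] hj; rewrite !mxE.
Qed.

Let mx2_unit a b c d : (mx2 a b c d \in unitmx) = (a * d - b * c != 0).
Proof. by rewrite unitmxE det_mx2 unitfE. Qed.

Definition stabilizer_in f S (P : 'M[K]_2 -> Prop) := forall T, T \in unitmx ->
  quintic_invariant f T -> exists2 M, T *m S = S *m M & P M.

Let stabilizer_in_subst f g S P : S \in unitmx ->
  (forall v, quintic_at f (S *m v) = quintic_at g v) ->
  (forall M, M \in unitmx -> quintic_invariant g M -> P M) -> stabilizer_in f S P.
Proof.
move=> uS fg h T uT invT; exists (invmx S *m T *m S); first by rewrite !mulmxA mulmxV // mul1mx.
apply: h; first by rewrite !unitmx_mul unitmx_inv uS uT.
by apply: invariant_subst fg invT _; rewrite !mulmxA mulmxV // mul1mx.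
Qed.

Let diag_subst g a d v : quintic_at g (mx2 a 0 0 d *m v) =
  quintic_at (fun i => g i * a ^+ (5 - i) * d ^+ i) v.
Proof.
rewrite [v]vec2E mx2_vec2 /quintic_at !(proj1 (vec2_at _ _)) !(proj2 (vec2_at _ _)) /quintic /=; ring.
Qed.

Let rescale f S g a d : S \in unitmx -> a != 0 -> d != 0 ->
  (forall v, quintic_at f (S *m v) = quintic_at g v) ->
  S *m mx2 a 0 0 d \in unitmx /\ forall v, quintic_at f (S *m mx2 a 0 0 d *m v) =
    quintic_at (fun i => g i * a ^+ (5 - i) * d ^+ i) v.
Proof.
move=> uS a0 d0 fg; split; last by move=> v; rewrite -mulmxA fg diag_subst.
by rewrite unitmx_mul uS mx2_unit mulr0 subr0 mulf_neq0.
Qed.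

Let root_neq0 n a b : (0 < n)%N -> a ^+ n = b -> b != 0 -> a != 0.
Proof. by move=> n0 <-; rewrite expf_eq0 n0. Qed.

Let fermat_case f S g : S \in unitmx -> (forall v, quintic_at f (S *m v) = quintic_at g v) ->
  g 0%N != 0 -> g 5%N != 0 -> (forall i, (0 < i < 5)%N -> g i = 0) ->
  exists2 S', S' \in unitmx & stabilizer_in f S' is_fermat.
Proof.
move=> uS fg g0 g5 gi; pose a := 5.-root (g 0%N)^-1; pose d := 5.-root (g 5%N)^-1.
have [a5 d5] : a ^+ 5 = (g 0%N)^-1 /\ d ^+ 5 = (g 5%N)^-1 by rewrite !rootCK.
have a0 : a != 0 by apply: root_neq0 a5 _; rewrite ?invr_eq0.
have d0 : d != 0 by apply: root_neq0 d5 _; rewrite ?invr_eq0.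
have [uS' fg'] := rescale uS a0 d0 fg; exists (S *m mx2 a 0 0 d) => //.
apply: stabilizer_in_subst fg' _ => // M; apply: fermat_stabilizer.
- by rewrite expr0 mulr1 a5 divff.
- by rewrite subnn expr0 mulr1 d5 divff.
- by move=> i i5; rewrite gi // !mul0r.
Qed.

Let dihedral_case f S g : S \in unitmx -> (forall v, quintic_at f (S *m v) = quintic_at g v) ->
  g 1%N != 0 -> g 4%N != 0 -> [/\ g 0%N = 0, g 2%N = 0, g 3%N = 0 & g 5%N = 0] ->
  exists2 S', S' \in unitmx & stabilizer_in f S' is_dihedral.
Proof.
(* Taking d from g_1 a^4 d = 1 turns g_4 a d^4 = 1 into a^15 = g_4 / g_1^4. *)
move=> uS fg g1 g4 [g0 g2 g3 g5]; pose a := 15.-root (g 4%N / g 1%N ^+ 4).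
have a15 : a ^+ 15 = g 4%N / g 1%N ^+ 4 by rewrite rootCK.
have a0 : a != 0 by apply: root_neq0 a15 _; rewrite ?mulf_neq0 ?invr_eq0 ?expf_neq0.
pose d := (a ^+ 4 * g 1%N)^-1.
have d0 : d != 0 by rewrite invr_eq0 mulf_neq0 ?expf_neq0.
have [uS' fg'] := rescale uS a0 d0 fg; exists (S *m mx2 a 0 0 d) => //.
apply: stabilizer_in_subst fg' _ => // M; apply: dihedral_stabilizer.
- by rewrite /d; field; rewrite a0 g1.
- rewrite /d; transitivity (g 4%N / g 1%N ^+ 4 / a ^+ 15); first by field; rewrite a0 g1.
  by rewrite a15 divff // mulf_neq0 ?invr_eq0 ?expf_neq0.
- by rewrite g0 g2 g3 g5 !mul0r.
Qed.

Let swap_loop S T a d : T *m S = S *m mx2 a 0 0 d ->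
  T *m (S *m mx2 0 1 1 0) = S *m mx2 0 1 1 0 *m mx2 d 0 0 a.
Proof.
move=> TS; rewrite mulmxA TS -!mulmxA !mx2M; congr (_ *m _); congr mx2; ring.
Qed.

Let swap_unit S : S \in unitmx -> S *m mx2 0 1 1 0 \in unitmx.
Proof. by move=> uS; rewrite unitmx_mul uS mx2_unit mulr0 sub0r mulr1 oppr_eq0 oner_eq0. Qed.

Let loop_case f S g : S \in unitmx -> (forall v, quintic_at f (S *m v) = quintic_at g v) ->
  loop_like g -> g 2%N = 0 -> exists2 S', S' \in unitmx & stabilizer_in f S' is_loop.
Proof.
move=> uS fg g2 g20; exists (S *m mx2 0 1 1 0); first exact: swap_unit.
move=> T uT invT.
have [M TS [a [w [a5 w4 Ma]]]] := stabilizer_in_subst uS fg (fun M => loop_stabilizer g2 g20 (M :=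
  M)) uT invT.
exists (mx2 (a * w) 0 0 a); last by exists a, w.
by apply: swap_loop; rewrite TS Ma.
Qed.

Let invariant_scalar f a : smooth_quintic f -> quintic_invariant f a%:M -> a ^+ 5 = 1.
Proof.
move=> smf; rewrite -mx2_scalar => /invariant_mx2 inv.
have [/orP[f0|f1] _] := smooth_quintic_ends smf.
  by apply: (mulfI f0); rewrite mulr1 -[RHS](inv 0%N) // /subst_quintic /=; ring.
by apply: (mulfI f1); rewrite mulr1 -[RHS](inv 1%N) // /subst_quintic /=; ring.
Qed.

Let invariantM f T T' : quintic_invariant f T -> quintic_invariant f T' ->
  quintic_invariant f (T *m T').
Proof.
move=> /quintic_invariantP h /quintic_invariantP h'; apply/quintic_invariantP => v.
by rewrite -mulmxA h h'.
Qed.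

Let conj_sqr S T a : S \in unitmx -> T *m S = S *m mx2 a 0 0 (- a) ->
  T *m T = (a ^+ 2)%:M.
Proof.
move=> uS TS; have -> : T = S *m mx2 a 0 0 (- a) *m invmx S by rewrite -TS mulmxK.
rewrite !mulmxA mulmxKV // -(mulmxA S) mx2M.
have -> : mx2 (a * a + 0 * 0) (a * 0 + 0 * - a) (0 * a + - a * 0) (0 * 0 + - a * - a) = (a ^+ 2)%:M.
  by rewrite -mx2_scalar; congr mx2; ring.
by rewrite mul_mx_scalar -scalemxAl mulmxV // scalemx1.
Qed.

Let conj_det S T a : S \in unitmx -> T *m S = S *m mx2 a 0 0 (- a) ->
  \det T = - a ^+ 2.
Proof.
move=> uS TS; have -> : T = S *m mx2 a 0 0 (- a) *m invmx S by rewrite -TS mulmxK.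
have dS : \det S != 0 by rewrite -unitfE -unitmxE.
by rewrite !det_mulmx det_inv det_mx2; field.
Qed.

(* In the last case every non-scalar element of the group is [a] times an involution with
   eigenvalues [1] and [-1]; two such involutions are equal up to a scalar because their
   product has determinant [1] up to a fifth root of unity. *)
Theorem quintic_group f : smooth_quintic f -> exists2 S, S \in unitmx &
  [\/ stabilizer_in f S is_fermat, stabilizer_in f S is_loop | stabilizer_in f S is_dihedral].
Proof.
move=> smf; have [[T0 [uT0 inv0 ns0]]|none] := pselect (exists T, [/\ T \in unitmx,
    quintic_invariant f T & forall c, T <> c%:M]); last first.
  (* A group of scalars fits the loop type with w = 1. *)
  exists 1%:M; rewrite ?unitmx1 //; apply: Or32 => T uT invT.
  have [[a Ta]|ns] := pselect (exists a, T = a%:M); last first.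
    by case: none; exists T; split=> // a Ta; apply: ns; exists a.
  exists T; rewrite ?mulmx1 ?mul1mx //; exists a, 1.
  rewrite expr1n mulr1 Ta mx2_scalar; split=> //.
  by apply: (@invariant_scalar f); rewrite -?Ta.
have [[S [g [uS fg [[g0 g5 gi]|[g1 g4 gi]|[g2 g20]]]]]|generic] := pselect (exists S g,
    [/\ S \in unitmx, forall v, quintic_at f (S *m v) = quintic_at g v &
    [\/ [/\ g 0%N != 0, g 5%N != 0 & forall i, (0 < i < 5)%N -> g i = 0],
        [/\ g 1%N != 0, g 4%N != 0 & [/\ g 0%N = 0, g 2%N = 0, g 3%N = 0 & g 5%N = 0]] |
        loop_like g /\ g 2%N = 0]]).
- by have [S' uS' h] := fermat_case uS fg g0 g5 gi; exists S' => //; apply: Or31.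
- by have [S' uS' h] := dihedral_case uS fg g1 g4 gi; exists S' => //; apply: Or33.
- by have [S' uS' h] := loop_case uS fg g2 g20; exists S' => //; apply: Or32.
have inv T : T \in unitmx -> quintic_invariant f T -> (forall c, T <> c%:M) ->
    exists S a, [/\ S \in unitmx, a ^+ 5 = 1 & T *m S = S *m mx2 a 0 0 (- a)].
  move=> uT invT ns; have [S [g [uS fg [h|h|[g2 [h|[a a5 TS]]]]]]] := classify_quintic smf uT invT ns.
  - by case: generic; exists S, g; split=> //; apply: Or31.
  - by case: generic; exists S, g; split=> //; apply: Or32.
  - by case: generic; exists S, g; split=> //; apply: Or33.
  by exists S, a.
have [S [a [uS a5 TS]]] := inv _ uT0 inv0 ns0.
have a0 : a != 0 by apply: root_neq0 a5 _; rewrite ?oner_neq0.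
exists (S *m mx2 0 1 1 0); [exact: swap_unit | apply: Or32 => T uT invT].
have [[b Tb]|ns] := pselect (exists b, T = b%:M).
  exists T; first by rewrite Tb -scalar_mxC.
  exists b, 1; rewrite expr1n mulr1 Tb mx2_scalar; split=> //.
  by apply: (@invariant_scalar f); rewrite -?Tb.
have {}ns c : T <> c%:M by move=> Tc; apply: ns; exists c.
have invTT0 := invariantM invT inv0.
have uTT0 : T *m T0 \in unitmx by rewrite unitmx_mul uT.
have T02 := conj_sqr uS TS; have [S1 [b [uS1 b5 TS1]]] := inv _ uT invT ns.
have [[e Te]|nsT] := pselect (exists e, T *m T0 = e%:M); last first.
  have {}nsT c : T *m T0 <> c%:M by move=> Tc; apply: nsT; exists c.
  have [S2 [d [uS2 d5 TS2]]] := inv _ uTT0 invTT0 nsT.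
  have /esym := conj_det uS2 TS2; rewrite det_mulmx (conj_det uS TS) (conj_det uS1 TS1) mulrNN.
  move/(congr1 (fun x => x ^+ 5)) => h.
  have : - (d ^+ 5) ^+ 2 = (b ^+ 5) ^+ 2 * (a ^+ 5) ^+ 2.
    by transitivity ((- d ^+ 2) ^+ 5); [ring | rewrite h; ring].
  rewrite a5 b5 d5 !expr1n mulr1 => /eqP.
  by rewrite eq_sym -subr_eq0 opprK -mulr2n pnatr_eq0.
have e5 : e ^+ 5 = 1 by apply: (@invariant_scalar f); rewrite -?Te.
pose c := e / a; have c5 : c ^+ 5 = 1 by rewrite expr_div_n e5 a5 divr1.
(* Since [T0] squared is a^2 and [T *m T0] is the scalar e, [T] is e / a^2 times [T0] and is
   diagonalized by the same [S]. *)
have Tc : T *m S = S *m mx2 c 0 0 (- c).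
  have a20 : a ^+ 2 != 0 by rewrite expf_neq0.
  have -> : T = (e / a ^+ 2) *: T0.
    have := congr1 (mulmxr T0) Te; rewrite /= -mulmxA T02 mul_mx_scalar mul_scalar_mx => h.
    by apply: (scalerI a20); rewrite h scalerA mulrCA divff ?mulr1.
  rewrite -scalemxAl TS scalemxAr; congr (_ *m _).
  apply/matrixP => -[[|[|//]]] hi -[[|[|//]]] hj; rewrite !mxE /c /= ?mulr0 //; field; exact: a0.
exists (mx2 (- c) 0 0 c); first exact: swap_loop.
(* The involution is a loop matrix with w = -1. *)
exists c, (-1); rewrite mulrN1; split=> //.
by rewrite -signr_odd.
Qed.
End QuinticStabilizers.

(** * Automorphisms in normal coordinates *)

Section Models.
Variables (K : numClosedFieldType) (z : K).
Local Notation C := (cycle_coords K).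
Implicit Types (A B N : 'M[K]_5) (S M : 'M[K]_2).

Lemma mulmx_ext m n (A B : 'M[K]_(m, n)) : (forall v : 'cV_n, A *m v = B *m v) -> A = B.
Proof.
move=> h; apply/matrixP => i j; have /colP/(_ i) := h (delta_mx j ord0).
by rewrite -!colE !mxE.
Qed.

Definition cycle3 : 'M[K]_3 := \matrix_(i, j) (nth 0%N [:: 1; 2; 0]%N i == j)%:R.

Lemma cycle_coords_block : C = bmx cycle3 1%:M.
Proof.
apply: mulmx_ext => v; rewrite [v]vec5E cycle_coordsE bmx_vec5 mul1mx.
by congr vec5; rewrite mxE ?inordK // big_ord3 !mxE !inordK //= ?mul0r ?mul1r ?add0r ?addr0.
Qed.

Lemma cycle_coords_cube : C ^+ 3 = 1%:M.
Proof.
apply: mulmx_ext => v; rewrite mul1mx [v]vec5E 2!exprS expr1 -!mulmxE -!mulmxA.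
by rewrite !cycle_coordsE.
Qed.

Lemma klein_diag_mod (z13 : z ^+ 13 = 1) k : klein_diag z k = klein_diag z (k %% 13).
Proof.
have e (y : K) : y ^+ 13 = 1 -> y ^+ k = y ^+ (k %% 13).
  by move=> y13; rewrite {1}(divn_eq k 13) exprD mulnC exprM y13 expr1n mul1r.
apply/matrixP => i j; rewrite !mxE /= e //.
by rewrite (e (z ^- 4)) ?(e (z ^+ 3)) // ?exprVn exprAC z13 expr1n ?invr1.
Qed.

Definition model (P : 'M[K]_2 -> Prop) N :=
  exists j k M, P M /\ N = C ^+ j *m bmx (klein_diag z k) M.

Definition conjugates_into F B (P : 'M[K]_5 -> Prop) := forall A c, A \in unitmx -> c != 0 ->
  (forall v, ev F (A *m v) = c * ev F v) ->
  exists N a, [/\ a != 0, P N & A *m B = a *: (B *m N)].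

Theorem normal_form_models F B q f : B \in unitmx -> smooth_quintic f -> 13.-primitive_root z ->
  (forall x y w t s, ev F (B *m vec5 x y w t s) = nform q f x y w t s) ->
  exists2 B', B' \in unitmx & (forall v, ev F (B' *m (C *m v)) = ev F (B' *m v)) /\
    [\/ conjugates_into F B' (model (@is_fermat K)), conjugates_into F B' (model (@is_loop K)) |
        conjugates_into F B' (model (@is_dihedral K))].
Proof.
move=> uB smf pz FB; have [S uS gS] := quintic_group smf.
have commC j : bmx 1%:M S *m C ^+ j = C ^+ j *m bmx 1%:M S.
  elim: j => [|j IH]; first by rewrite expr0 mulmx1 mul1mx.
  rewrite exprSr -mulmxE mulmxA IH -!mulmxA; congr (_ *m _).
  by rewrite cycle_coords_block !bmxM !mul1mx !mulmx1.
have FB' v : ev F (B *m v) = nform_at q f v by rewrite {1}[v]vec5E FB.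
exists (B *m bmx 1%:M S); first by rewrite unitmx_mul uB bmx_unit unitmx1.
split.
  move=> v; rewrite -!mulmxA (mulmxA (bmx _ _)) -(expr1 C) commC expr1 -mulmxA.
  move: (bmx _ _ *m v) => u; rewrite !FB' [u]vec5E cycle_coordsE.
  by rewrite /nform_at !vec5_at //= /nform /klein; ring.
have main P : stabilizer_in f S P -> conjugates_into F (B *m bmx 1%:M S) (model P).
  move=> SP A c uA c0 FA; pose A' := invmx B *m A *m B.
  have uA' : A' \in unitmx by rewrite !unitmx_mul unitmx_inv uB uA.
  have BA : B *m A' = A *m B by rewrite /A' !mulmxA mulmxV // mul1mx.
  clearbody A'; have sA' : semi_invariance q f c A'.
    by move=> v; rewrite -!FB' mulmxA BA -mulmxA FA.
  have [i [k [a [T [a0 uT invT CA]]]]] := klein_part smf c0 pz uA' sA'.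
  have [M TS PM] := SP T uT invT.
  (* As the cube of [C] is 1, the power 2 i is the inverse of the power i supplied by
     [klein_part]. *)
  exists (C ^+ (i * 2) *m bmx (klein_diag z k) M), a; split=> //; first by exists (i * 2)%N, k, M.
  have -> : A *m (B *m bmx 1%:M S) = B *m (A' *m bmx 1%:M S) by rewrite !mulmxA BA.
  have -> : A' = a *: (C ^+ (i * 2) *m bmx (klein_diag z k) T).
    rewrite scalemxAr -CA mulmxA mulmxE -exprD -mulnSr mulnC exprM cycle_coords_cube.
    by rewrite -[1%:M]/(1 : 'M_5) expr1n mul1r.
  rewrite -scalemxAl -scalemxAr -!mulmxA; congr (_ *: (_ *m _)).
  rewrite (mulmxA (bmx 1%:M S)) commC -!mulmxA; congr (_ *m _).
  by rewrite !bmxM mul1mx mulmx1 TS.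
by case: gS => h; [apply: Or31|apply: Or32|apply: Or33]; apply: main.
Qed.
End Models.

Lemma de_moivre (R : realType) (t : R) m :
  Complex (cos t) (sin t) ^+ m = Complex (cos (t *+ m)) (sin (t *+ m)).
Proof.
elim: m => [|m IH]; first by rewrite expr0 mulr0n cos0 sin0.
rewrite exprS IH mulrS cosD sinD; apply/eqP; rewrite eq_complex /= eqxx /=.
by rewrite [X in _ == X]addrC.
Qed.

(** The identity 1 - cos(2 u) = 2 sin(u)^2 reduces the claim to sin(pi i / k) > 0 for 0 < i < k. *)
Lemma xi_primitive (R : realType) k : (0 < k)%N -> k.-primitive_root (xi R k).
Proof.
move=> k0; apply/andP; split=> //; apply/forallP => i; rewrite unity_rootE de_moivre.
have k0' : 0 < k%:R :> R by rewrite ltr0n.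
apply/eqP; have [ik|ik] := eqVneq i.+1 k.
  apply/eqP; rewrite ik -[_ *+ k]mulr_natr divfK ?gt_eqF // mulr_natl.
  by rewrite cos2pi sin2pi.
apply/negP => /eqP[]; rewrite -[X in X = _]/(cos _).
have -> : 2 * pi / k%:R *+ i.+1 = (pi / k%:R *+ i.+1) *+ 2 :> R.
  by rewrite -mulrnA mulnC mulrnA; congr (_ *+ _); rewrite mulr2n; field; rewrite gt_eqF.
have -> : pi / k%:R *+ i.+1 = pi * (i.+1%:R / k%:R) :> R.
  by rewrite -mulr_natr mulrAC mulrA.
rewrite cos_mulr2n cos2sin2; set s := sin _ => h.
have s0 : 0 < s.
  apply: sin_gt0_pi; rewrite mulr_gt0 ?pi_gt0 ?divr_gt0 ?ltr0n //=.
  by rewrite gtr_pMr ?pi_gt0 // ltr_pdivrMr // mul1r ltr_nat ltn_neqAle ik ltn_ord.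
have : s ^+ 2 *+ 2 = 0.
  by transitivity (1 - ((1 - s ^+ 2) *+ 2 - 1)); [ring | rewrite h subrr].
by move/eqP; rewrite mulrn_eq0 expf_eq0 /= gt_eqF.
Qed.

(** * Projective linear groups *)

Local Open Scope classical_set_scope.
Local Open Scope quotient_scope.
Local Open Scope card_scope.
Local Open Scope ring_scope.

Section ProjectiveLinearGroup.
Variables (K : fieldType) (n : nat).
Implicit Types (A B : 'M[K]_n) (f g : PGL K n) (v : 'cV[K]_n) (X : set (proj K n)).

Lemma PGL_class_pi A (uA : A \in unitmx) : PGL_class A = \pi_(PGL K n) (exist _ A uA).
Proof.
by rewrite /PGL_class; congr (\pi_(PGL K n) _); apply/val_inj; rewrite insubdK.
Qed.

Lemma PGL_classM A B : A \in unitmx -> B \in unitmx ->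
  PGL_class (A *m B) = (PGL_class A * PGL_class B)%g.
Proof.
move=> uA uB; have uAB : A *m B \in unitmx by rewrite unitmx_mul uA.
rewrite !PGL_class_pi; apply: esym; rewrite [LHS]PGL_pi_mul.
by congr (\pi_(PGL K n) _); apply/val_inj.
Qed.

Lemma PGL_classP A B : A \in unitmx -> B \in unitmx ->
  PGL_class A = PGL_class B <-> proportional A B.
Proof. by move=> uA uB; rewrite !PGL_class_pi; apply: PGL_piP. Qed.

Lemma PGL_class_repr f : PGL_class (val (repr f)) = f.
Proof. by rewrite (PGL_class_pi (valP (repr f))) -[RHS]reprK; congr (\pi_(PGL K n) _);
  apply/val_inj. Qed.

Lemma PGL_class1 : PGL_class (1%:M : 'M[K]_n) = 1%g.
Proof. by rewrite (PGL_class_pi (unitmx1 K n)); congr (\pi_(PGL K n) _); apply/val_inj. Qed.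

Lemma is_subgroupP (G : groupType) (H : set G) : is_subgroup H <->
  [/\ H 1%g, forall x y, H x -> H y -> H (x * y)%g & forall x, H x -> H x^-1%g].
Proof.
split=> [[/set_mem H1 Hdiv]|[H1 HM HV]]; last first.
  split; first exact/mem_set.
  by move=> x y /set_mem Hx /set_mem Hy; apply/mem_set/HM => //; apply: HV.
have HD x y : H x -> H y -> H (x / y)%g.
  by move=> Hx Hy; apply/set_mem/Hdiv; apply/mem_set.
have HV x : H x -> H x^-1%g by move=> Hx; rewrite -[x^-1%g]mul1g; apply: HD.
by split=> // x y Hx Hy; rewrite -[y]invgK; apply/HD/HV.
Qed.

Lemma PGL_gen_subgroup (s : seq 'M[K]_n) : is_subgroup (PGL_gen s).
Proof.
apply/is_subgroupP; split=> [H [/is_subgroupP[]]//|x y Gx Gy H sH|x Gx H sH];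
  have [/is_subgroupP[_ HM HV] _] := sH.
- by apply: HM; [exact: Gx | exact: Gy].
- by apply: HV; exact: Gx.
Qed.

Lemma PGL_gen_class (s : seq 'M[K]_n) A : A \in s -> PGL_gen s (PGL_class A).
Proof. by move=> sA; apply: sub_gen_smallest; exists A. Qed.

Lemma PGL_gen_mul (s : seq 'M[K]_n) A B : A \in unitmx -> B \in unitmx ->
  PGL_gen s (PGL_class A) -> PGL_gen s (PGL_class B) -> PGL_gen s (PGL_class (A *m B)).
Proof. by move=> uA uB gA gB; rewrite PGL_classM //; have /is_subgroupP[_ + _] := PGL_gen_subgroup
  s; apply. Qed.

Lemma PGL_act1 p : PGL_act (1%g : PGL K n) p = p.
Proof.
rewrite -PGL_class1 (PGL_class_pi (unitmx1 K n)) -[p]reprK PGL_act_pi.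
by congr (\pi_(proj K n) _); apply/val_inj; rewrite /= mul1mx.
Qed.

Lemma PGL_actM f g p : PGL_act (f * g)%g p = PGL_act f (PGL_act g p).
Proof.
rewrite -[f]reprK -[g]reprK -[p]reprK [(_ * _)%g]PGL_pi_mul.
rewrite (PGL_act_pi (repr g)) (PGL_act_pi (repr f)) PGL_act_pi.
by congr (\pi_(proj K n) _); apply/val_inj; rewrite /= mulmxA.
Qed.

Lemma Aut_hypP X f : Aut_hyp X f <-> forall p, X (PGL_act f p) <-> X p.
Proof.
split=> [fX p|fX].
  split=> [|Xp]; last by rewrite -fX; exists p.
  rewrite -[in X in X -> _]fX => -[q Xq] /(congr1 (PGL_act f^-1%g)).
  by rewrite -!PGL_actM mulVg !PGL_act1 => <-.
apply/seteqP; split=> [_ [p Xp <-]|p Xp]; first exact/fX.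
exists (PGL_act f^-1%g p); first by apply/fX; rewrite -PGL_actM mulgV PGL_act1.
by rewrite -PGL_actM mulgV PGL_act1.
Qed.

Lemma Aut_hyp_subgroup X : is_subgroup (Aut_hyp X).
Proof.
apply/is_subgroupP; split=> [|f g /Aut_hypP fX /Aut_hypP gX|f /Aut_hypP fX]; apply/Aut_hypP => p.
- by rewrite PGL_act1.
- by rewrite PGL_actM fX.
- by rewrite -fX -PGL_actM mulgV PGL_act1.
Qed.
End ProjectiveLinearGroup.

(** * Model matrices as words in the generators *)

Section DiagonalFive.
Variable K : numClosedFieldType.

Lemma diag5_vec5 (a b c d e x y w t s : K) : diag5 a b c d e *m vec5 x y w t s =
  vec5 (a * x) (b * y) (c * w) (d * t) (e * s).
Proof.
apply/colP => -[[|[|[|[|[|//]]]]] hi]; rewrite mul_diag_mx !mxE //.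
Qed.

Lemma diag5M (a b c d e a' b' c' d' e' : K) : diag5 a b c d e *m diag5 a' b' c' d' e' =
  diag5 (a * a') (b * b') (c * c') (d * d') (e * e').
Proof.
by apply: mulmx_ext => v; rewrite [v]vec5E -mulmxA !diag5_vec5 !mulrA.
Qed.

Lemma diag5X (a b c d e : K) k : diag5 a b c d e ^+ k =
  diag5 (a ^+ k) (b ^+ k) (c ^+ k) (d ^+ k) (e ^+ k).
Proof.
elim: k => [|k IH]; last by rewrite !exprS IH -mulmxE diag5M.
by apply: mulmx_ext => v; rewrite [v]vec5E !expr0 diag5_vec5 !mul1r mul1mx.
Qed.

Lemma diag5_fermat (a b c d e : K) k m m' :
  diag5 (a ^+ k) (b ^+ k) (c ^+ k) (d ^+ m) (e ^+ m') =
  diag5 a b c 1 1 ^+ k *m diag5 1 1 1 d 1 ^+ m *m diag5 1 1 1 1 e ^+ m'.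
Proof. by rewrite !diag5X !diag5M !expr1n !mulr1 !mul1r. Qed.

Lemma diag5_dihedral (a b c d e : K) k m m' :
  diag5 (a ^+ k) (b ^+ k) (c ^+ k) (d ^+ m * e ^+ m') (d ^+ m * (e ^+ m') ^+ 2) =
  diag5 a b c 1 1 ^+ k *m diag5 1 1 1 d d ^+ m *m diag5 1 1 1 e (e ^+ 2) ^+ m'.
Proof. by rewrite !diag5X !diag5M !expr1n (exprAC e) !mulr1 !mul1r. Qed.

Lemma diag5_loop (a b c d e : K) k m m' :
  diag5 (d ^+ m * e ^+ m') (d ^+ m) (a ^+ k) (b ^+ k) (c ^+ k) =
  diag5 d d 1 1 1 ^+ m *m diag5 e 1 1 1 1 ^+ m' *m diag5 1 1 a b c ^+ k.
Proof. by rewrite !diag5X !diag5M !expr1n !mulr1 !mul1r. Qed.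

Lemma P45_vec5 (x y w t s : K) : P45 K *m vec5 x y w t s = vec5 x y w s t.
Proof.
rewrite [LHS]vec5E /P45 -row_permE !mxE tpermL tpermR !inordK //=.
by rewrite !tpermD -?val_eqE ?inordK //= !inordK.
Qed.

Lemma P345_vec5 (x y w t s : K) : P345 K *m vec5 x y w t s = vec5 x y t s w.
Proof.
have u : uniq [:: inord 2; inord 3; inord 4 : 'I_5].
  by rewrite /= !inE -!val_eqE /= !inordK.
have [e0 e1 e2] := cyc3E u.
rewrite [LHS]vec5E /P345 -row_permE !mxE e0 e1 e2 !inordK //=.
have e k : (k < 2)%N -> cyc3 (inord 2) (inord 3) (inord 4) (inord k) = inord k :> 'I_5.
  move=> k2; rewrite /cyc3 permM !tpermD // -val_eqE /= !inordK //; lia.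
by rewrite !e // !inordK.
Qed.

(* The generators of [G12] put the binary part in the first two coordinates. *)
Definition binary_first : 'M[K]_5 := \matrix_(i, j) (nth 0%N [:: 3; 4; 0; 1; 2]%N i == j)%:R.

Lemma binary_first_vec5 (x y w t s : K) : binary_first *m vec5 x y w t s = vec5 t s x y w.
Proof.
apply/colP => -[[|[|[|[|[|//]]]]] hi]; rewrite mxE big_ord5 !mxE !inordK //=;
  by rewrite !(mul0r, mul1r, add0r, addr0).
Qed.

Lemma binary_first_unit : binary_first \in unitmx.
Proof.
(* The underlying permutation is a 5-cycle. *)
have Q5 : binary_first *m binary_first ^+ 4 = 1%:M.
  apply: mulmx_ext => v; rewrite !exprS expr0 mulr1 -!mulmxE -!mulmxA [v]vec5E.
  by rewrite !binary_first_vec5 mul1mx.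
by have [] := mulmx1_unit Q5.
Qed.

Lemma bmx_diag5 (z a b : K) k : bmx (klein_diag z k) (mx2 a 0 0 b) =
  diag5 (z ^+ k) ((z ^- 4) ^+ k) ((z ^+ 3) ^+ k) a b.
Proof.
apply: mulmx_ext => v; rewrite [v]vec5E bmx_vec5 diag5_vec5.
have -> (t s : K) : \col_i nth 0 [:: t; s] i = vec2 t s by [].
rewrite mx2_vec2 !mul_diag_mx !mxE !inordK //=.
by rewrite !mul0r addr0 add0r.
Qed.

Lemma bmx_antidiag5 (z a b : K) k : bmx (klein_diag z k) (mx2 0 a b 0) =
  diag5 (z ^+ k) ((z ^- 4) ^+ k) ((z ^+ 3) ^+ k) a b *m P45 K.
Proof.
apply: mulmx_ext => v; rewrite [v]vec5E -mulmxA bmx_vec5 P45_vec5 diag5_vec5.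
have -> (t s : K) : \col_i nth 0 [:: t; s] i = vec2 t s by [].
rewrite mx2_vec2 !mul_diag_mx !mxE !inordK //=.
by rewrite !mul0r addr0 add0r.
Qed.
End DiagonalFive.

Section Generated.
Variable K : numClosedFieldType.
Implicit Types (A B : 'M[K]_5) (s : seq 'M[K]_5).

(** Invertibility is carried along because [PGL_class] sends singular matrices to 1 and is
    multiplicative on invertible ones. *)
Definition gen_mx s A := A \in unitmx /\ PGL_gen s (PGL_class A).

Lemma gen_mxM s A B : gen_mx s A -> gen_mx s B -> gen_mx s (A *m B).
Proof. by move=> [uA gA] [uB gB]; split; [rewrite unitmx_mul uA | apply: PGL_gen_mul]. Qed.

Lemma gen_mxX s A k : gen_mx s A -> gen_mx s (A ^+ k).
Proof.
move=> gA; elim: k => [|k IH]; last by rewrite exprS; apply: gen_mxM.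
rewrite expr0; split; first exact: unitmx1.
by rewrite PGL_class1; have /is_subgroupP[] := PGL_gen_subgroup s.
Qed.
End Generated.

Section GeneratedModels.
Variable R : realType.
Local Notation z := (xi R 13).
Implicit Types N : 'M[R[i]]_5.

Let gen9 A : A \in G9_gens R -> gen_mx (G9_gens R) A.
Proof. by move=> gA; split; [apply: gens_unit; rewrite mem_cat gA | apply: PGL_gen_class]. Qed.

Let gen12 A : A \in G12_gens R -> gen_mx (G12_gens R) A.
Proof. by move=> gA; split; [apply: gens_unit; rewrite !mem_cat gA orbT | apply: PGL_gen_class]. Qed.

Let gen16 A : A \in G16_gens R -> gen_mx (G16_gens R) A.
Proof. by move=> gA; split; [apply: gens_unit; rewrite !mem_cat gA !orbT | apply: PGL_gen_class]. Qed.

Let xi_root k (a : R[i]) : (0 < k)%N -> a ^+ k = 1 -> exists m, a = xi R k ^+ m.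
Proof. by move=> k0 ak; have [i ->] := prim_rootP (xi_primitive R k0) ak; exists i. Qed.

Lemma fermat_generated N : model z (@is_fermat _) N -> gen_mx (G9_gens R) N.
Proof.
move=> [j [k [M [[a [b [a5 b5 Mab]]] ->]]]]; apply: gen_mxM.
  by apply/gen_mxX/gen9; rewrite inE eqxx.
have [[m am] [m' bm']] := (xi_root (isT : 0 < 5)%N a5, xi_root (isT : 0 < 5)%N b5).
have gD : gen_mx (G9_gens R) (diag5 (z ^+ k) ((z ^- 4) ^+ k) ((z ^+ 3) ^+ k) a b).
  rewrite am bm' diag5_fermat; apply: gen_mxM; first apply: gen_mxM;
    by apply/gen_mxX/gen9; rewrite !inE eqxx ?orbT.
have gP : gen_mx (G9_gens R) (P45 _) by apply: gen9; rewrite !inE eqxx ?orbT.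
case: Mab => ->; first by rewrite bmx_diag5; exact: gD.
by rewrite bmx_antidiag5; exact: gen_mxM gD gP.
Qed.

Lemma dihedral_generated N : model z (@is_dihedral _) N -> gen_mx (G16_gens R) N.
Proof.
move=> [j [k [M [[a [w [a5 w3 Maw]]] ->]]]]; apply: gen_mxM.
  by apply/gen_mxX/gen16; rewrite !inE eqxx orbT.
have [[m am] [m' wm']] := (xi_root (isT : 0 < 5)%N a5, xi_root (isT : 0 < 3)%N w3).
have gD : gen_mx (G16_gens R)
    (diag5 (z ^+ k) ((z ^- 4) ^+ k) ((z ^+ 3) ^+ k) (a * w) (a * w ^+ 2)).
  rewrite am wm' diag5_dihedral; apply: gen_mxM; first apply: gen_mxM;
    by apply/gen_mxX/gen16; rewrite !inE eqxx ?orbT.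
have gP : gen_mx (G16_gens R) (P45 _) by apply: gen16; rewrite !inE eqxx ?orbT.
case: Maw => ->; first by rewrite bmx_diag5; exact: gD.
by rewrite bmx_antidiag5; exact: gen_mxM gD gP.
Qed.

Lemma loop_generated N : model z (@is_loop _) N ->
  exists2 N', binary_first _ *m N = N' *m binary_first _ & gen_mx (G12_gens R) N'.
Proof.
move=> [j [k [M [[a [w [a5 w4 ->]]] ->]]]].
exists (P345 _ ^+ j *m diag5 (a * w) a (z ^+ k) ((z ^- 4) ^+ k) ((z ^+ 3) ^+ k)).
  have QC : binary_first _ *m cycle_coords R[i] ^+ j = P345 _ ^+ j *m binary_first _.
    elim: j => [|j IH]; first by rewrite !expr0 mulmx1 mul1mx.
    rewrite !exprSr -!mulmxE mulmxA IH -!mulmxA; congr (_ *m _); apply: mulmx_ext => v.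
    by rewrite [v]vec5E -!mulmxA cycle_coordsE !binary_first_vec5 P345_vec5.
  rewrite mulmxA QC -!mulmxA; congr (_ *m _); apply: mulmx_ext => v.
  by rewrite bmx_diag5 [v]vec5E -!mulmxA diag5_vec5 !binary_first_vec5 diag5_vec5.
apply: gen_mxM; first by apply/gen_mxX/gen12; rewrite !inE eqxx ?orbT.
have [[m am] [m' wm']] := (xi_root (isT : 0 < 5)%N a5, xi_root (isT : 0 < 4)%N w4).
rewrite am wm' diag5_loop; apply: gen_mxM; first apply: gen_mxM;
  by apply/gen_mxX/gen12; rewrite !inE eqxx ?orbT.
Qed.
End GeneratedModels.

(** * Finiteness and order of the automorphism group *)

Section FiniteSubgroup.
Variables (G : groupType) (H : set G) (n p : nat) (c : G).

(** Left translation by [c] permutes the finite set [H] without fixed points and generates a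
    p-group, so the fixed-point congruence applies. *)
Lemma order_dvd_card : is_subgroup H -> H #= `I_n -> prime p -> H c ->
  (c ^+ p = 1)%g -> c <> 1%g -> (p %| n)%N.
Proof.
move=> /is_subgroupP[_ HM _] Hn pp Hc cp c1.
have [X HX] : exists X : {fset G}, H = [set` X].
  by apply/finite_fsetP/finite_setP; exists n.
have cX (x : X) : (c * val x)%g \in X.
  suff : H (c * val x)%g by rewrite HX.
  by apply: HM => //; rewrite HX /=; exact: valP.
pose f (x : X) : X := [` cX x]%fset.
have finj : injective f by move=> x y /(congr1 val)/mulgI/val_inj.
pose s := perm finj.
have sX k (x : X) : val ((s ^+ k)%g x) = (c ^+ k * val x)%g.
  elim: k => [|k IH]; first by rewrite expg0 perm1 mul1g.
  by rewrite expgSr permM permE /= IH expgS mulgA.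
have sp : (s ^+ p = 1)%g by apply/perm.permP => x; apply/val_inj; rewrite sX cp mul1g perm1.
have pS : (p.-group <[s]>)%g.
  rewrite /pgroup -[#|_|]/(#[s]%g); apply: pnat_dvd (pnat_id pp).
  by rewrite order_dvdn sp.
have aS : [acts <[s]>%g, on [set: X]%SET | 'P] by apply/actsP => ? _ x; rewrite !inE.
have := pgroup_fix_mod pS aS; rewrite cardsT.
have -> : ('Fix_([set: X] | 'P)(<[s]>))%g = finset.set0.
  apply/finset.setP => x; rewrite finset.inE finset.in_set0; apply/negP => /andP[_ /afixP h].
  have sx : s x = x by apply: h; exact: cycle_id.
  by apply: c1; apply: (mulIg (val x)); rewrite mul1g -[RHS](congr1 val sx) -[s]expg1 sX.
rewrite cards0 mod0n => /eqP; rewrite -/(dvdn p _).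
by move: Hn; rewrite HX => /card_eq_fsetP <-; rewrite cardfE.
Qed.
End FiniteSubgroup.

Section AutomorphismForms.
Variable K : numClosedFieldType.
Implicit Types (F : {mpoly K[5]}) (A B N : 'M[K]_5) (v : 'cV[K]_5).

Let zero_locus_pi F (x : nzvec K 5) : F \is 5.-homog ->
  zero_locus F (\pi_(proj K 5) x) <-> ev F (val x) = 0.
Proof.
move=> hF; rewrite /zero_locus /= -[_.@[_]]/(ev F (val (repr (\pi_(proj K 5) x)))).
have [c c0 ->] := proj_repr_pi x; rewrite (ev_homog _ _ hF).
by split=> [/eqP|->]; rewrite ?mulr0 // mulf_eq0 expf_eq0 (negPf c0) /= => /eqP.
Qed.

(** Homogeneity of [F] and of its derivatives carries the Jacobian criterion from chosen
    representatives to all nonzero vectors. *)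
Lemma smooth_hypersurface_form (X : set (proj K 5)) : smooth_hypersurface 5 X ->
  exists F, [/\ F \is 5.-homog, smooth F & X = zero_locus F].
Proof.
move=> [F [F0 hF XF smX]]; exists F; split=> // v v0 Fv.
pose x : nzvec K 5 := exist _ v v0.
have Xx : X (\pi_(proj K 5) x) by rewrite XF; apply/zero_locus_pi.
have [j] := smX _ Xx.
apply: contra_neq => gv.
rewrite -[_.@[_]]/(ev (mderiv j F) (val (repr (\pi_(proj K 5) x)))).
have [c c0 ->] := proj_repr_pi x.
have := grad_homog v hF c0; rewrite gv scaler0 => /rowP/(_ j).
by rewrite !mxE.
Qed.

Let ev0 F : F \is 5.-homog -> ev F 0 = 0.
Proof. by move=> hF; rewrite -(scale0r (0 : 'cV[K]_5)) (ev_homog _ _ hF) expr0n mul0r. Qed.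

Lemma Aut_hyp_class F A : F \is 5.-homog -> A \in unitmx ->
  Aut_hyp (zero_locus F) (PGL_class A) <-> forall v, ev F v = 0 <-> ev F (A *m v) = 0.
Proof.
move=> hF uA; rewrite (PGL_class_pi uA) Aut_hypP; split=> [h v|h p].
  have [->|v0] := eqVneq v 0; first by rewrite mulmx0 ev0.
  have := h (\pi_(proj K 5) (exist _ v v0)).
  by rewrite PGL_act_pi !zero_locus_pi //= => ->.
by rewrite -[p]reprK PGL_act_pi !zero_locus_pi //= -h.
Qed.

Lemma Aut_hyp_repr F f : F \is 5.-homog -> smooth F -> Aut_hyp (zero_locus F) f ->
  exists2 c, c != 0 & forall v, ev F (val (repr f) *m v) = c * ev F v.
Proof.
move=> hF smF; rewrite -{1}[f]PGL_class_repr => /(Aut_hyp_class hF (valP (repr f))) zF.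
exact: same_zeros_prop hF isT smF zF.
Qed.

Lemma PGL_class_conj A B N a : A \in unitmx -> B \in unitmx -> a != 0 ->
  A *m B = a *: (B *m N) ->
  N \in unitmx /\ (PGL_class A = PGL_class B * PGL_class N * (PGL_class B)^-1)%g.
Proof.
move=> uA uB a0 AB; have uN : N \in unitmx.
  have -> : N = a^-1 *: (invmx B *m (A *m B)).
    by rewrite AB -scalemxAr scalerA mulVf // scale1r mulKmx.
  by rewrite unitmxZ ?unitfE ?invr_eq0 // !unitmx_mul unitmx_inv uA uB.
split=> //; apply: (mulIg (PGL_class B)); rewrite mulgVK -!PGL_classM //.
apply/PGL_classP; rewrite ?unitmx_mul ?uA ?uB //.
by exists a.
Qed.
End AutomorphismForms.

Section FiniteModels.
Variables (K : numClosedFieldType) (z u : K).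
Hypotheses (z13 : z ^+ 13 = 1) (pu : 60.-primitive_root u).
Implicit Types (M : 'M[K]_2) (N : 'M[K]_5).

(** A common finite bound for the three types, with 60 the least common multiple of 3, 4 and 5. *)
Definition is_monomial M := exists a b, [/\ a ^+ 60 = 1, b ^+ 60 = 1 &
  M = mx2 a 0 0 b \/ M = mx2 0 a b 0].

Let root60 (a : K) k m : (k * m = 60)%N -> a ^+ k = 1 -> a ^+ 60 = 1.
Proof. by move=> <- ak; rewrite exprM ak expr1n. Qed.

Lemma fermat_monomial M : is_fermat M -> is_monomial M.
Proof.
move=> [a [b [a5 b5 Mab]]]; exists a, b; split=> //.
  exact: (@root60 _ 5 12).
exact: (@root60 _ 5 12).
Qed.

Lemma loop_monomial M : is_loop M -> is_monomial M.
Proof.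
move=> [a [w [a5 w4 Maw]]]; exists (a * w), a; split; last by left.
  by rewrite exprMn (@root60 _ 5 12) // (@root60 _ 4 15) // mulr1.
exact: (@root60 _ 5 12).
Qed.

Lemma dihedral_monomial M : is_dihedral M -> is_monomial M.
Proof.
move=> [a [w [a5 w3 Maw]]]; exists (a * w), (a * w ^+ 2); split=> //.
  by rewrite exprMn (@root60 _ 5 12) // (@root60 _ 3 20) // mulr1.
by rewrite exprMn exprAC (@root60 _ 5 12) // (@root60 _ 3 20) // expr1n mulr1.
Qed.

Lemma finite_monomial_models : finite_set [set N | model z is_monomial N].
Proof.
pose N (t : ('I_3 * 'I_13) * (bool * ('I_60 * 'I_60))) := cycle_coords K ^+ t.1.1 *m
  bmx (klein_diag z t.1.2) (let a := u ^+ t.2.2.1 in let b := u ^+ t.2.2.2 in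
    if t.2.1 then mx2 a 0 0 b else mx2 0 a b 0).
apply: (@sub_finite_set _ _ (range N)); last exact/finite_image/finite_finset.
move=> _ [j [k [M [[a [b [a60 b60 Mab]] ->]]]]].
have [m am] := prim_rootP pu a60; have [m' bm'] := prim_rootP pu b60.
have -> : cycle_coords K ^+ j = cycle_coords K ^+ (j %% 3).
  rewrite {1}(divn_eq j 3) exprD mulnC exprM cycle_coords_cube.
  by rewrite -[1%:M]/(1 : 'M_5) expr1n mul1r.
rewrite klein_diag_mod //.
pose t e : ('I_3 * 'I_13) * (bool * ('I_60 * 'I_60)) := ((inord (j %% 3), inord (k %% 13)), (e, (m,
  m'))).
have tE e : N (t e) = cycle_coords K ^+ (j %% 3) *m bmx (klein_diag z (k %% 13))
    (if e then mx2 a 0 0 b else mx2 0 a b 0).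
  by rewrite /N /= !inordK ?ltn_pmod // -am -bm'.
by case: Mab => ->; [exists (t true)|exists (t false)]; rewrite ?tE.
Qed.

End FiniteModels.

Lemma PGL_classX (K : fieldType) n (A : 'M[K]_n.+1) k : A \in unitmx ->
  PGL_class (A ^+ k) = (PGL_class A ^+ k)%g.
Proof.
move=> uA; elim: k => [|k IH]; first by rewrite expr0 expg0 PGL_class1.
by rewrite exprS expgS -IH -mulmxE PGL_classM // -[_ \in unitmx]/(A ^+ k \is a GRing.unit) unitrX.
Qed.

Section Automorphisms.
Variable R : realType.
Local Notation K := (R[i]).
Local Notation z := (xi R 13).
Implicit Types (X : set (proj K 5)) (F : {mpoly K[5]}) (b x y : PGL K 5).

Lemma finite_model P : (forall M, P M -> is_monomial M) -> finite_set [set N : 'M[K]_5 | model z P N].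
Proof.
move=> PM; have pz := xi_primitive R (isT : 0 < 13)%N.
have := finite_monomial_models (prim_expr_order pz) (xi_primitive R (isT : 0 < 60)%N).
apply: sub_finite_set => N [j [k [M [/PM mM ->]]]].
by exists j, k, M.
Qed.

Lemma conjugate_isomorphic (H G : set (PGL K 5)) b : is_subgroup H ->
  (forall x, H x -> G (b^-1 * x * b)%g) ->
  exists H', [/\ is_subgroup H', H' `<=` G & isomorphic H H'].
Proof.
move=> /is_subgroupP[H1 HM HV] HG; pose f x := (b^-1 * x * b)%g.
have fM x y : f (x * y)%g = (f x * f y)%g by rewrite /f !mulgA mulgK.
have f1 : f 1%g = 1%g by rewrite /f mulg1 mulVg.
exists (f @` H); split; last first.
- exists f; last by move=> x y _ _; apply: fM.
  split=> [x Hx|x y _ _ /mulIg/mulgI//|y Hy //].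
  by exists x.
- by move=> _ [x Hx <-]; apply: HG.
apply/is_subgroupP; split.
- by exists 1%g.
- by move=> _ _ [x Hx <-] [y Hy <-]; exists (x * y)%g; [apply: HM|].
move=> _ [x Hx <-]; exists x^-1%g; first exact: HV.
by apply/(mulgI (f x)); rewrite -fM !mulgV.
Qed.

Lemma Aut_hyp_model F B P x : F \is 5.-homog -> smooth F -> B \in unitmx ->
  conjugates_into F B (model z P) -> Aut_hyp (zero_locus F) x ->
  exists N, [/\ N \in unitmx, model z P N & x = (PGL_class B * PGL_class N * (PGL_class B)^-1)%g].
Proof.
move=> hF smF uB FB xF; have [c c0 xc] := Aut_hyp_repr hF smF xF.
have ux := valP (repr x); have [N [a [a0 PN xN]]] := FB _ _ ux c0 xc.
have [uN xE] := PGL_class_conj ux uB a0 xN.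
by exists N; split=> //; rewrite -[LHS]PGL_class_repr xE.
Qed.

Lemma finite_Aut_hyp F B P : F \is 5.-homog -> smooth F -> B \in unitmx ->
  (forall M, P M -> is_monomial M) -> conjugates_into F B (model z P) ->
  finite_set (Aut_hyp (zero_locus F)).
Proof.
move=> hF smF uB PM FB; have := finite_model PM.
move/(finite_image (fun N => (PGL_class B * PGL_class N * (PGL_class B)^-1)%g)).
apply: sub_finite_set => x /(Aut_hyp_model hF smF uB FB)[N [_ PN ->]].
by exists N.
Qed.

Lemma dvd3_card_Aut_hyp F B n : F \is 5.-homog -> B \in unitmx ->
  (forall v, ev F (B *m (cycle_coords K *m v)) = ev F (B *m v)) ->
  Aut_hyp (zero_locus F) #= `I_n -> (3 %| n)%N.
Proof.
move=> hF uB FB Fn; pose A := B *m cycle_coords K *m invmx B.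
have uBC : B *m cycle_coords K \in unitmx by rewrite unitmx_mul uB cycle_unit.
have uA : A \in unitmx by rewrite unitmx_mul uBC unitmx_inv.
have AE : PGL_class A = (PGL_class B * PGL_class (cycle_coords K) * (PGL_class B)^-1)%g.
  have AB : A *m B = 1 *: (B *m cycle_coords K) by rewrite scale1r mulmxKV.
  by have [] := PGL_class_conj uA uB (oner_neq0 _) AB.
apply: (@order_dvd_card _ _ _ 3 (PGL_class A)) Fn _ _ _ _ => //.
- exact: Aut_hyp_subgroup.
- apply/Aut_hyp_class => // v.
  by rewrite -[v in X in X <-> _](mulKVmx uB) -FB !mulmxA.
- rewrite AE 2!expgS expg1 !mulgA !mulgKV -!mulgA.
  have -> : (PGL_class (cycle_coords K) * (PGL_class (cycle_coords K) * (PGL_class (cycle_coords K)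
    * (PGL_class B)^-1)))%g
    = (PGL_class (cycle_coords K) ^+ 3 * (PGL_class B)^-1)%g by rewrite 2!expgS expg1 !mulgA.
  by rewrite -PGL_classX ?cycle_unit // cycle_coords_cube PGL_class1 mul1g mulgV.
rewrite AE => /(congr1 (fun x => (PGL_class B)^-1 * x * PGL_class B)%g).
rewrite mulg1 mulVg !mulgA mulVg mul1g mulgKV -PGL_class1 => /PGL_classP[]; rewrite ?unitmx1
  ?cycle_unit //.
(* The permutation matrix is not scalar: its (0, 1) entry is 1. *)
move=> c _ /matrixP/(_ (inord 0) (inord 1)); rewrite !mxE.
have u : uniq [:: inord 0; inord 1; inord 2 : 'I_5] by rewrite /= !inE -!val_eqE /= !inordK.
have [-> _ _] := cyc3E u; rewrite eqxx -val_eqE /= !inordK // mulr0 => /eqP.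
by rewrite oner_eq0.
Qed.

End Automorphisms.

Theorem theorem5p15 (R : realType) (X : set (proj R[i] 5))
    (smoothX : smooth_hypersurface 5 X)
    (ord13 : exists2 f, Aut_hyp X f & has_order f 13) :
  (exists G : set (PGL R[i] 5),
     [/\ G = G9 R \/ G = G12 R \/ G = G16 R &
         exists H : set (PGL R[i] 5),
           [/\ is_subgroup H, H `<=` G & isomorphic (Aut_hyp X) H]])
  /\ (exists2 n : nat, Aut_hyp X #= `I_n & (3 %| n)%N).
Proof.
have [F [hF smF XF]] := smooth_hypersurface_form smoothX.
move: ord13; rewrite {}XF => -[f fF [_ f13 fk]] {X smoothX}.
have [c c0 fc] := Aut_hyp_repr hF smF fF; have uf := valP (repr f).
have uf13 : val (repr f) ^+ 13 \in unitmx by apply: unitrX uf.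
(* Order 13 in PGL only makes the 13th power of the lift a scalar; [normal_form] rescales the
   lift. *)
have [mu mu0 fmu] : proportional (val (repr f) ^+ 13) 1%:M.
  apply/(PGL_classP uf13 (unitmx1 _ _)).
  by rewrite PGL_classX // PGL_class_repr f13 PGL_class1.
have fns a : val (repr f) <> a%:M.
  move=> fa; apply: (fk 1%N) => //; rewrite expg1 -[f]PGL_class_repr -PGL_class1.
  apply/PGL_classP; rewrite ?unitmx1 //; exists a; last by rewrite fa scalemx1.
  apply: contraTneq uf => a0; rewrite fa a0 unitmxE det_scalar expr0n unitr0 //.
rewrite scalemx1 in fmu.
have pz := xi_primitive R (isT : 0 < 13)%N.
have [B uB [q [g [smg FB]]]] := normal_form hF smF pz fc fmu mu0 fns.
have [B' uB' [FC FP]] := normal_form_models uB smg pz FB.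
have sub := Aut_hyp_subgroup (zero_locus F).
split; last first.
  have [n Fn] : finite_set (Aut_hyp (zero_locus F)).
    case: FP => FP.
    - exact: finite_Aut_hyp hF smF uB' (@fermat_monomial _) FP.
    - exact: finite_Aut_hyp hF smF uB' (@loop_monomial _) FP.
    - exact: finite_Aut_hyp hF smF uB' (@dihedral_monomial _) FP.
  by exists n => //; apply: dvd3_card_Aut_hyp hF uB' FC Fn.
pose b := PGL_class B'; case: FP => FP.
- exists (G9 R); split; first by left.
  apply: (@conjugate_isomorphic _ _ _ b) => // x /(Aut_hyp_model hF smF uB' FP)[N [uN PN ->]].
  by rewrite !mulgA mulVg mul1g mulgKV; have [] := fermat_generated PN.
- exists (G12 R); split; first by right; left.
  pose Q := @binary_first R[i]; have uQ : Q \in unitmx := binary_first_unit R[i].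
  (* The factor [Q] reorders the coordinates to those in which the generators of [G12] are
     written. *)
  apply: (@conjugate_isomorphic _ _ _ (b * (PGL_class Q)^-1)%g) => // x /(Aut_hyp_model hF smF uB'
    FP)[N [uN PN ->]].
  have [N' QN [uN' gN']] := loop_generated PN.
  suff -> : ((b * (PGL_class Q)^-1)^-1 * (b * PGL_class N * b^-1) * (b * (PGL_class Q)^-1) =
    PGL_class N')%g by [].
  apply: (mulIg (PGL_class Q)); rewrite invMg invgK !mulgA !mulgKV.
  by rewrite -!PGL_classM // QN.
- exists (G16 R); split; first by right; right.
  apply: (@conjugate_isomorphic _ _ _ b) => // x /(Aut_hyp_model hF smF uB' FP)[N [uN PN ->]].
  by rewrite !mulgA mulVg mul1g mulgKV; have [] := dihedral_generated PN.
Qed.
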